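(* Assume (A1) and (A2) below. Then there exist constants $c<\infty$ and $C>0$, depending only on $f$ and on $(J_x)_{x\in\mathbb{Z}^2}$, such that for every infinite-volume Gibbs measure $\mu$ of the model described in the context and every $x\in\mathbb{Z}^2\setminus\{0\}$, \[ \bigl|\langle \cos(\theta_0-\theta_x)\rangle_\mu\bigr|\le c\,\|x\|_\infty^{-C}. \]
   Context: Spins are angles $\theta_u\in[0,2\pi)$ (i.e. points of the circle $\mathbb{S}^1$), $u\in\mathbb{Z}^2$, and differences of angles are taken mod $2\pi$. Coupling constants: $J_{u,v}=J_{u-v}$, where $(J_x)_{x\in\mathbb{Z}^2}$ satisfies $J_x=J_{-x}\ge 0$ and $\sum_{x\in\mathbb{Z}^2}J_x=1$. (A1): there exist $\alpha>4$ and $J\ge 0$ such that $J_x\le J\|x\|_1^{-\alpha}$ for all $x\ne 0$. (A2): the interaction $f:\mathbb{R}\to\mathbb{R}$ is continuous, $2\pi$-periodic and even (it already includes the inverse temperature). For finite $\Lambda\subset\mathbb{Z}^2$, let $\mathcal{E}_\Lambda$ be the set of unordered pairs $\{u,v\}$ of distinct vertices of $\mathbb{Z}^2$ with $\{u,v\}\cap\Lambda\ne\emptyset$. Given a boundary configuration $\bar\theta\in[0,2\pi)^{\mathbb{Z}^2}$, the finite-volume Gibbs measure $\mu^{\bar\theta}_\Lambda$ is the probability measure on configurations $\theta$ with $\theta_y=\bar\theta_y$ for $y\notin\Lambda$, and $(\theta_u)_{u\in\Lambda}$ having density proportional to $\exp\{\sum_{\{u,v\}\in\mathcal{E}_\Lambda}J_{u,v}f(\theta_u-\theta_v)\}$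 with respect to Lebesgue measure on $[0,2\pi)^\Lambda$. An infinite-volume Gibbs measure is a probability measure $\mu$ on $[0,2\pi)^{\mathbb{Z}^2}$ satisfying the DLR equations: for every finite $\Lambda$, the conditional distribution of $(\theta_u)_{u\in\Lambda}$ given $(\theta_y)_{y\notin\Lambda}=\bar\theta$ is $\mu^{\bar\theta}_\Lambda$ for $\mu$-a.e. $\bar\theta$. $\langle\cdot\rangle_\mu$ denotes expectation under $\mu$. *)

(* Defs.v *)
From HB Require Import structures.
From mathcomp Require Import all_boot all_order all_algebra.
From mathcomp Require Import all_classical all_reals all_analysis.
Set Implicit Arguments. Unset Strict Implicit. Unset Printing Implicit Defensive.
Import Order.TTheory GRing.Theory Num.Theory.
Import numFieldNormedType.Exports.
Local Open Scope classical_set_scope.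
Local Open Scope ring_scope.

Definition site := (int * int)%type.
Definition site0 : site := (0%Z, 0%Z).
Definition sub_site (u v : site) : site := (u.1 - v.1, u.2 - v.2).
Definition norm1 (x : site) : int := `|x.1| + `|x.2|.
Definition norminf (x : site) : int := Num.max `|x.1| `|x.2|.

Definition zrange (N : nat) : seq int :=
  [seq (i%:Z - N%:Z) | i <- iota 0 (N.*2).+1].
Definition box (N : nat) : seq site :=
  [seq (a, b) | a <- zrange N, b <- zrange N].

Section Model.
Variable R : realType.

Definition config := site -> R.

Definition cylinders : set (set config) :=
  [set A | exists (u : site) (B : set R), measurable B /\
           A = (fun th : config => th u) @^-1` B].
Definition Omega := g_sigma_algebraType cylinders.

Definition upd (th : config) (u : site) (t : R) : config :=
  fun v => if v == u then t else th v.

(* Hamiltonian-type sum over the pairs {u,v} meeting Lambda (Lambda = the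
   finite set of elements of the uniq sequence s):
   sum_{u in s} sum_{v notin s} J_{u-v} f(th_u - th_v)
   + 1/2 sum_{u in s} sum_{v in s, v <> u} J_{u-v} f(th_u - th_v);
   the infinite sum over v notin s is the limit of the box partial sums
   (it converges absolutely as sum J = 1 and f is bounded). *)
Definition energy (f : R -> R) (J : site -> R) (s : seq site) (th : config) : R :=
  limn (fun N : nat =>
    \sum_(u <- s) \sum_(v <- box N | v \notin s) J (sub_site u v) * f (th u - th v))
  + 2^-1 * \sum_(u <- s) \sum_(v <- s | v != u) J (sub_site u v) * f (th u - th v).

Fixpoint iint (s : seq site) (F : config -> \bar R) (th : config) : \bar R :=
  match s with
  | [::] => F th
  | u :: s' => (\int[@lebesgue_measure R]_(t in `[0%R, (2 * pi)%R[) iint s' F (upd th u t))%E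
  end.

Definition gibbs_kernel (f : R -> R) (J : site -> R) (s : seq site)
    (thb : config) (A : set config) : \bar R :=
  (iint s (fun th => ((\1_A th) * expR (energy f J s th))%:E) thb
   * ((fine (iint s (fun th => (expR (energy f J s th))%:E) thb))^-1)%:E)%E.

(* Infinite-volume Gibbs measure: a probability measure on [0,2pi)^{Z^2}
   (product sigma-algebra) satisfying the DLR equations mu = mu gamma_Lambda
   for every finite Lambda. *)
Definition is_gibbs (f : R -> R) (J : site -> R)
    (mu : probability Omega R) : Prop :=
  (forall u : site, mu [set th : Omega | 0 <= th u < 2 * pi] = 1%E) /\
  (forall s : seq site, uniq s ->
     forall A : set Omega, measurable A ->
       mu A = (\int[mu]_(thb in setT) gibbs_kernel f J s thb A)%E).

Definition couplings (J : site -> R) : Prop :=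
  (forall x, J x = J (sub_site site0 x)) /\ (forall x, 0 <= J x) /\
  (\esum_(x in [set: site]) (J x)%:E = 1%E).

Definition A1 (J : site -> R) : Prop :=
  exists (alpha Jc : R), 4 < alpha /\ 0 <= Jc /\
    forall x : site, x != site0 ->
      J x <= Jc * ((norm1 x)%:~R `^ (- alpha)).

Definition A2 (f : R -> R) : Prop :=
  continuous f /\ (forall t, f (t + 2 * pi) = f t) /\ (forall t, f (- t) = f t).

End Model.

(* Main.v *)
(** The proof is a McBryan-Spencer complex rotation, made to work for an
interaction that is merely continuous.  Write f as a trigonometric polynomial
plus a remainder h with 0 <= h <= eps.  Complex rotations by a profile a are
affordable for the polynomial part: they gain exp (- a_0) and cost
exp (O (sum J_{u,v} (a_u - a_v)^2)).

The remainder is expanded as a product of factors 1 + (e^{J h} - 1) over the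
edges, and the clusters of the edges where the second term is chosen are
explored one edge at a time.  Since eps is small this is a subcritical long
range percolation, in which the weight kappa^{size} extent^q of a cluster has
bounded expectation for some q > 2, by alpha > 4.  The rotation is required to
be constant on each cluster, and zero on the clusters that reach the
complement of the box, so it leaves the chosen factors unchanged.

For |x| = m^2 the profile is dl ln (m^2 / max (m, |u|)).  It is dl ln m at the
origin, and its Dirichlet energy is O (dl^2 ln m).  Locking it on a cluster of
extent l around v changes it by O (dl l / max (m, |v|)), whose cost is paid by
the weight of the cluster, unless l is comparable to max (m, |v|).  Such a
cluster exists with probability at most sum_v max (m, |v|)^{-q} =
O (m^{2-q} ln m). *)

Require Import Defs.
From HB Require Import structures.
From mathcomp Require Import all_boot all_order all_algebra.
From mathcomp Require Import all_classical all_reals all_analysis.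
From mathcomp Require Import measurable_realfun zify ring lra.
Set Implicit Arguments.
Unset Strict Implicit.
Unset Printing Implicit Defensive.
Import Order.TTheory GRing.Theory Num.Theory.
Import numFieldNormedType.Exports.
Local Open Scope classical_set_scope.
Local Open Scope ring_scope.

(** * Bounded measurable functions and iterated integrals *)

Section BoundedMeasurable.
Context {d : measure_display} {T : measurableType d} {R : realType}.
Implicit Types F G : T -> R.

(** The obstacle is that the remainder [h] has no analytic continuation, so a complex rotation
    cannot act on its factors: a factor survives only when both ends of its edge turn by the same
    angle, whence the locking. Taking [h >= 0] makes every chosen factor nonnegative. The absolute
    value of the numerator can then be bounded for each choice of edges against the positive weight
    that builds the denominator, and [k <= eps J (1 + k)] lets [eps J] play the part of the
    probability of an open edge. The cut-off of the profile at radius m keeps every cluster that is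
    too long at a scale of at least m, which is why the failure probability is a power of m, while
    the box of radius [m ^ 2] still leaves the profile a logarithmic rise. The gain is linear in
    [dl] and the cost quadratic, so a small [dl] leaves a power of m. The site x lies just outside
    the box: once the exterior is fixed its spin is a constant, and the observable involves the spin
    at 0 only. No complex integral is formed; the analytic shift is replaced by the Cauchy-Riemann
    equations together with invariance under real rotations. *)

Definition bm F := measurable_fun setT F /\ exists M, forall x, `|F x| <= M.

Lemma eq_bm F G : F =1 G -> bm F -> bm G.
Proof. by move=> /funext ->. Qed.

Lemma bm_cst c : bm (fun=> c).
Proof. by split; [exact: measurable_cst | exists `|c|]. Qed.

Lemma bmD F G : bm F -> bm G -> bm (fun x => F x + G x).
Proof.
move=> [mF [M FM]] [mG [N GN]]; split; first exact: measurable_funD.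
by exists (M + N) => x; rewrite (le_trans (ler_normD _ _))// lerD.
Qed.

Lemma bmM F G : bm F -> bm G -> bm (fun x => F x * G x).
Proof.
move=> [mF [M FM]] [mG [N GN]]; split; first exact: measurable_funM.
by exists (M * N) => x; rewrite normrM ler_pM.
Qed.

Lemma bmZ c F : bm F -> bm (fun x => c * F x).
Proof. by move=> bF; apply: bmM => //; exact: bm_cst. Qed.

Lemma bmN F : bm F -> bm (fun x => - F x).
Proof.
by move=> bF; apply: (eq_bm _ (bmZ (-1) bF)) => x; rewrite mulN1r.
Qed.

Lemma bmB F G : bm F -> bm G -> bm (fun x => F x - G x).
Proof. by move=> bF bG; apply: bmD => //; exact: bmN. Qed.

Lemma bm_norm F : bm F -> bm (fun x => `|F x|).
Proof.
move=> [mF [M FM]]; split; first exact: measurableT_comp.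
by exists M => x; rewrite normr_id.
Qed.

Lemma bm_sum (I : Type) (r : seq I) (P : pred I) (F : I -> T -> R) :
  (forall i, P i -> bm (F i)) -> bm (fun x => \sum_(i <- r | P i) F i x).
Proof.
move=> bF; elim: r => [|i r IH].
  by apply: (eq_bm _ (bm_cst 0)) => x; rewrite big_nil.
have [Pi|Pi] := boolP (P i).
  by apply: (eq_bm _ (bmD (bF _ Pi) IH)) => x; rewrite big_cons Pi.
by apply: (eq_bm _ IH) => x; rewrite big_cons (negbTE Pi).
Qed.

Lemma bm_prod (I : Type) (r : seq I) (P : pred I) (F : I -> T -> R) :
  (forall i, P i -> bm (F i)) -> bm (fun x => \prod_(i <- r | P i) F i x).
Proof.
move=> bF; elim: r => [|i r IH].
  by apply: (eq_bm _ (bm_cst 1)) => x; rewrite big_nil.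
have [Pi|Pi] := boolP (P i).
  by apply: (eq_bm _ (bmM (bF _ Pi) IH)) => x; rewrite big_cons Pi.
by apply: (eq_bm _ IH) => x; rewrite big_cons (negbTE Pi).
Qed.

Lemma bm_continuous (g : R -> R) F : continuous g -> bm F -> bm (g \o F).
Proof.
move=> cg [mF [M FM]]; split.
  by apply: measurableT_comp => //; exact: continuous_measurable_fun.
have cgM : compact (g @` `[- M, M]).
  apply: continuous_compact; last exact: segment_compact.
  exact: continuous_subspaceT.
have [K [_ HK]] := compact_bounded cgM.
exists (K + 1) => x; apply: (HK (K + 1)); first by rewrite ltrDl.
by exists (F x) => //=; rewrite in_itv/= -ler_norml.
Qed.

Lemma bm_indic (A : set T) : measurable A -> bm (\1_A : T -> R).
Proof.
move=> mA; split; first exact: measurable_indic.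
by exists 1 => x; rewrite indicE; case: (_ \in _); rewrite ?normr1 ?normr0.
Qed.

Lemma integrable_bm (mu : {measure set T -> \bar R}) (D : set T) F :
  measurable D -> (mu D < +oo)%E -> bm F -> mu.-integrable D (EFin \o F).
Proof.
move=> mD muD [mF [M FM]]; apply: measurable_bounded_integrable => //.
  exact: measurable_funTS.
exists M; split; first exact: num_real.
by move=> K MK x _; rewrite /= (le_trans (FM x))// ltW.
Qed.

End BoundedMeasurable.

(** * Integration over one period of the circle *)

Section Arc.
Context {R : realType}.
Notation leb := (@lebesgue_measure R).
Notation arc := (`[0%R, (2 * pi)%R[%classic : set R).

Lemma two_pi_gt0 : 0 < 2 * pi :> R.
Proof. by rewrite mulr_gt0// pi_gt0. Qed.

Lemma lebesgue_arc : leb arc = (2 * pi)%:E.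
Proof. by rewrite lebesgue_measure_itv/= lte_fin two_pi_gt0/= sube0. Qed.

Lemma integrable_arc (g : R -> R) : bm g -> leb.-integrable arc (EFin \o g).
Proof.
move=> bg; apply: integrable_bm => //.
by apply: (@le_lt_trans _ _ (2 * pi)%:E); rewrite ?ltry// -lebesgue_arc.
Qed.

Definition aint (g : R -> R) : R := Rintegral leb arc g.

Lemma EFin_aint g : bm g -> ((aint g)%:E = \int[leb]_(t in arc) (g t)%:E)%E.
Proof.
move=> bg; rewrite /aint /Rintegral fineK//.
by apply: integrable_fin_num => //; exact: integrable_arc.
Qed.

Lemma aintD g1 g2 : bm g1 -> bm g2 ->
  aint (fun t => g1 t + g2 t) = aint g1 + aint g2.
Proof. by move=> b1 b2; apply: RintegralD => //; exact: integrable_arc. Qed.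

Lemma aintZ c g : bm g -> aint (fun t => c * g t) = c * aint g.
Proof. by move=> b; apply: RintegralZl => //; exact: integrable_arc. Qed.

Lemma le_aint g1 g2 : bm g1 -> bm g2 -> (forall t, g1 t <= g2 t) ->
  aint g1 <= aint g2.
Proof.
by move=> b1 b2 le12; apply: le_Rintegral => //; exact: integrable_arc.
Qed.

Lemma aint_cst c : aint (fun=> c) = c * (2 * pi).
Proof.
rewrite /aint Rintegral_cst//.
congr (_ * _); exact: (congr1 fine lebesgue_arc).
Qed.


Lemma measurable_addr (c : R) :
  measurable_fun setT ((fun x => x + c) : measurableTypeR R -> measurableTypeR R).
Proof. by apply: measurable_funD => //; exact: measurable_cst. Qed.

Lemma preimage_addr_itv (c : R) (b1 b2 : bool) (x y : R) :
  (fun t => t + c) @^-1` [set` Interval (BSide b1 x) (BSide b2 y)] =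
  [set` Interval (BSide b1 (x - c)) (BSide b2 (y - c))].
Proof.
by apply/seteqP; split => t /=; case: b1; case: b2; rewrite !in_itv/=;
  rewrite ?lerBlDr ?ltrBlDr ?lerBrDr ?ltrBrDr.
Qed.

(** Lebesgue measure is determined by its values on bounded intervals, and translation preserves
    their length. *)
Lemma lebesgue_measure_addr (c : R) (A : set R) : measurable A ->
  pushforward leb ((fun x => x + c) : _ -> measurableTypeR R) A = leb A.
Proof.
have mc := measurable_addr c.
pose mc' := isMeasurableFun.Build _ _ _ _ _ mc.
pose pc : {mfun _ >-> _} := HB.pack ((fun x => x + c) : measurableTypeR R -> measurableTypeR R) mc'.
move=> mA; apply/esym.
apply: (lebesgue_measure_unique (mu := pushforward leb pc)) => //= _ [[a b]] _ <-.
rewrite /pushforward/= preimage_addr_itv !lebesgue_measure_itv/= !lte_fin ltrD2r.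
by case: ifP => // _; rewrite -!EFinB; congr (_%:E); lra.
Qed.

Lemma Rintegral_addr (c x y : R) (g : R -> R) : bm g ->
  Rintegral leb `[x, y[%classic (fun t => g (t + c)) =
  Rintegral leb `[x + c, y + c[%classic g.
Proof.
move=> bg; have mc := measurable_addr c.
have bgc : @bm _ (measurableTypeR R) R (fun t : R => g (t + c)).
  case: bg => mg [M gM]; split; last by exists M => t.
  exact: (measurableT_comp mg mc).
congr fine; pose D : set R := `[x + c, y + c[%classic.
have -> : `[x, y[%classic = (fun t => t + c) @^-1` D.
  by rewrite preimage_addr_itv !addrK.
have bd (a b : R) : (leb `[a, b[%classic < +oo)%E.
  by rewrite lebesgue_measure_itv/=; case: ifP => // _; rewrite -EFinB ltry.
have := @integral_pushforward _ _ (measurableTypeR R) (measurableTypeR R) R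
  (fun x => x + c) mc leb D (EFin \o g).
rewrite /comp => <- //.
- by apply: eq_measure_integral => A mA _; exact: lebesgue_measure_addr.
- by apply/measurable_EFinP; case: bg.
- rewrite /D preimage_addr_itv !addrK; apply: (integrable_bm _ _ bgc) => //.
  exact: bd.
- exact: measurable_itv.
Qed.

Lemma periodicz (g : R -> R) (p : R) (k : int) t :
  (forall t, g (t + p) = g t) -> g (t + k%:~R * p) = g t.
Proof.
move=> gp; have nat_case (n : nat) u : g (u + n%:R * p) = g u.
  elim: n u => [|n IH] u; first by rewrite mul0r addr0.
  by rewrite -addn1 natrD mulrDl mul1r addrA gp IH.
case: k => n; first exact: nat_case.
rewrite NegzE mulrNz mulNr -{2}(subrK (n.+1%:R * p) t) nat_case.
by rewrite pmulrn.
Qed.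

(** The shift is reduced modulo the period to [c0] in [0, 2 pi); the window [c0, 2 pi + c0) is cut
    at 2 pi and its second piece is moved back by one period. *)
Lemma aint_shift (g : R -> R) (c : R) : bm g -> (forall t, g (t + 2 * pi) = g t) ->
  aint (fun t => g (t + c)) = aint g.
Proof.
move=> bg gp; have p0 := two_pi_gt0.
pose k := Num.floor (c / (2 * pi)); pose c0 := c - k%:~R * (2 * pi).
have c0ge0 : 0 <= c0 by rewrite subr_ge0 -ler_pdivlMr// floor_le_tmp.
have c0lt : c0 < 2 * pi.
  rewrite ltrBlDr -{1}(mul1r (2 * pi)) -mulrDl -ltr_pdivrMr//.
  by rewrite addrC -intrD1 floorD1_gt.
have -> : (fun t => g (t + c)) = (fun t => g (t + c0)).
  apply/funext => t; rewrite -(periodicz k (t + c0) gp); congr g.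
  by rewrite /c0; ring.
have ig (a b : R) : leb.-integrable `[a, b[%classic (EFin \o g).
  apply: integrable_bm => //.
  by rewrite /= lebesgue_measure_itv/=; case: ifP => // _; rewrite -EFinB ltry.
have split3 (a b e : R) : a <= b -> b <= e ->
    Rintegral leb `[a, e[%classic g =
    Rintegral leb `[a, b[%classic g + Rintegral leb `[b, e[%classic g.
  move=> ab be; rewrite -Rintegral_setU//; last 2 first.
  - rewrite -itv_bndbnd_setU ?bnd_simp//.
  - apply/disj_setPLR => t /=; rewrite !in_itv/= => /andP[_ tb].
    by apply/negP; rewrite negb_and -ltNge tb.
  by rewrite -itv_bndbnd_setU ?bnd_simp.
rewrite /aint Rintegral_addr// add0r (split3 c0 (2 * pi) (2 * pi + c0)); [|lra|lra].
rewrite (split3 0 c0 (2 * pi)); [|lra|lra].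
rewrite addrC; congr (_ + _).
have := Rintegral_addr (2 * pi) 0 c0 bg.
by rewrite add0r (addrC c0) => <-; apply: eq_Rintegral => t _; rewrite gp.
Qed.

End Arc.

(** * Iterated integrals over finitely many spins *)

Section IteratedIntegral.
Context {R : realType}.
Notation leb := (@lebesgue_measure R).
Implicit Types (F G : Omega R -> R) (th : Omega R) (s : seq site).

Lemma measurable_eval (u : site) : measurable_fun setT (fun th : Omega R => th u).
Proof.
move=> _ B mB; rewrite setTI; apply: sub_sigma_algebra.
by exists u, B.
Qed.

Lemma measurable_upd (u : site) :
  measurable_fun setT (fun p : Omega R * measurableTypeR R => upd p.1 u p.2 : Omega R).
Proof.
apply: (@measurability _ _ _ (Omega R) _ _ (@cylinders R)) => // _ [_ [v [B [mB ->]]] <-].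
rewrite setTI.
have [->|vu] := eqVneq v u.
  rewrite (_ : _ @^-1` _ = setT `*` B); first exact: measurableX.
  by apply/seteqP; split => -[th t] /=; rewrite /upd eqxx // => -[].
rewrite (_ : _ @^-1` _ = ((fun th : Omega R => th v) @^-1` B) `*` setT).
  apply: measurableX => //; rewrite -[_ @^-1` _]setTI; exact: measurable_eval.
by apply/seteqP; split => -[th t] /=; rewrite /upd (negbTE vu) // => -[].
Qed.

Lemma bm_upd F u : bm F ->
  @bm _ (Omega R * measurableTypeR R)%type R (fun p => F (upd p.1 u p.2)).
Proof.
move=> [mF [M FM]]; split; last by exists M.
exact: (measurableT_comp mF (measurable_upd u)).
Qed.

Lemma bm_section F u th : bm F -> @bm _ (measurableTypeR R) R (fun t => F (upd th u t)).
Proof.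
move=> bF; have [mG [M GM]] := bm_upd u bF.
split; last by exists M => t; exact: (GM (th, t)).
exact: (measurableT_comp mG (measurable_pair1 th)).
Qed.

(** Real-valued counterpart of [iint], equal to it on bounded measurable integrands by [iintE];
    linearity and order are handled here, free of extended reals. *)
Fixpoint rint s F th : R :=
  if s is u :: s' then aint (fun t => rint s' F (upd th u t)) else F th.

(** Tonelli's theorem gives the measurability of a parameter integral for a nonnegative integrand,
    so it is applied to [G = F + M]; a constant is subtracted afterwards. *)
Lemma bm_aint F u : bm F -> bm (fun th => aint (fun t => F (upd th u t))).
Proof.
move=> bF; have [M FM] := bF.2; pose G th := F th + M.
have bG : bm G by apply: bmD => //; exact: bm_cst.
have G0 th : 0 <= G th by rewrite -lerBlDr sub0r; have /ler_normlP[] := FM th; lra.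
have bsec th : bm (fun t => F (upd th u t)) by exact: bm_section.
have GE th : aint (fun t => F (upd th u t)) =
    aint (fun t => G (upd th u t)) - M * (2 * pi).
  by rewrite aintD// ?aint_cst ?addrK//; exact: bm_cst.
split; last first.
  exists (M * (2 * pi)) => th; rewrite -aint_cst ler_norml.
  have -> : - aint (fun=> M) = aint (fun=> - M) :> R.
    by rewrite !aint_cst mulNr.
  by apply/andP; split; apply: le_aint => //; first [exact: bm_cst|move=> t];
    have /ler_normlP[] := FM (upd th u t); lra.
rewrite (_ : (fun th => aint _) =
    (fun th => aint (fun t => G (upd th u t)) - M * (2 * pi))); last exact/funext.
apply: measurable_funB => //.
pose g (p : Omega R * measurableTypeR R) : \bar R :=
  ((G (upd p.1 u p.2) * \1_(`[0%R, (2 * pi)%R[%classic : set R) p.2)%:E)%E.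
have mg : measurable_fun setT g.
  apply/measurable_EFinP; apply: measurable_funM; first by case: (bm_upd u bG).
  apply: measurableT_comp => //; exact: measurable_indic.
have g0 p : (0 <= g p)%E by rewrite lee_fin mulr_ge0// indicE.
have mgF := @measurable_fun_fubini_tonelli_F _ _ (Omega R) (measurableTypeR R) R leb g mg g0.
rewrite /fubini_F in mgF.
apply: (measurableT_comp (fine_measurable measurableT)) => //.
move: mgF; congr measurable_fun; apply/funext => th.
rewrite [RHS]integral_mkcond; apply: eq_integral => t _.
rewrite /g/= patchE indicE; case: ifP => _; first by rewrite mulr1.
by rewrite mulr0.
Qed.

Lemma bm_rint s F : bm F -> bm (rint s F).
Proof. by move=> bF; elim: s => //= u s IH; exact: bm_aint. Qed.

Lemma rint_section s F u th : bm F -> bm (fun t => rint s F (upd th u t)).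
Proof. by move=> bF; apply: bm_section; exact: bm_rint. Qed.

Lemma iintE s F th : bm F -> iint s (EFin \o F) th = (rint s F th)%:E.
Proof.
move=> bF; elim: s th => //= u s IH th.
rewrite EFin_aint; last exact: rint_section.
by apply: eq_integral => t _; rewrite IH.
Qed.

(** The iterated integral only visits configurations that agree with [th] off [s]; this is what
    turns the boundary spins into constants. *)
Lemma eq_rint_off s F G th :
  (forall th', (forall v, v \notin s -> th' v = th v) -> F th' = G th') ->
  rint s F th = rint s G th.
Proof.
elim: s th => /= [|u s IH] th FG; first exact: FG.
congr aint; apply/funext => t; apply: IH => th' th'E; apply: FG => v.
by rewrite inE negb_or => /andP[vu vs]; rewrite th'E// /upd (negbTE vu).
Qed.

Lemma eq_rint s F G th : F =1 G -> rint s F th = rint s G th.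
Proof. by move=> /funext ->. Qed.

Lemma rint_off s F th th' : (forall v, v \notin s -> th' v = th v) ->
  rint s F th' = rint s F th.
Proof.
elim: s th th' => /= [|u s IH] th th' E; first by congr F; apply/funext => v; exact: E.
congr aint; apply/funext => t; apply: IH => v vs; rewrite /upd.
by case: eqVneq => // vu; apply: E; rewrite inE negb_or vu.
Qed.

Lemma rintD s F G th : bm F -> bm G ->
  rint s (fun th => F th + G th) th = rint s F th + rint s G th.
Proof.
move=> bF bG; elim: s th => //= u s IH th.
rewrite -aintD//; try exact: rint_section.
by congr aint; apply/funext => t; rewrite IH.
Qed.

Lemma rintZ s c F th : bm F -> rint s (fun th => c * F th) th = c * rint s F th.
Proof.
move=> bF; elim: s th => //= u s IH th.
rewrite -aintZ//; last exact: rint_section.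
by congr aint; apply/funext => t; rewrite IH.
Qed.

Lemma le_rint s F G th : bm F -> bm G -> (forall th, F th <= G th) ->
  rint s F th <= rint s G th.
Proof.
move=> bF bG FG; elim: s th => //= u s IH th.
by apply: le_aint => [||t]; [exact: rint_section|exact: rint_section|exact: IH].
Qed.

Lemma le_norm_rint s F G th : bm F -> bm G -> (forall th, `|F th| <= G th) ->
  `|rint s F th| <= rint s G th.
Proof.
move=> bF bG FG; rewrite ler_norml; apply/andP; split; last first.
  by apply: le_rint => // th'; apply: le_trans (FG th'); exact: ler_norm.
rewrite lerNl -mulN1r -rintZ//; apply: le_rint => //; first exact: bmZ.
by move=> th'; rewrite mulN1r; apply: le_trans (FG th'); rewrite -normrN ler_norm.
Qed.

Lemma rint_cst s c th : rint s (fun=> c) th = c * (2 * pi) ^+ size s.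
Proof.
elim: s th => /= [|u s IH] th; first by rewrite mulr1.
rewrite (_ : (fun t => _) = (fun=> c * (2 * pi) ^+ size s)); last exact/funext.
by rewrite aint_cst exprSr -mulrA.
Qed.

Definition rotate (psi : site -> R) th : Omega R := fun v => th v + psi v.

Definition periodic_at F (u : site) :=
  forall th, F (upd th u (th u + 2 * pi)) = F th.

Lemma upd_upd th u t t' : upd (upd th u t) u t' = upd th u t'.
Proof. by apply/funext => v; rewrite /upd; case: eqP. Qed.

Lemma rint_periodic s F u : periodic_at F u -> periodic_at (rint s F) u.
Proof.
move=> Fu; elim: s => //= w s IH th; congr aint; apply/funext => t.
have [->|wu] := eqVneq w u; first by rewrite upd_upd.
rewrite -(IH (upd th w t)); congr rint; apply/funext => v; rewrite /upd.
case: (eqVneq v u) => [->|vu]; last by [].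
by rewrite eq_sym (negbTE wu).
Qed.

(** Translation invariance of each circle, used one coordinate at a time; periodicity of [F] makes
    it a function on the torus. *)
Lemma rint_rotate s F psi th : bm F -> (forall u, u \in s -> periodic_at F u) ->
  (forall v, v \notin s -> psi v = 0) ->
  rint s (F \o rotate psi) th = rint s F th.
Proof.
move=> bF pF psi0.
(* Rotating the base configuration as well removes the condition on [psi] from the induction, where
   it would fail for the tail of [s]. *)
have -> : rint s F th = rint s F (rotate psi th).
  by apply/esym/rint_off => v vs; rewrite /rotate psi0// addr0.
elim: s pF th {psi0} => //= u s IH pF th.
rewrite -[RHS](aint_shift (psi u)); last 2 first.
- exact: rint_section.
- move=> t; have /(_ s) := rint_periodic _ (pF u (mem_head _ _)).
  move=> /(_ (upd (rotate psi th) u t)); rewrite upd_upd => <-.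
  by congr (rint _ _ (upd _ _ (_ + _))); rewrite /upd eqxx.
congr aint; apply/funext => t; rewrite IH; last first.
  by move=> v vs; apply: pF; rewrite inE vs orbT.
congr rint; apply/funext => v; rewrite /rotate /upd.
by case: eqVneq => // ->.
Qed.

End IteratedIntegral.

(** * Complex rotations *)

Section Hyperbolic.
Context {R : realType}.
Implicit Types x y z : R.

Definition cosh z := (expR z + expR (- z)) / 2.
Definition sinh z := (expR z - expR (- z)) / 2.

Lemma cosh0 : cosh 0 = 1.
Proof. by rewrite /cosh oppr0 expR0; lra. Qed.

Lemma sinh0 : sinh 0 = 0.
Proof. by rewrite /sinh oppr0 expR0; lra. Qed.

Lemma cosh_ge1 z : 1 <= cosh z.
Proof.
have e0 := expR_gt0 z; rewrite /cosh expRN -subr_ge0.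
have -> : (expR z + (expR z)^-1) / 2 - 1 = (expR z - 1) ^+ 2 / (2 * expR z).
  by field; rewrite gt_eqF.
by rewrite divr_ge0 ?sqr_ge0// mulr_ge0// ltW.
Qed.

Lemma is_derive_cosh z : is_derive z 1 cosh (sinh z).
Proof.
rewrite /cosh; apply: is_derive_eq.
by rewrite /sinh !scaler0 /GRing.scale/=; lra.
Qed.

Lemma is_derive_sinh z : is_derive z 1 sinh (cosh z).
Proof.
rewrite /sinh; apply: is_derive_eq.
by rewrite /cosh !scaler0 /GRing.scale/=; lra.
Qed.

Lemma expR_lip (K x y : R) : x <= K -> y <= K ->
  `|expR x - expR y| <= expR K * `|x - y|.
Proof.
wlog yx : x y / y <= x.
  move=> W xK yK; have [yx|/ltW xy] := leP y x; first exact: W.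
  by rewrite distrC [`|x - y|]distrC; exact: W.
move=> xK yK; rewrite !ger0_norm ?subr_ge0 ?ler_expR//.
have -> : expR x - expR y = expR x * (1 - expR (y - x)).
  by rewrite mulrBr mulr1 -expRD addrCA subrr addr0.
apply: (@le_trans _ _ (expR x * (x - y))).
  rewrite ler_wpM2l ?expR_ge0//; have := expR_ge1Dx (y - x); lra.
by rewrite ler_wpM2r ?subr_ge0 ?ler_expR.
Qed.

Lemma lip1_derive (g dg : R -> R) : (forall x, is_derive x 1 g (dg x)) ->
  (forall x, `|dg x| <= 1) -> forall x y, `|g x - g y| <= `|x - y|.
Proof.
move=> gd gb x y; wlog yx : x y / y <= x.
  move=> W; have [yx|/ltW xy] := leP y x; first exact: W.
  by rewrite distrC [leRHS]distrC; exact: W.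
have cg : {within `[y, x], continuous g}.
  apply: continuous_subspaceT => z; apply: differentiable_continuous.
  exact/derivable1_diffP.
have [c _ ->] := @MVT_segment R g dg y x yx (fun z _ => gd z) cg.
by rewrite normrM ler_piMl.
Qed.

Lemma cos_lip x y : `|cos x - cos y| <= `|x - y|.
Proof.
apply: (@lip1_derive cos (fun z => - sin z)) => z.
by rewrite normrN ler_norml sin_geN1 sin_le1.
Qed.

Lemma sin_lip x y : `|sin x - sin y| <= `|x - y|.
Proof.
by apply: (@lip1_derive sin cos) => z; rewrite ler_norml cos_geN1 cos_le1.
Qed.

(** From [cosh z - 1 = (e^z - 1)^2 / (2 e^z)] and [e^z - 1 <= z e^z] for [z >= 0]. *)
Lemma cosh_sub1_le z : cosh z - 1 <= z ^+ 2 * expR `|z|.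
Proof.
wlog z0 : z / 0 <= z.
  move=> W; have [|/ltW z0] := leP 0 z; first exact: W.
  have : cosh (- z) - 1 <= (- z) ^+ 2 * expR `|- z| by apply: W; lra.
  by rewrite sqrrN normrN /cosh opprK [expR (- z) + _]addrC.
rewrite ger0_norm//; have e0 := expR_gt0 z.
have -> : cosh z - 1 = (expR z - 1) ^+ 2 / (2 * expR z).
  by rewrite /cosh expRN; field; rewrite gt_eqF.
rewrite ler_pdivrMr ?mulr_gt0//.
have h : 0 <= expR z - 1 <= z * expR z.
  have h1 := expR_ge1Dx z; have := expR_ge1Dx (- z); rewrite expRN => h2.
  apply/andP; split; first lra.
  have : (1 - z) * expR z <= 1.
    by have := ler_wpM2r (ltW e0) h2; rewrite mulVf ?gt_eqF.
  lra.
move/andP: h => [h0 h1].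
apply: (@le_trans _ _ ((z * expR z) ^+ 2)).
  by rewrite ler_pXn2r ?nnegrE// (le_trans h0).
have := mulr_ge0 (sqr_ge0 z) (ltW (mulr_gt0 e0 e0)); rewrite !expr2; lra.
Qed.

End Hyperbolic.

Section UniformlyLipschitz.
Context {R : realType} {A : Type}.
Implicit Types g : A -> R -> R -> R.

(** Bounded and Lipschitz in (t, s) on a square, uniformly in the configuration [a]. The uniformity
    gives [rot_step] one remainder constant for all configurations; the half-side 2 leaves room for
    [s + h] with s and h at most 1. *)
Definition ul g := exists2 M, 0 <= M &
  forall a t s t' s', `|t| <= 2 -> `|s| <= 2 -> `|t'| <= 2 -> `|s'| <= 2 ->
    `|g a t s| <= M /\ `|g a t s - g a t' s'| <= M * (`|t - t'| + `|s - s'|).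

Lemma eq_ul g1 g2 : (forall a t s, g1 a t s = g2 a t s) -> ul g1 -> ul g2.
Proof.
by move=> E; have -> : g2 = g1 by apply/funext => a; apply/funext => t; apply/funext => s.
Qed.

Lemma ul_cst c : ul (fun _ _ _ => c).
Proof.
exists `|c| => // a t s t' s' _ _ _ _; split => //.
by rewrite subrr normr0 mulr_ge0 ?addr_ge0.
Qed.

Lemma ul_fst : ul (fun _ t _ => t).
Proof. by exists 2 => // a t s t' s' *; split => //; have := normr_ge0 (t - t'); have := normr_ge0 (s - s'); lra. Qed.

Lemma ul_snd : ul (fun _ _ s => s).
Proof. by exists 2 => // a t s t' s' *; split => //; have := normr_ge0 (t - t'); have := normr_ge0 (s - s'); lra. Qed.

Lemma ulD g1 g2 : ul g1 -> ul g2 -> ul (fun a t s => g1 a t s + g2 a t s).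
Proof.
move=> [M1 M10 H1] [M2 M20 H2]; exists (M1 + M2); first exact: addr_ge0.
move=> a t s t' s' ht hs ht' hs'.
have [b1 l1] := H1 a t s t' s' ht hs ht' hs'.
have [b2 l2] := H2 a t s t' s' ht hs ht' hs'.
split; first by rewrite (le_trans (ler_normD _ _))// lerD.
by rewrite opprD addrACA mulrDl (le_trans (ler_normD _ _))// lerD.
Qed.

Lemma ulM g1 g2 : ul g1 -> ul g2 -> ul (fun a t s => g1 a t s * g2 a t s).
Proof.
move=> [M1 M10 H1] [M2 M20 H2]; exists (2 * (M1 * M2)); first by rewrite !mulr_ge0.
move=> a t s t' s' ht hs ht' hs'.
have [b1 l1] := H1 a t s t' s' ht hs ht' hs'.
have [b2 l2] := H2 a t s t' s' ht hs ht' hs'.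
have [b2' _] := H2 a t' s' t s ht' hs' ht hs.
have d0 : 0 <= `|t - t'| + `|s - s'| by exact: addr_ge0.
split; first by rewrite normrM (le_trans (ler_pM _ _ b1 b2))// ler_peMl ?mulr_ge0//; lra.
have -> : g1 a t s * g2 a t s - g1 a t' s' * g2 a t' s' =
   g1 a t s * (g2 a t s - g2 a t' s') + (g1 a t s - g1 a t' s') * g2 a t' s' by ring.
rewrite (le_trans (ler_normD _ _))// !normrM.
have := ler_pM (normr_ge0 _) (normr_ge0 _) b1 l2.
have := ler_pM (normr_ge0 _) (normr_ge0 _) l1 b2'.
lra.
Qed.

Lemma ulN g : ul g -> ul (fun a t s => - g a t s).
Proof. by move=> /(ulM (ul_cst (-1))); apply: eq_ul => a t s; rewrite mulN1r. Qed.

Lemma ulB g1 g2 : ul g1 -> ul g2 -> ul (fun a t s => g1 a t s - g2 a t s).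
Proof. by move=> h1 h2; apply: ulD => //; exact: ulN. Qed.

Lemma ul_sum (J : Type) (r : seq J) (g : J -> A -> R -> R -> R) :
  (forall j, ul (g j)) -> ul (fun a t s => \sum_(j <- r) g j a t s).
Proof.
move=> h; elim: r => [|j r IH].
  by apply: eq_ul (ul_cst 0) => a t s; rewrite big_nil.
by apply: eq_ul (ulD (h j) IH) => a t s; rewrite big_cons.
Qed.

Lemma ul_expR g : ul g -> ul (fun a t s => expR (g a t s)).
Proof.
move=> [M M0 H]; exists (expR M * (M + 1)); first by rewrite mulr_ge0 ?expR_ge0 ?addr_ge0.
move=> a t s t' s' ht hs ht' hs'.
have [b l] := H a t s t' s' ht hs ht' hs'.
have [b' _] := H a t' s' t s ht' hs' ht hs.
have bM := le_trans (ler_norm _) b; have bM' := le_trans (ler_norm _) b'.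
split.
  rewrite ger0_norm ?expR_ge0// (@le_trans _ _ (expR M)) ?ler_expR//.
  by rewrite ler_peMr ?expR_ge0//; lra.
apply: (le_trans (expR_lip bM bM')).
rewrite -mulrA ler_wpM2l ?expR_ge0// (le_trans l)//.
by rewrite ler_wpM2r ?addr_ge0//; lra.
Qed.

(** The phase [b a] may be unbounded in [a]: it cancels in differences, and [F] itself is
    bounded. *)
Lemma ul_phase (F : R -> R) (b : A -> R) g : (forall x, `|F x| <= 1) ->
  (forall x y, `|F x - F y| <= `|x - y|) -> ul g ->
  ul (fun a t s => F (b a + g a t s)).
Proof.
move=> F1 FL [M M0 H]; exists (M + 1); first by rewrite addr_ge0.
move=> a t s t' s' ht hs ht' hs'.
have [_ l] := H a t s t' s' ht hs ht' hs'.
split; first by rewrite (le_trans (F1 _))//; lra.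
apply: (le_trans (FL _ _)).
rewrite opprD addrACA subrr add0r (le_trans l)//.
by rewrite ler_wpM2r ?addr_ge0//; lra.
Qed.

Lemma ul_cos (b : A -> R) g : ul g -> ul (fun a t s => cos (b a + g a t s)).
Proof.
move=> hg; apply: ul_phase hg => [x|]; last exact: cos_lip.
by rewrite ler_norml cos_geN1 cos_le1.
Qed.

Lemma ul_sin (b : A -> R) g : ul g -> ul (fun a t s => sin (b a + g a t s)).
Proof.
move=> hg; apply: ul_phase hg => [x|]; last exact: sin_lip.
by rewrite ler_norml sin_geN1 sin_le1.
Qed.

Lemma ul_cosh g : ul g -> ul (fun a t s => cosh (g a t s)).
Proof.
move=> hg; apply: ulM; last exact: ul_cst.
by apply: ulD; apply: ul_expR => //; exact: ulN.
Qed.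

Lemma ul_sinh g : ul g -> ul (fun a t s => sinh (g a t s)).
Proof.
move=> hg; apply: ulM; last exact: ul_cst.
by apply: ulB; apply: ul_expR => //; exact: ulN.
Qed.

End UniformlyLipschitz.

(** * Cauchy-Riemann equations for the rotated weight *)

Section ComplexRotation.
Context {R : realType} {A J : Type}.
Variables (r : seq J) (c y : J -> R) (y0 : R) (x : J -> A -> R) (x0 : A -> R).

(* P + i Q is the exponent i (x0 + z y0) + sum_j c_j cos (x_j + z y_j) at the
   complex angle z = t + i s. *)
Definition rotP a t s : R :=
  \sum_(j <- r) c j * (cos (x j a + t * y j) * cosh (s * y j)) - s * y0.
Definition rotQ a t s : R :=
  x0 a + (t * y0 - \sum_(j <- r) c j * (sin (x j a + t * y j) * sinh (s * y j))).
Definition rotU a t s : R := expR (rotP a t s) * cos (rotQ a t s).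
Definition rotV a t s : R := expR (rotP a t s) * sin (rotQ a t s).

(** The partial derivatives of [rotP] in s and t. By Cauchy-Riemann those of [rotQ] are [Pt] in s
    and [- Ps] in t, so that [W] is both the s-derivative of [rotU] and minus the t-derivative of
    [rotV]. *)
Let Ps a t s : R :=
  \sum_(j <- r) c j * (cos (x j a + t * y j) * (y j * sinh (s * y j))) - y0.
Let Pt a t s : R :=
  - \sum_(j <- r) c j * (y j * sin (x j a + t * y j) * cosh (s * y j)).
Let W a t s : R :=
  expR (rotP a t s) * (Ps a t s * cos (rotQ a t s) - Pt a t s * sin (rotQ a t s)).

Let ul_W : ul W.
Proof.
have uy j : ul (fun (_ : A) t (_ : R) => t * y j) by apply: ulM; [exact: ul_fst|exact: ul_cst].
have us (k : R) : ul (fun (_ : A) (_ : R) s => s * k) by apply: ulM; [exact: ul_snd|exact: ul_cst].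
have ut (k : R) : ul (fun (_ : A) t (_ : R) => t * k) by apply: ulM; [exact: ul_fst|exact: ul_cst].
have uP : ul rotP.
  apply: ulB => //; apply: ul_sum => j; apply: ulM; first exact: ul_cst.
  by apply: ulM; [exact: ul_cos|exact: ul_cosh].
have uQ : ul (fun a t s => t * y0 - \sum_(j <- r) c j * (sin (x j a + t * y j) * sinh (s * y j))).
  apply: ulB => //; apply: ul_sum => j; apply: ulM; first exact: ul_cst.
  by apply: ulM; [exact: ul_sin|exact: ul_sinh].
apply: ulM; first exact: ul_expR.
apply: ulB; apply: ulM; [|exact: ul_cos| |exact: ul_sin].
- apply: ulB; last exact: ul_cst.
  apply: ul_sum => j; apply: ulM; first exact: ul_cst.
  apply: ulM; first exact: ul_cos.
  by apply: ulM; [exact: ul_cst|exact: ul_sinh].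
- apply: ulN; apply: ul_sum => j; apply: ulM; first exact: ul_cst.
  apply: ulM; last exact: ul_cosh.
  by apply: ulM; [exact: ul_cst|exact: ul_sin].
Qed.

Let is_derive_sumr (g dg : J -> R -> R) (z : R) :
  (forall j, is_derive z 1 (g j) (dg j z)) ->
  is_derive z 1 (fun z => \sum_(j <- r) g j z) (\sum_(j <- r) dg j z).
Proof.
move=> gd; elim: r => [|j l IH].
  rewrite big_nil (_ : (fun z => _) = cst 0); first exact: is_derive_cst.
  by apply/funext => w; rewrite big_nil.
rewrite big_cons (_ : (fun z => _) = g j + (fun z => \sum_(j <- l) g j z)).
  exact: is_deriveD.
by apply/funext => w; rewrite big_cons.
Qed.

Let is_derive_affine (a b z : R) : is_derive z 1 (fun z : R => a + z * b) b.
Proof.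
have := is_deriveD (is_derive_cst a z 1) (is_deriveM (is_derive_id z 1) (is_derive_cst b z 1)).
by rewrite scaler0 !add0r /GRing.scale/= mulr1.
Qed.

Let is_derive_compr (g : R -> R) (dg : R) (h : R -> R) (dh z : R) :
  is_derive (h z) 1 g dg -> is_derive z 1 h dh ->
  is_derive z 1 (fun z => g (h z)) (dg * dh).
Proof. by move=> gd hd; have := is_derive1_comp gd hd. Qed.

Let is_derive_rotU a (s z : R) : is_derive z 1 (fun h : R => rotU a 0 (s + h)) (W a 0 (s + z)).
Proof.
have lin j : is_derive z 1 (fun h : R => (s + h) * y j) (y j).
  by apply: is_derive_eq; rewrite !scaler0 !add0r /GRing.scale/= mulr1.
have dP : is_derive z 1 (fun h : R => rotP a 0 (s + h)) (Ps a 0 (s + z)).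
  apply: is_deriveB.
    apply: (is_derive_sumr (dg := fun j z => c j * (cos (x j a + 0 * y j) * (y j * sinh ((s + z) * y j))))) => j.
    have dc := is_derive_compr (is_derive_cosh _) (lin j).
    by apply: is_derive_eq; rewrite /GRing.scale/=; ring.
  by apply: is_derive_eq; rewrite !scaler0 !add0r /GRing.scale/= mulr1.
have dQ : is_derive z 1 (fun h : R => rotQ a 0 (s + h)) (Pt a 0 (s + z)).
  have dS : is_derive z 1 (fun h : R => \sum_(j <- r) c j * (sin (x j a + 0 * y j) * sinh ((s + h) * y j)))
      (- Pt a 0 (s + z)).
    rewrite opprK.
    apply: (is_derive_sumr (dg := fun j z => c j * (y j * sin (x j a + 0 * y j) * cosh ((s + z) * y j)))) => j.
    have dc := is_derive_compr (is_derive_sinh _) (lin j).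
    by apply: is_derive_eq; rewrite /GRing.scale/=; ring.
  by have := is_deriveD (is_derive_cst (x0 a) z 1)
      (is_deriveB (is_derive_cst (0 * y0) z 1) dS); rewrite sub0r add0r opprK.
have dE := is_derive_compr (is_derive_expR _) dP.
have dC := is_derive_compr (is_derive_cos _) dQ.
apply: is_derive_eq; rewrite /W /GRing.scale/=; ring.
Qed.

Let is_derive_rotV a (s z : R) : is_derive z 1 (fun h : R => rotV a h s) (- W a z s).
Proof.
have lin j : is_derive z 1 (fun h : R => x j a + h * y j) (y j) by exact: is_derive_affine.
have dP : is_derive z 1 (fun h : R => rotP a h s) (Pt a z s).
  have dS : is_derive z 1 (fun h : R => \sum_(j <- r) c j * (cos (x j a + h * y j) * cosh (s * y j)))
      (Pt a z s).
    rewrite /Pt -sumrN.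
    apply: (is_derive_sumr (dg := fun j z => - (c j * (y j * sin (x j a + z * y j) * cosh (s * y j))))) => j.
    have dc := is_derive_compr (is_derive_cos _) (lin j).
    by apply: is_derive_eq; rewrite /GRing.scale/=; ring.
  by have := is_deriveB dS (is_derive_cst (s * y0) z 1); rewrite subr0.
have dQ : is_derive z 1 (fun h : R => rotQ a h s) (- Ps a z s).
  have dS : is_derive z 1 (fun h : R => \sum_(j <- r) c j * (sin (x j a + h * y j) * sinh (s * y j)))
      (Ps a z s + y0).
    rewrite /Ps subrK.
    apply: (is_derive_sumr (dg := fun j z => c j * (cos (x j a + z * y j) * (y j * sinh (s * y j))))) => j.
    have dc := is_derive_compr (is_derive_sin _) (lin j).
    by apply: is_derive_eq; rewrite /GRing.scale/=; ring.
  by apply: is_derive_eq; rewrite !scaler0 !add0r /GRing.scale/=; ring.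
have dE := is_derive_compr (is_derive_expR _) dP.
have dC := is_derive_compr (is_derive_sin _) dQ.
apply: is_derive_eq; rewrite /W /GRing.scale/=; ring.
Qed.

(* By the Cauchy-Riemann equations the two increments below cancel to first
   order. *)
Lemma rot_step : exists2 C, 0 <= C & forall a s h, 0 <= s <= 1 -> 0 <= h <= 1 ->
  `|(rotU a 0 (s + h) - rotU a 0 s) + (rotV a h s - rotV a 0 s)| <= C * h ^+ 2.
Proof.
have [M M0 HM] := ul_W; exists (2 * M); first by rewrite mulr_ge0.
move=> a s h /andP[s0 s1] /andP[h0 h1].
(* The derivative [W a 0 (s + z) - W a z s] vanishes at z = 0 and is at most [2 M z] by the
   Lipschitz bound, so the mean value theorem yields a quadratic increment. *)
pose d z := rotU a 0 (s + z) + rotV a z s.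
have dd (z : R) : is_derive z 1 d (W a 0 (s + z) - W a z s).
  by have := is_deriveD (is_derive_rotU a s z) (is_derive_rotV a s z).
have cd : {within `[0, h], continuous d}.
  apply: continuous_subspaceT => z; apply: differentiable_continuous.
  exact/derivable1_diffP.
have [z] := @MVT_segment R d (fun z => W a 0 (s + z) - W a z s) 0 h h0 (fun z _ => dd z) cd.
rewrite in_itv/= subr0 => /andP[z0 zh] dE.
have -> : (rotU a 0 (s + h) - rotU a 0 s) + (rotV a h s - rotV a 0 s) = d h - d 0.
  by rewrite /d addr0; ring.
have n2 (v : R) : 0 <= v -> v <= 2 -> `|v| <= 2 by move=> v0; rewrite ger0_norm.
have [_] : _ /\ _ := HM a 0 (s + z) z s (n2 0 ltac:(lra) ltac:(lra))
  (n2 (s + z) ltac:(lra) ltac:(lra)) (n2 z ltac:(lra) ltac:(lra)) (n2 s ltac:(lra) ltac:(lra)).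
rewrite sub0r normrN addrAC subrr add0r (ger0_norm z0) => HW.
rewrite dE normrM (ger0_norm h0) expr2 mulrA ler_wpM2r//.
by rewrite (le_trans HW)// -mulrA mulrCA ler_wpM2l//; lra.
Qed.

End ComplexRotation.

(** * Analytic shift for functionals invariant under real rotations *)

Section RotationBound.
Context {d : measure_display} {T : measurableType d} {R : realType} {J : Type}.
Variables (L : (T -> R) -> R) (r : seq J) (c y : J -> R) (y0 : R).
Variables (x : J -> T -> R) (x0 : T -> R).
Hypothesis LD : forall F G, bm F -> bm G -> L (fun a => F a + G a) = L F + L G.
Hypothesis LZ : forall k F, bm F -> L (fun a => k * F a) = k * L F.
Hypothesis le_L : forall F G, bm F -> bm G -> (forall a, F a <= G a) -> L F <= L G.
Hypothesis mx : forall j, measurable_fun setT (x j).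
Hypothesis mx0 : measurable_fun setT x0.
Notation U t s := (fun a => rotU r c y y0 x x0 a t s).
Notation V t s := (fun a => rotV r c y y0 x x0 a t s).
Hypothesis LV : forall t s, L (V t s) = L (V 0 s).

Lemma bm_cos (F : T -> R) : measurable_fun setT F -> bm (fun a => cos (F a)).
Proof.
move=> mF; split.
  by apply: measurableT_comp => //; apply: continuous_measurable_fun; exact: continuous_cos.
by exists 1 => a; rewrite ler_norml cos_geN1 cos_le1.
Qed.

Lemma bm_sin (F : T -> R) : measurable_fun setT F -> bm (fun a => sin (F a)).
Proof.
move=> mF; split.
  by apply: measurableT_comp => //; apply: continuous_measurable_fun; exact: continuous_sin.
by exists 1 => a; rewrite ler_norml sin_geN1 sin_le1.
Qed.

Lemma bm_expR (F : T -> R) : bm F -> bm (fun a => expR (F a)).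
Proof. by move=> bF; apply: (bm_continuous (g := expR)) bF; exact: continuous_expR. Qed.

Let m_add (F : T -> R) k : measurable_fun setT F -> measurable_fun setT (fun a => F a + k).
Proof. by move=> mF; apply: measurable_funD => //; exact: measurable_cst. Qed.

Let bm_rotP t s : bm (fun a => rotP r c y y0 x a t s).
Proof.
apply: bmB; last exact: bm_cst.
apply: bm_sum => j _; apply: bmZ; apply: bmM; last exact: bm_cst.
by apply: bm_cos; exact: m_add.
Qed.

Let m_rotQ t s : measurable_fun setT (fun a => rotQ r c y y0 x x0 a t s).
Proof.
apply: measurable_funD => //; apply: measurable_funB; first exact: measurable_cst.
suff [] : bm (fun a => \sum_(j <- r) c j * (sin (x j a + t * y j) * sinh (s * y j))) by [].
apply: bm_sum => j _; apply: bmZ; apply: bmM; last exact: bm_cst.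
by apply: bm_sin; exact: m_add.
Qed.

Let bm_rotU t s : bm (U t s).
Proof. by apply: bmM; [exact: bm_expR|exact: bm_cos]. Qed.

Let bm_rotV' t s : bm (V t s).
Proof. by apply: bmM; [exact: bm_expR|exact: bm_sin]. Qed.

Lemma bm_rotV t s : bm (V t s).
Proof. exact: bm_rotV'. Qed.

Lemma le_norm_functional F G : bm F -> bm G -> (forall a, `|F a| <= G a) -> `|L F| <= L G.
Proof.
move=> bF bG FG; rewrite ler_norml; apply/andP; split; last first.
  by apply: le_L => // a; apply: le_trans (FG a); exact: ler_norm.
rewrite lerNl -mulN1r -LZ//; apply: le_L => //; first exact: bmZ.
by move=> a; rewrite mulN1r; apply: le_trans (FG a); rewrite -normrN ler_norm.
Qed.

(** By [rot_step] the s-derivative of [L (U 0 s)] is minus the t-derivative of [L (V t s)], which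
    vanishes by [LV]. Concretely, n + 1 steps of size 1 / (n + 1) each err by a multiple of its
    square, so the total error is below every positive number. *)
Let rot_cst : L (U 0 1) = L (U 0 0).
Proof.
have [C C0 HC] := rot_step r c y y0 x x0.
pose l1 := L (fun=> 1).
have l10 : 0 <= l1.
  have -> : 0 = L (fun=> 0 * 1) by rewrite LZ ?mul0r//; exact: bm_cst.
  by apply: le_L; [exact: bm_cst|exact: bm_cst|move=> a; rewrite mul0r].
have step s h : 0 <= s <= 1 -> 0 <= h <= 1 ->
    `|L (U 0 (s + h)) - L (U 0 s)| <= C * h ^+ 2 * l1.
  move=> hs hh; have <- : L (fun a => (rotU r c y y0 x x0 a 0 (s + h) + -1 * rotU r c y y0 x x0 a 0 s) +
      (rotV r c y y0 x x0 a h s + -1 * rotV r c y y0 x x0 a 0 s)) = L (U 0 (s + h)) - L (U 0 s).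
    rewrite LD; [|by apply: bmD => //; exact: bmZ|by apply: bmD => //; exact: bmZ].
    rewrite !LD// ?LZ//; [|exact: bmZ|exact: bmZ].
    by rewrite LV; ring.
  rewrite -LZ; last exact: bm_cst.
  apply: le_norm_functional.
  - by apply: bmD; apply: bmD => //; exact: bmZ.
  - exact: bm_cst.
  - by move=> a; rewrite mulr1 !mulN1r; exact: HC.
have chain n k : (k <= n.+1)%N ->
    `|L (U 0 (k%:R / n.+1%:R)) - L (U 0 0)| <= k%:R * (C * n.+1%:R^-1 ^+ 2 * l1).
  elim: k => [_|k IH kn]; first by rewrite !mul0r subrr normr0.
  have n0 : (0 : R) < n.+1%:R by [].
  rewrite -(subrK (L (U 0 (k%:R / n.+1%:R))) (L (U 0 (k.+1%:R / n.+1%:R)))) -addrA.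
  rewrite (le_trans (ler_normD _ _))// -[k.+1%:R in leRHS]natr1 mulrDl mul1r [leRHS]addrC lerD//; last first.
    by apply: IH; exact: ltnW.
  have -> : k.+1%:R / n.+1%:R = k%:R / n.+1%:R + n.+1%:R^-1 :> R.
    by rewrite -natr1 mulrDl mul1r.
  apply: step; apply/andP; split.
  - by rewrite divr_ge0.
  - by rewrite ler_pdivrMr// mul1r ler_nat ltnW.
  - by rewrite invr_ge0 ltW.
  - by rewrite invf_le1// ler1n.
apply/eqP; rewrite -subr_eq0 -normr_le0 leNgt; apply/negP => D0.
pose D := `|L (U 0 1) - L (U 0 0)|; rewrite -/D in D0.
pose n := Num.bound (C * l1 / D).
have : C * l1 / D < n%:R by apply: archi_boundP; rewrite divr_ge0 ?mulr_ge0// ltW.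
have := chain n n.+1 (leqnn _); rewrite divff ?pnatr_eq0// -/D => Dle.
rewrite ltr_pdivrMr// ltNge => /negP; apply.
have n0 : (0 : R) < n.+1%:R by [].
have : D * n.+1%:R <= C * l1.
  rewrite -ler_pdivlMr//; apply: (le_trans Dle); rewrite le_eqVlt; apply/orP; left.
  by apply/eqP; field; rewrite gt_eqF// natr1.
by rewrite -natr1; lra.
Qed.

(** At s = 1 the modulus of the integrand is [exp P], where [c cos x cosh y <= c cos x + |c| (cosh y
    - 1)]. *)
Lemma complex_rotation_bound :
  `|L (fun a => cos (x0 a) * expR (\sum_(j <- r) c j * cos (x j a)))| <=
  expR (- y0 + \sum_(j <- r) `|c j| * (cosh (y j) - 1)) *
  L (fun a => expR (\sum_(j <- r) c j * cos (x j a))).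
Proof.
have bS : bm (fun a => \sum_(j <- r) c j * cos (x j a)).
  by apply: bm_sum => j _; apply: bmZ; exact: bm_cos.
have -> : (fun a => cos (x0 a) * expR (\sum_(j <- r) c j * cos (x j a))) = U 0 0.
  apply/funext => a; rewrite /rotU /rotP /rotQ mulrC; congr (expR _ * cos _).
    by rewrite mul0r subr0; apply: eq_bigr => j _; rewrite !mul0r addr0 cosh0 mulr1.
  by rewrite mul0r big1 ?subr0 ?addr0// => j _; rewrite mul0r sinh0 !mulr0.
rewrite -rot_cst -LZ; last exact: bm_expR.
apply: le_norm_functional => //; first by apply: bmZ; exact: bm_expR.
move=> a; rewrite /rotU normrM ger0_norm ?expR_ge0// -expRD.
apply: (@le_trans _ _ (expR (rotP r c y y0 x a 0 1))).
  by rewrite ler_piMr ?expR_ge0// ler_norml cos_geN1 cos_le1.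
rewrite ler_expR /rotP mul1r addrC -addrA lerD2l -big_split/=.
apply: ler_sum => j _; rewrite mul0r addr0 mul1r.
have := ler_norm (c j * cos (x j a)).
have := ler_pM (normr_ge0 (c j)) (normr_ge0 (cos (x j a))) (lexx `|c j|) (_ : `|cos (x j a)| <= 1).
rewrite -normrM ler_norml cos_geN1 cos_le1 => /(_ isT) h1 h2.
have : c j * cos (x j a) * (cosh (y j) - 1) <= `|c j| * (cosh (y j) - 1).
  by rewrite ler_wpM2r ?subr_ge0 ?cosh_ge1//; lra.
lra.
Qed.

End RotationBound.

(** * Trigonometric approximation *)

Section TrigonometricApproximation.
Context {R : realType}.
Implicit Types (f : R -> R) (c : nat -> R).

Lemma unif_continuous_segment f (a b e : R) : continuous f -> 0 < e ->
  exists2 dl : R, 0 < dl & forall x y, x \in `[a, b] -> `|x - y| < dl ->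
    `|f x - f y| < e.
Proof.
move=> cf e0.
have /compact_near_coveringP cov : compact (`[a, b] : set R) by exact: segment_compact.
pose P (dl x : R) := forall y, `|x - y| < dl -> `|f x - f y| < e.
have [x _|dl [dl0 dlP]] := cov R (0^'+) P _.
  have /cvgrPdist_lt/(_ _ (divr_gt0 e0 (ltr0n _ 2))) := cf x.
  move=> /nbhs_ballP[r /= r0 fr].
  have r2 : 0 < r / 2 by rewrite divr_gt0.
  exists (ball x (r / 2), [set d | d < r / 2]).
    by split; [exact: nbhsx_ballx|exact: nbhs_right_lt].
  move=> [x' d] /= [xx' dr] y x'y; rewrite /ball/= in xx'.
  have h1 : `|f x - f x'| < e / 2 by apply: fr; rewrite /ball/=; lra.
  have h2 : `|f x - f y| < e / 2.
    apply: fr; rewrite /ball/= -(subrK x' x) -addrA.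
    by rewrite (le_lt_trans (ler_normD _ _))//; lra.
  rewrite -(subrK (f x) (f x')) -addrA (le_lt_trans (ler_normD _ _))// distrC.
  lra.
exists (dl / 2) => [|x y xab]; first by rewrite divr_gt0.
have {}dl0 : 0 < dl := dl0.
by apply: (dlP (dl / 2)) => //=; rewrite ?sub0r ?normrN ?gtr0_norm ?divr_gt0//; lra.
Qed.

(** The product formula gives sines of (x + y) / 2 and (y - x) / 2, for x <= y; both angles stay at
    distance at least dl / 2 from 0 and from pi. *)
Lemma cos_gap (dl x y : R) : 0 < dl -> 0 <= x <= pi -> 0 <= y <= pi ->
  dl <= `|x - y| -> 2 * sin (dl / 2) ^+ 2 <= `|cos x - cos y|.
Proof.
move=> d0; wlog xy : x y / x <= y.
  move=> W; have [xy|yx] := leP x y; first exact: W.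
  move=> hx hy; rewrite distrC => h; rewrite distrC; apply: W => //; exact: ltW.
move=> /andP[x0 xpi] /andP[y0 ypi]; rewrite distrC ger0_norm ?subr_ge0// => dxy.
have -> : cos x - cos y = 2 * (sin ((x + y) / 2) * sin ((y - x) / 2)).
  have {1}-> : x = (x + y) / 2 - (y - x) / 2 by lra.
  have {3}-> : y = (x + y) / 2 + (y - x) / 2 by lra.
  by rewrite cosB cosD; ring.
have mono a : dl / 2 <= a <= pi - dl / 2 -> sin (dl / 2) <= sin a.
  move=> /andP[a1 a2]; have [ah|ah] := leP a (pi / 2).
    by rewrite leNgt ltr_sin -?leNgt// in_itv/=; apply/andP; split; lra.
  have -> : sin a = sin (pi - a) by rewrite addrC sinDpi sinN opprK.
  rewrite leNgt ltr_sin -?leNgt ?in_itv/=; first lra.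
  - by apply/andP; split; lra.
  - by apply/andP; split; lra.
have s0 : 0 <= sin (dl / 2) by apply: sin_ge0_pi; apply/andP; split; lra.
have s1 : sin (dl / 2) <= sin ((x + y) / 2) by apply: mono; apply/andP; split; lra.
have s2 : sin (dl / 2) <= sin ((y - x) / 2) by apply: mono; apply/andP; split; lra.
rewrite ger0_norm; first by rewrite ler_pM2l// expr2 ler_pM.
by rewrite mulr_ge0// mulr_ge0// (le_trans s0).
Qed.

Lemma eq_cos_even_periodic f x : (forall t, f (t + 2 * pi) = f t) ->
  (forall t, f (- t) = f t) -> exists2 y : R, 0 <= y <= pi & cos x = cos y /\ f x = f y.
Proof.
move=> fp fe; have p0 : 0 < 2 * pi :> R by rewrite mulr_gt0// pi_gt0.
pose k := Num.floor (x / (2 * pi)); pose z := x - k%:~R * (2 * pi).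
have z0 : 0 <= z by rewrite subr_ge0 -ler_pdivlMr// floor_le_tmp.
have zlt : z < 2 * pi.
  rewrite ltrBlDr -{1}(mul1r (2 * pi)) -mulrDl -ltr_pdivrMr//.
  by rewrite addrC -intrD1 floorD1_gt.
have per (g : R -> R) : (forall t, g (t + 2 * pi) = g t) -> g x = g z.
  move=> gp; suff pz (j : int) t : g (t + j%:~R * (2 * pi)) = g t.
    by rewrite -(pz k z) /z subrK.
  have nat_case (n : nat) u : g (u + n%:R * (2 * pi)) = g u.
    elim: n u => [|n IH] u; first by rewrite mul0r addr0.
    by rewrite -addn1 natrD mulrDl mul1r addrA gp IH.
  case: j => n; first exact: nat_case.
  by rewrite NegzE mulrNz mulNr -[in RHS](subrK (n.+1%:R * (2 * pi)) t) nat_case.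
have cosp t : cos (t + 2 * pi) = cos t :> R.
  by rewrite mulr_natl cosD2pi.
have [zpi|piz] := leP z pi.
  by exists z; rewrite ?z0//; split; [exact: (per cos)|exact: per].
exists (2 * pi - z); first by apply/andP; split; lra.
split; first by rewrite (per cos)// -(cosN z) -(cosp (- z)); congr cos; lra.
by rewrite (per f)// -(fe z) -(fp (- z)); congr f; lra.
Qed.

(** Korovkin's inequality: close points are handled by uniform continuity, distant ones by the fact
    that [cos] separates them. A positive linear operator can be applied to it, which turns a
    variance bound into uniform approximation. *)
Lemma cos_weighted_modulus f (e : R) : continuous f -> 0 < e ->
  exists2 K : R, 0 <= K & forall x y, 0 <= x <= pi -> 0 <= y <= pi ->
    `|f x - f y| <= e + K * (cos x - cos y) ^+ 2.
Proof.
move=> cf e0; have [dl dl0 Hdl] := unif_continuous_segment 0 pi cf e0.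
have [M M0 fM] : exists2 M : R, 0 <= M & forall x, 0 <= x <= pi -> `|f x| <= M.
  have cfM : compact (f @` `[0, pi]).
    by apply: continuous_compact; [exact: continuous_subspaceT|exact: segment_compact].
  have [K [_ HK]] := compact_bounded cfM.
  exists (`|K| + 1) => // x xpi; apply: (HK (`|K| + 1)).
    by rewrite (le_lt_trans (ler_norm K))// ltrDl.
  by exists x => //=; rewrite in_itv.
(* Capped at pi, so that [sin (d / 2)] is positive. *)
pose d := Num.min dl pi.
have d0 : 0 < d by rewrite lt_min dl0 pi_gt0.
have dpi : d <= pi by rewrite ge_min lexx orbT.
pose g := 2 * sin (d / 2) ^+ 2.
have g0 : 0 < g.
  by rewrite mulr_gt0// exprn_gt0// sin_gt0_pi//; apply/andP; split; lra.
exists (2 * M / g ^+ 2); first by rewrite divr_ge0 ?sqr_ge0// mulr_ge0.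
move=> x y hx hy; have [xyd|dxy] := ltP `|x - y| d.
  rewrite -[leLHS]addr0 lerD//; last first.
    apply: mulr_ge0; last exact: sqr_ge0.
    by apply: divr_ge0; [exact: mulr_ge0|exact: sqr_ge0].
  by apply/ltW/Hdl; rewrite ?in_itv// (lt_le_trans xyd)// ge_min lexx.
have := cos_gap d0 hx hy dxy; rewrite -/g => gxy.
rewrite -[leLHS]add0r lerD ?(ltW e0)//.
apply: (@le_trans _ _ (2 * M)).
  by rewrite mulr2n mulrDl !mul1r (le_trans (ler_normB _ _))// lerD// fM.
rewrite -mulrA ler_peMr ?mulr_ge0// mulrC ler_pdivlMr ?exprn_gt0// mul1r.
by rewrite -[leRHS]real_normK ?num_real// ler_pXn2r// nnegrE ltW.
Qed.

(* The Bernstein operator of degree n at y, unfolded one coin toss at a time: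
   the expectation of g under the binomial law of parameters n and y. *)
Fixpoint bernstein (n : nat) (g : nat -> R) (y : R) : R :=
  if n is n'.+1 then y * bernstein n' (g \o S) y + (1 - y) * bernstein n' g y
  else g 0%N.

Lemma bernstein_le n g1 g2 y : 0 <= y <= 1 ->
  (forall k, (k <= n)%N -> g1 k <= g2 k) -> bernstein n g1 y <= bernstein n g2 y.
Proof.
move=> /andP[y0 y1]; elim: n g1 g2 => /= [|n IH] g1 g2 g12; first exact: g12.
rewrite lerD// ler_wpM2l ?subr_ge0//; apply: IH => k kn; apply: g12 => //.
exact: leqW.
Qed.

Lemma bernsteinD n g1 g2 y :
  bernstein n (fun k => g1 k + g2 k) y = bernstein n g1 y + bernstein n g2 y.
Proof.
elim: n g1 g2 => //= n IH g1 g2.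
by rewrite (IH (g1 \o S) (g2 \o S)) IH; ring.
Qed.

Lemma bernsteinZ n a g y : bernstein n (fun k => a * g k) y = a * bernstein n g y.
Proof. by elim: n g => //= n IH g; rewrite (IH (g \o S)) IH; ring. Qed.

Lemma bernstein_cst n a y : bernstein n (fun=> a) y = a.
Proof. by elim: n => //= n IH; rewrite [X in y * X]IH IH; ring. Qed.

Lemma bernstein_variance n (m y : R) :
  bernstein n (fun k => (k%:R - m) ^+ 2) y = n%:R * y * (1 - y) + (n%:R * y - m) ^+ 2.
Proof.
elim: n m => /= [|n IH] m; first by ring.
have -> : (fun k => (k%:R - m) ^+ 2) \o S = (fun k => (k%:R - (m - 1)) ^+ 2).
  by apply/funext => k /=; rewrite -natr1; congr (_ ^+ 2); ring.
by rewrite !IH -natr1; ring.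
Qed.

Definition trigpoly (p : R -> R) :=
  exists M c, forall t, p t = \sum_(k < M) c k * cos (k%:R * t).

Lemma trigpoly_cst a : trigpoly (fun=> a).
Proof.
by exists 1%N, (fun=> a) => t; rewrite big_ord1 mul0r cos0 mulr1.
Qed.

Lemma trigpolyZ a p : trigpoly p -> trigpoly (fun t => a * p t).
Proof.
move=> [M [c pE]]; exists M, (fun k => a * c k) => t.
by rewrite pE mulr_sumr; apply: eq_bigr => k _; rewrite mulrA.
Qed.

Lemma trigpolyD p q : trigpoly p -> trigpoly q -> trigpoly (fun t => p t + q t).
Proof.
move=> [M [c pE]] [N [c' qE]].
exists (M + N)%N, (fun k => (if (k < M)%N then c k else 0) + (if (k < N)%N then c' k else 0)).
move=> t; under eq_bigr do rewrite mulrDl.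
rewrite big_split/= pE qE; congr (_ + _).
  rewrite big_split_ord/= [X in _ + X]big1 ?addr0; last first.
    by move=> i _; rewrite ltnNge leq_addr/= mul0r.
  by apply: eq_bigr => i _; rewrite ltn_ord.
rewrite -(big_mkord xpredT (fun k => (if (k < N)%N then c' k else 0) * cos (k%:R * t))).
rewrite addnC (big_cat_nat (n := N)) ?leq_addr//=.
rewrite [X in _ = _ + X]big_nat_cond [X in _ = _ + X]big1 ?addr0; last first.
  by move=> i /andP[/andP[Ni _] _]; rewrite ltnNge Ni/= mul0r.
rewrite -(big_mkord xpredT (fun k => c' k * cos (k%:R * t))) !big_nat.
by apply: eq_bigr => i /andP[_ ->].
Qed.

Lemma trigpoly_cosM p : trigpoly p -> trigpoly (fun t => cos t * p t).
Proof.
move=> [M [c pE]].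
have -> : (fun t => cos t * p t) =
    (fun t => \sum_(k < M) c k * (cos t * cos (k%:R * t))).
  by apply/funext => t; rewrite pE mulr_sumr; apply: eq_bigr => k _; rewrite mulrCA.
elim: M {pE} => [|M IH].
  have := trigpoly_cst 0; congr trigpoly; apply/funext => t.
  by rewrite big_ord0.
have : trigpoly (fun t => (\sum_(k < M) c k * (cos t * cos (k%:R * t))) +
    c M * (cos t * cos (M%:R * t))).
  apply: trigpolyD => //; apply: trigpolyZ.
  (* Frequency 0 is separate, as the formula [2 cos t cos (k t) = cos ((k + 1) t) + cos ((k - 1) t)]
     is used with natural frequencies only. *)
  case: M {IH} => [|M].
    exists 2%N, (fun k => (k == 1)%:R) => t.
    by rewrite !big_ord_recl big_ord0/= !mul0r cos0 mulr1 add0r !mul1r addr0.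
  exists M.+3, (fun k => ((k == M.+2) || (k == M))%:R / 2) => t.
  rewrite 3!big_ord_recr/= big1 ?add0r; last first.
    by move=> i _; rewrite !ltn_eqF ?mul0r// (leqW (leqW (ltn_ord i))).
  have -> : (M == M.+2) = false by rewrite ltn_eqF.
  have -> : (M.+1 == M.+2) = false by rewrite ltn_eqF.
  have -> : (M.+1 == M) = false by rewrite gtn_eqF.
  rewrite !eqxx/= !mul0r addr0.
  have -> : M.+2%:R * t = M.+1%:R * t + t by rewrite -natr1; ring.
  have -> : M%:R * t = M.+1%:R * t - t by rewrite -natr1; ring.
  by rewrite !cosD cosN sinN; lra.
by congr trigpoly; apply/funext => t; rewrite big_ord_recr.
Qed.

Lemma trigpoly_bernstein n g : trigpoly (fun t => bernstein n g ((1 + cos t) / 2)).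
Proof.
elim: n g => /= [|n IH] g; first exact: trigpoly_cst.
have := trigpolyD (trigpolyZ 2^-1 (trigpolyD (IH (g \o S)) (trigpoly_cosM (IH (g \o S)))))
  (trigpolyZ 2^-1 (trigpolyD (IH g) (trigpolyZ (-1) (trigpoly_cosM (IH g))))).
by congr trigpoly; apply/funext => t; lra.
Qed.

(** Weierstrass approximation by Bernstein polynomials in the variable [(1 + cos t) / 2]; these are
    trigonometric polynomials, and [acos] reads off f at the nodes k / n. *)
Lemma trig_approx f (e : R) : A2 f -> 0 < e ->
  exists M c, forall t, `|f t - \sum_(k < M) c k * cos (k%:R * t)| <= e.
Proof.
move=> [cf [fp fe]] e0.
have [K K0 HK] := cos_weighted_modulus cf (divr_gt0 e0 (ltr0n R 2)).
(* The binomial variance is at most n / 4, so the weighted term of the modulus contributes at most K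
   / n. *)
pose n := (Num.bound (2 * K / e)).+1.
have nb : K / n%:R <= e / 2.
  have : 2 * K / e < n%:R.
    apply: (lt_trans (archi_boundP _)); first by rewrite divr_ge0 ?mulr_ge0// ltW.
    by rewrite ltr_nat.
  by rewrite ltr_pdivrMr// => h; rewrite ler_pdivrMr//; lra.
pose g k := f (acos (2 * k%:R / n%:R - 1)).
have [M [c pE]] := trigpoly_bernstein n g.
exists M, c => t; rewrite -pE.
have [x /[dup] xpi /andP[x0 x1] [-> ->]] := eq_cos_even_periodic t fp fe.
pose y := (1 + cos x) / 2.
have y01 : 0 <= y <= 1.
  have := cos_geN1 x; have := cos_le1 x; rewrite /y => ? ?.
  by apply/andP; split; lra.
have bnd k : (k <= n)%N -> `|f x - g k| <= e / 2 + 4 * K / n%:R ^+ 2 * (k%:R - n%:R * y) ^+ 2.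
  move=> kn; have n0 : (0 : R) < n%:R by [].
  have kn' : (k%:R : R) <= n%:R by rewrite ler_nat.
  have k0 : (0 : R) <= k%:R by [].
  have kI : -1 <= (2 * k%:R / n%:R - 1 : R) <= 1.
    apply/andP; split; first by rewrite lerBrDr addNr divr_ge0// mulr_ge0.
    by rewrite lerBlDr ler_pdivrMr//; lra.
  have [api acosE] := acos_def kI.
  apply: (le_trans (HK _ _ xpi api)); rewrite lerD2l acosE.
  rewrite le_eqVlt; apply/orP; left; apply/eqP; rewrite /y; field.
  by rewrite gt_eqF.
have E1 : `|f x - bernstein n g y| <= bernstein n (fun k => `|f x - g k|) y.
  rewrite -{1}(bernstein_cst n (f x) y) -mulN1r -bernsteinZ -bernsteinD ler_norml.
  have -> : - bernstein n (fun k => `|f x - g k|) y =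
      bernstein n (fun k => -1 * `|f x - g k|) y by rewrite bernsteinZ mulN1r.
  apply/andP; split; apply: bernstein_le => // k _.
    by rewrite !mulN1r lerNl -normrN ler_norm.
  by rewrite mulN1r ler_norm.
apply: (le_trans E1); apply: (le_trans (bernstein_le y01 bnd)).
rewrite bernsteinD bernstein_cst bernsteinZ bernstein_variance subrr expr0n/= addr0.
rewrite [leRHS](splitr e) lerD2l; apply: le_trans nb.
rewrite (_ : 4 * K / n%:R ^+ 2 * (n%:R * y * (1 - y)) = (K / n%:R) * (4 * (y * (1 - y)))).
  rewrite -[leRHS]mulr1 ler_wpM2l ?divr_ge0//.
  have : 0 <= (2 * y - 1) ^+ 2 by exact: sqr_ge0.
  by rewrite sqrrB expr1n; lra.
have n0 : (n%:R : R) != 0 by rewrite pnatr_eq0.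
by move: (n%:R : R) n0 => N N0; clearbody y; field.
Qed.

End TrigonometricApproximation.

(** * Lattice sums *)

Definition nrm (u : site) : nat := maxn `|u.1|%N `|u.2|%N.
Definition dist (u v : site) : nat := nrm (sub_site u v).

Lemma norminfE (u : site) : norminf u = (nrm u)%:Z.
Proof. by case: u => a b; rewrite /norminf /nrm /=; lia. Qed.

Lemma nrm_le_norm1 (u : site) : (nrm u)%:Z <= norm1 u.
Proof. by case: u => a b; rewrite /norm1 /nrm /=; lia. Qed.

Lemma nrm_eq0 (u : site) : (nrm u == 0)%N = (u == site0).
Proof.
case: u => a b; rewrite /nrm /site0 /=; apply/idP/eqP => [|[-> ->]] //.
by move=> h; congr (_, _); lia.
Qed.

Lemma dist_sym u v : dist u v = dist v u.
Proof. by case: u => a b; case: v => c d; rewrite /dist /nrm /=; lia. Qed.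

Lemma dist_triangle v u w : (dist u w <= dist u v + dist v w)%N.
Proof.
by case: u => a b; case: v => c d; case: w => e f; rewrite /dist /nrm /=; lia.
Qed.

Lemma dist_refl u : dist u u = 0%N.
Proof. by case: u => a b; rewrite /dist /nrm /=; lia. Qed.

Lemma nrm_dist u v : (nrm u <= nrm v + dist u v)%N.
Proof. by case: u => a b; case: v => c d; rewrite /dist /nrm /=; lia. Qed.

Lemma zrangeP N a : (a \in zrange N) = (`|a| <= N)%N.
Proof.
apply/mapP/idP => [[i + ->]|aN]; first by rewrite mem_iota -addnn; lia.
exists `|(a + N%:Z)%R|%N; first by rewrite mem_iota -addnn; lia.
by lia.
Qed.

Lemma uniq_zrange N : uniq (zrange N).
Proof. by rewrite map_inj_uniq ?iota_uniq// => i j; lia. Qed.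

Lemma mem_box N u : (u \in box N) = (nrm u <= N)%N.
Proof.
rewrite /nrm; apply/allpairsP/idP => [[[a b] /= [+ + ->]]|].
  by rewrite !zrangeP geq_max => -> ->.
by rewrite geq_max => /andP[h1 h2]; exists u; rewrite !zrangeP h1 h2; case: u h1 h2.
Qed.

Lemma uniq_box N : uniq (box N).
Proof. by apply: allpairs_uniq; rewrite ?uniq_zrange// => -[a b] [c d]. Qed.

Section LatticeSums.
Context {R : realType}.
Implicit Types (G H : nat -> R).

Lemma sum_subseq_le (I : eqType) (l1 l2 : seq I) (P1 P2 : pred I) (F : I -> R) :
  uniq l1 -> uniq l2 -> (forall i, i \in l1 -> P1 i -> (i \in l2) && P2 i) ->
  (forall i, i \in l2 -> P2 i -> 0 <= F i) ->
  \sum_(i <- l1 | P1 i) F i <= \sum_(i <- l2 | P2 i) F i.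
Proof.
move=> u1 u2 sub F0; rewrite -[leLHS]big_filter -[leRHS]big_filter.
set k1 := [seq x <- l1 | P1 x]; set k2 := [seq x <- l2 | P2 x].
have sub12 : {subset k1 <= k2}.
  move=> i; rewrite !mem_filter => /andP[Pi li].
  by have /andP[-> ->] := sub i li Pi.
have uk1 : uniq k1 by rewrite filter_uniq.
have uk2 : uniq k2 by rewrite filter_uniq.
have Fk2 i : i \in k2 -> 0 <= F i by rewrite mem_filter => /andP[? ?]; exact: F0.
rewrite [leRHS](bigID (mem k1))/= -[leLHS]addr0 lerD//; last first.
  by rewrite big_seq_cond sumr_ge0// => i /andP[/Fk2].
rewrite -[leRHS]big_filter le_eqVlt; apply/orP; left; apply/eqP; apply: perm_big.
apply: uniq_perm; rewrite ?filter_uniq// => i; rewrite mem_filter /=.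
by case: (boolP (i \in k1)) => // /sub12 ->.
Qed.

Lemma sum_zrange_le N H : (forall k, 0 <= H k) ->
  \sum_(i <- zrange N) H `|i|%N <= 2 * \sum_(0 <= k < N.+1) H k.
Proof.
move=> H0; rewrite big_map -[iota _ _]/(index_iota 0 (N.*2).+1).
rewrite (big_cat_nat (n := N)) //=; last by rewrite -addnn; lia.
rewrite mulr2n mulrDl mul1r lerD//.
  rewrite big_nat_rev/= add0n big_nat_recl//= -[leLHS]add0r lerD//.
  rewrite le_eqVlt; apply/orP; left; apply/eqP.
  by rewrite !big_nat; apply: eq_bigr => i iN; congr H; lia.
rewrite -{1}(add0n N) big_addn le_eqVlt; apply/orP; left; apply/eqP.
have -> : ((N.*2).+1 - N = N.+1)%N by rewrite -addnn; lia.
by apply: eq_bigr => i _; congr H; lia.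
Qed.

(** At most [8 (k + 1)] sites have sup norm k: two choices of the larger coordinate, two signs for
    it, and a bound [2 (k + 1)] for the number of values of the other. *)
Lemma sum_box_le N G : (forall k, 0 <= G k) ->
  \sum_(u <- box N) G (nrm u) <= 8 * \sum_(0 <= k < N.+1) k.+1%:R * G k.
Proof.
move=> G0; rewrite big_allpairs_dep/=.
pose I (a b : int) : R := (`|b| <= `|a|)%N%:R * G `|a|%N.
have I0 a b : 0 <= I a b by rewrite mulr_ge0.
have le1 : \sum_(a <- zrange N) \sum_(b <- zrange N) G (nrm (a, b)) <=
    \sum_(a <- zrange N) \sum_(b <- zrange N) (I a b + I b a).
  apply: ler_sum => a _; apply: ler_sum => b _; rewrite /nrm/=.
  have [ba|ab] := leqP `|b|%N `|a|%N.
    by rewrite /I ba mul1r lerDl I0.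
  by rewrite /I (ltnW ab) mul1r lerDr I0.
apply: (le_trans le1).
have -> : \sum_(a <- zrange N) \sum_(b <- zrange N) (I a b + I b a) =
    2 * \sum_(a <- zrange N) \sum_(b <- zrange N) I a b.
  under eq_bigr do rewrite big_split.
  by rewrite big_split/= [X in _ + X]exchange_big/=; ring.
have le2 : \sum_(a <- zrange N) \sum_(b <- zrange N) I a b <=
    \sum_(a <- zrange N) 2 * (`|a|%N.+1%:R * G `|a|%N).
  apply: ler_sum => a _; rewrite -mulr_suml mulrA ler_wpM2r//.
  apply: (le_trans (sum_zrange_le (H := fun k => (k <= `|a|)%N%:R) N _)) => //.
  rewrite ler_pM2l//; rewrite -natr_sum ler_nat.
  have cnt n : (\sum_(0 <= i < n) (i <= `|a|)%N <= n)%N.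
    apply: (@leq_trans (\sum_(0 <= i < n) 1)).
      by apply: leq_sum => i _; exact: leq_b1.
    by rewrite sum_nat_const_nat subn0 muln1.
  have [aN|Na] := leqP `|a|%N.+1 N.+1.
    rewrite (big_cat_nat (n := `|a|%N.+1))//= [X in (_ + X)%N]big_nat_cond.
    rewrite [X in (_ + X)%N]big1 ?addn0; last by move=> i /andP[/andP[ai _] _]; rewrite leqNgt ai.
    by rewrite (leq_trans (cnt _))//.
  by rewrite (leq_trans (cnt _))// ltnW.
have le3 := sum_zrange_le (H := fun k => k.+1%:R * G k) N _.
rewrite -mulr_sumr in le2.
have := le3 (fun k => mulr_ge0 (ler0n _ _) (G0 k)); lra.
Qed.

Lemma inv_le_ln_diff (k : nat) : (0 < k)%N -> k.+1%:R^-1 <= ln k.+1%:R - ln k%:R :> R.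
Proof.
move=> k0; have k0R : (0 : R) < k%:R by rewrite ltr0n.
have k1R : (0 : R) < k.+1%:R by [].
rewrite -ln_div ?posrE// -lerN2 -lnV ?posrE ?divr_gt0// invf_div.
have -> : k%:R / k.+1%:R = 1 + - (k.+1%:R^-1) :> R.
  by rewrite -natr1; field; rewrite natr1 gt_eqF.
have := @le_ln1Dx R (- k.+1%:R^-1); apply.
by rewrite ltrN2 invf_lt1// ltr1n ltnS.
Qed.

Lemma sum_inv_le m M : (0 < m)%N -> (m <= M)%N ->
  \sum_(m <= k < M) k.+1%:R^-1 <= ln M%:R - ln m%:R :> R.
Proof.
move=> m0; elim: M => [|M IH]; first by rewrite leqn0 => /eqP ->; rewrite big_geq ?subrr.
rewrite leq_eqVlt => /orP[/eqP <-|]; first by rewrite big_geq ?subrr.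
rewrite ltnS => mM; rewrite big_nat_recr//=.
move: (IH mM) (inv_le_ln_diff (leq_trans m0 mM)).
set a := ln M.+1%:R; set b := M.+1%:R^-1; lra.
Qed.

(** Radii below m contribute a constant, and the shells from m to [m ^ 2] a harmonic sum of size
    [ln (m ^ 2) - ln m = ln m]. This is the Dirichlet energy of the logarithmic profile, up to a
    constant. *)
Lemma sum_inv_sq_box m : (0 < m)%N ->
  \sum_(u <- box (m ^ 2).-1) (maxn m (nrm u))%:R ^- 2 <= 40 + 32 * ln m%:R :> R.
Proof.
move=> m0; have m0R : (0 : R) < m%:R by rewrite ltr0n.
apply: (le_trans (sum_box_le (G := fun k => (maxn m k)%:R ^- 2) _ _)).
  by move=> k; rewrite invr_ge0 exprn_ge0.
have mm : (0 < m ^ 2)%N by rewrite expn_gt0 m0.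
have m2 : (m <= m ^ 2)%N by rewrite -mulnn leq_pmulr.
rewrite prednK// (big_cat_nat (n := m))//=.
have le1 : \sum_(0 <= k < m) k.+1%:R * (maxn m k)%:R ^- 2 <= 1 :> R.
  apply: (@le_trans _ _ (\sum_(0 <= k < m) m%:R^-1)).
    rewrite !big_nat; apply: ler_sum => k km.
    rewrite (maxn_idPl _); last by lia.
    rewrite ler_pdivrMr ?exprn_gt0// expr2 mulKf ?gt_eqF// ler_nat; lia.
  by rewrite sumr_const_nat subn0 -[_ *+ m]mulr_natr mulVf ?gt_eqF.
have le2 : \sum_(m <= k < m ^ 2) k.+1%:R * (maxn m k)%:R ^- 2 <=
    \sum_(m <= k < m ^ 2) 4 * k.+1%:R^-1 :> R.
  rewrite !big_nat; apply: ler_sum => k /andP[mk _].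
  rewrite (maxn_idPr mk); have k0 : (0 : R) < k%:R by rewrite ltr0n; lia.
  rewrite ler_pdivrMr ?exprn_gt0// mulrAC ler_pdivlMr//.
  have : k.+1%:R <= 2 * k%:R :> R by rewrite -natrM ler_nat; lia.
  have := ler0n R k.+1; nra.
have := @sum_inv_le m (m ^ 2) m0 m2; rewrite natrX lnXn// => le3.
rewrite -mulr_sumr in le2; have : 0 <= ln m%:R :> R by rewrite ln_ge0 ?ler1n.
lra.
Qed.

(** Comparison with the telescoping differences of [k^(-g) / g]. *)
Lemma sum_powR_le (g : R) N : 0 < g ->
  \sum_(1 <= k < N) k%:R `^ (- (1 + g)) <= 1 + g^-1.
Proof.
move=> g0; have [N1|N1] := leqP N 1.
  by rewrite big_geq// addr_ge0// invr_ge0 ltW.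
have tele k : (0 < k)%N ->
    k.+1%:R `^ (- (1 + g)) <= g^-1 * (k%:R `^ (- g) - k.+1%:R `^ (- g)).
  move=> k0; have k0R : (0 : R) < k%:R by rewrite ltr0n.
  have k1R : (0 : R) < k.+1%:R by [].
  rewrite mulrC ler_pdivlMr// /powR !gt_eqF//.
  have -> : - (1 + g) * ln k.+1%:R = - ln k.+1%:R + - g * ln k.+1%:R by ring.
  rewrite expRD expRN lnK ?posrE//.
  have -> : - g * ln k%:R = g * (ln k.+1%:R - ln k%:R) + - g * ln k.+1%:R by ring.
  rewrite expRD -[X in _ <= _ - X]mul1r -mulrBl mulrAC ler_wpM2r ?expR_ge0//.
  have := expR_ge1Dx (g * (ln k.+1%:R - ln k%:R)).
  move: (ler_wpM2l (ltW g0) (inv_le_ln_diff k0)).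
  set a := ln _ - ln _; set b := k.+1%:R^-1; lra.
have claim n : \sum_(1 <= k < n.+2) k%:R `^ (- (1 + g)) <=
    1 + g^-1 * (1 - n.+1%:R `^ (- g)).
  elim: n => [|n IH]; first by rewrite big_nat1 !powR1 subrr mulr0 addr0.
  rewrite big_nat_recr//=; have := tele n.+1 isT; lra.
case: N N1 => [|[|n]]// _; apply: (le_trans (claim n)); rewrite lerD2l.
by rewrite ler_piMr ?invr_ge0 ?(ltW g0)// gerBl powR_ge0.
Qed.

(** With [q = alpha / 2] the shell of radius k contributes at most a multiple of
    [k * k^(q - alpha) = k^(1 - alpha / 2)], summable because [alpha > 4]; the same condition gives
    [q > 2]. *)
Lemma moment_bound (J : site -> R) : couplings J -> A1 J ->
  exists q Q : R, [/\ 2 < q, 0 < Q & forall (u : site) (l : seq site), uniq l ->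
    \sum_(v <- l | v != u) J (sub_site u v) * (1 + (dist u v)%:R) `^ q <= Q].
Proof.
move=> [Jsym [J0 _]] [al [Jc [al4 [Jc0 HJ]]]].
pose q := al / 2; pose g := al / 2 - 2.
have g0 : 0 < g by rewrite /g; lra.
(* The added 1 keeps [Q] positive when [Jc = 0]. *)
pose Q := Jc * 2 `^ q * (16 * (1 + g^-1)) + 1.
exists q, Q; split; first by rewrite /q; lra.
  rewrite /Q ltr_pwDr// mulr_ge0 ?mulr_ge0 ?powR_ge0//.
  by rewrite addr_ge0// invr_ge0 ltW.
move=> u l ul.
pose N := \max_(v <- l) dist u v.
have lN v : v \in l -> (dist u v <= N)%N.
  by move=> vl; rewrite /N (big_rem v)//= leq_maxl.
pose F (x : site) := J x * (1 + (nrm x)%:R) `^ q.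
have F0 x : 0 <= F x by rewrite mulr_ge0// powR_ge0.
have inj : injective (sub_site u).
  by case: u {ul lN N} => a b [c d] [e f]; rewrite /sub_site/= => -[h1 h2]; congr (_, _); lia.
have -> : \sum_(v <- l | v != u) J (sub_site u v) * (1 + (dist u v)%:R) `^ q =
    \sum_(x <- map (sub_site u) l | x != site0) F x.
  rewrite big_map; apply: eq_bigl => v.
  have -> : site0 = sub_site u u by case: u {ul lN N inj} => a b; rewrite /sub_site/= !subrr.
  by rewrite (inj_eq inj).
apply: (@le_trans _ _ (\sum_(x <- box N | x != site0) F x)).
  apply: sum_subseq_le; rewrite ?uniq_box ?map_inj_uniq//.
  by move=> _ /mapP[v vl ->] ->; rewrite mem_box lN.
pose G (k : nat) : R := if k == 0%N then 0 else Jc * 2 `^ q * k%:R `^ (- al + q).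
have G0 k : 0 <= G k by rewrite /G; case: eqP => // _; rewrite !mulr_ge0 ?powR_ge0.
have FG : \sum_(x <- box N | x != site0) F x <= \sum_(x <- box N) G (nrm x).
  rewrite big_mkcond/=; apply: ler_sum => x _; rewrite /G nrm_eq0.
  case: eqP => [//|/eqP x0] /=.
  have n0 : (0 : R) < (nrm x)%:R by rewrite ltr0n lt0n nrm_eq0.
  have n1 : (nrm x)%:R <= (norm1 x)%:~R :> R.
    by rewrite -[(nrm x)%:R]/((nrm x)%:Z%:~R) ler_int nrm_le_norm1.
  have J1 : J x <= Jc * (nrm x)%:R `^ (- al).
    apply: (le_trans (HJ x x0)); rewrite ler_wpM2l//.
    rewrite !powRN lef_pV2 ?posrE ?powR_gt0//; last first.
      exact: lt_le_trans n1.
    rewrite ge0_ler_powR ?nnegrE ?(ltW n0)//; first lra.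
  have J2 : (1 + (nrm x)%:R) `^ q <= 2 `^ q * (nrm x)%:R `^ q.
    rewrite -powRM ?(ltW n0)// ge0_ler_powR ?nnegrE ?addr_ge0 ?mulr_ge0 ?(ltW n0)//.
      by rewrite /q; lra.
    have : (1 : R) <= (nrm x)%:R by rewrite ler1n lt0n nrm_eq0.
    lra.
  apply: (le_trans (ler_pM (J0 x) (powR_ge0 _ _) J1 J2)).
  rewrite powRD; last by rewrite (gt_eqF n0) implybT.
  by rewrite le_eqVlt; apply/orP; left; apply/eqP; ring.
apply: (le_trans FG); apply: (le_trans (sum_box_le N G0)).
rewrite big_nat_recl//= {1}/G eqxx mulr0 add0r.
have le1 : \sum_(0 <= k < N) k.+2%:R * G k.+1 <=
    Jc * 2 `^ q * (2 * \sum_(1 <= k < N.+1) k%:R `^ (- (1 + g))).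
  rewrite big_add1/= mulr_sumr mulr_sumr; apply: ler_sum => k _.
  rewrite /G/= mulrCA ler_wpM2l ?mulr_ge0 ?powR_ge0//.
  have k0 : (0 : R) < k.+1%:R by [].
  have -> : - (1 + g) = 1 + (- al + q) by rewrite /g /q; lra.
  rewrite [X in _ <= 2 * X]powRD ?(gt_eqF k0) ?implybT// powRr1 ?(ltW k0)// mulrA.
  apply: ler_wpM2r; first exact: powR_ge0.
  by rewrite -natrM ler_nat; lia.
have := sum_powR_le N.+1 g0 => le2.
rewrite /Q; set A := Jc * _ in le1 *.
have A0 : 0 <= A by rewrite mulr_ge0 ?powR_ge0.
have := ler_wpM2l A0 le2; nra.
Qed.

End LatticeSums.

(** * Sums over pairs of sites *)

Section Pairs.
Context {T : eqType}.
Implicit Types l : seq T.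

Fixpoint pairs l : seq (T * T) :=
  if l is u :: l' then [seq (u, w) | w <- l'] ++ pairs l' else [::].

Lemma big_pairs_cons (V : Type) (idx : V) (op : Monoid.law idx) (F : T -> T -> V) u l :
  \big[op/idx]_(p <- pairs (u :: l)) F p.1 p.2 =
  op (\big[op/idx]_(w <- l) F u w) (\big[op/idx]_(p <- pairs l) F p.1 p.2).
Proof. by rewrite /= big_cat/= big_map. Qed.

Lemma mem_pairs l p : p \in pairs l -> (p.1 \in l) && (p.2 \in l).
Proof.
elim: l => //= u l IH; rewrite mem_cat => /orP[/mapP[w wl ->]/=|/IH /andP[h1 h2]].
  by rewrite !inE eqxx wl orbT.
by rewrite !inE h1 h2 !orbT.
Qed.

(** The exploration meets the sites in an order dictated by the clusters; for symmetric [F] the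
    product over pairs does not see that order. *)
Lemma big_pairs_perm (V : Type) (idx : V) (op : Monoid.com_law idx) (F : T -> T -> V) l l' :
  (forall u v, F u v = F v u) -> perm_eq l l' ->
  \big[op/idx]_(p <- pairs l) F p.1 p.2 = \big[op/idx]_(p <- pairs l') F p.1 p.2.
Proof.
move=> Fsym; elim: l l' => [|u l IH] l' pll'.
  by have /perm_nilP <- : perm_eq l' [::] by rewrite perm_sym.
have ul' : u \in l' by rewrite -(perm_mem pll') mem_head.
case: (splitPr ul') pll' => l1 l2 pll' {l' ul'}.
have pl : perm_eq l (l1 ++ l2).
  by rewrite -(perm_cons u) (perm_trans pll')// -[u :: l2]cat1s perm_catCA.
rewrite big_pairs_cons (IH _ pl) (perm_big _ pl)/= {IH pll' pl}.
elim: l1 => [|w l1 IH]; first by rewrite big_pairs_cons.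
rewrite !cat_cons !big_pairs_cons big_cons -IH !big_cat/= big_cons (Fsym u w).
by rewrite Monoid.mulmACA; congr (op _ _); rewrite Monoid.mulmCA.
Qed.

End Pairs.

Section PairSums.
Context {R : realType} {T : eqType}.

Lemma sum_offdiag (g : T -> T -> R) (l : seq T) : uniq l ->
  (forall u v, g u v = g v u) ->
  \sum_(u <- l) \sum_(v <- l | v != u) g u v = 2 * \sum_(p <- pairs l) g p.1 p.2.
Proof.
move=> + gs; elim: l => [|u l IH] /=; first by rewrite !big_nil mulr0.
move=> /andP[ul unl]; rewrite big_cons big_pairs_cons big_cons eqxx/= mulrDr -(IH unl).
have -> : \sum_(v <- l | v != u) g u v = \sum_(v <- l) g u v.
  rewrite big_seq_cond [RHS]big_seq; apply: eq_bigl => v.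
  by case: (boolP (v \in l)) => //= vl; apply: contraNneq ul => <-.
have -> : \sum_(j <- l) \sum_(v <- u :: l | v != j) g j v =
    \sum_(j <- l) (g u j + \sum_(v <- l | v != j) g j v).
  rewrite !big_seq; apply: eq_bigr => j jl; rewrite big_cons gs.
  by have -> : u != j by apply: contraNneq ul => ->.
by rewrite big_split/=; ring.
Qed.

End PairSums.

(** * Infinite sums over the edges that leave a finite set *)

Section BoundarySums.
Context {R : realType}.
Variables (J : site -> R) (q Q : R) (L : seq site).
Hypothesis J0 : forall x, 0 <= J x.
Hypothesis q0 : 0 <= q.
Hypothesis HQ : forall (u : site) (l : seq site), uniq l ->
    \sum_(v <- l | v != u) J (sub_site u v) * (1 + (dist u v)%:R) `^ q <= Q.
Implicit Types (w : site -> R) (u v : site).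

Definition bsN w u (N : nat) : R := \sum_(v <- box N | v \notin L) J (sub_site u v) * w v.
Definition bs w u : R := limn (bsN w u).

Lemma bsN_le_moment w u N : u \in L ->
  (forall v, v \notin L -> w v <= (1 + (dist u v)%:R) `^ q) -> bsN w u N <= Q.
Proof.
move=> uL wq; apply: le_trans (HQ u (uniq_box N)).
apply: (@le_trans _ _ (\sum_(v <- box N | v \notin L) J (sub_site u v) * (1 + (dist u v)%:R) `^ q)).
  by apply: ler_sum => v vL; rewrite ler_wpM2l// wq.
apply: sum_subseq_le; rewrite ?uniq_box// => v; last by move=> _ _; rewrite mulr_ge0 ?powR_ge0.
by move=> -> vL; apply: contraNneq vL => ->.
Qed.

Lemma one_le_weight u v : 1 <= (1 + (dist u v)%:R) `^ q :> R.
Proof.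
have e1 : 1 `^ q = 1 :> R by rewrite powR1.
by rewrite -[leLHS]e1 ge0_ler_powR ?nnegrE ?addr_ge0// lerDl.
Qed.

Lemma bsN_nd w u : (forall v, v \notin L -> 0 <= w v) ->
  {homo bsN w u : m n / (m <= n)%N >-> m <= n}.
Proof.
move=> w0 m n mn; apply: sum_subseq_le; rewrite ?uniq_box// => v.
  by rewrite !mem_box => /leq_trans -> //.
by move=> _ vL; rewrite mulr_ge0// w0.
Qed.

Lemma cvg_bsN_ge0 w u (G : R) : u \in L ->
  (forall v, v \notin L -> 0 <= w v <= G) -> cvgn (bsN w u).
Proof.
move=> uL wG; have w0 v : v \notin L -> 0 <= w v by move=> /wG /andP[].
apply: nondecreasing_is_cvgn; first by move=> m n; exact: bsN_nd.
exists (`|G| * Q) => _ [N _ <-].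
have -> : bsN w u N = \sum_(v <- box N | v \notin L) J (sub_site u v) * w v by [].
apply: (@le_trans _ _ (`|G| * bsN (fun=> 1) u N)).
  rewrite mulr_sumr; apply: ler_sum => v /wG /andP[_ wG'].
  by rewrite mulr1 mulrC ler_wpM2r// (le_trans wG')// ler_norm.
by rewrite ler_wpM2l// bsN_le_moment// => v _; exact: one_le_weight.
Qed.

Lemma bsND w1 w2 u N : bsN (fun v => w1 v + w2 v) u N = bsN w1 u N + bsN w2 u N.
Proof. by rewrite -big_split; apply: eq_bigr => v _; rewrite mulrDr. Qed.

Lemma bsNZ k w u N : bsN (fun v => k * w v) u N = k * bsN w u N.
Proof. by rewrite mulr_sumr; apply: eq_bigr => v _; rewrite mulrCA. Qed.

(** [w] is the difference of the nonnegative weights [w + G] and [G], whose box sums increase and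
    are bounded by the moment. *)
Lemma cvg_bsN w u (G : R) : u \in L -> (forall v, v \notin L -> `|w v| <= G) ->
  cvgn (bsN w u).
Proof.
move=> uL wG.
have -> : bsN w u = (fun N => bsN (fun v => w v + G) u N + -1 * bsN (fun=> G) u N).
  apply/funext => N; rewrite -bsNZ -bsND; apply: eq_bigr => v _; congr (_ * _).
  by rewrite mulN1r addrK.
apply: is_cvgD; last apply: is_cvgM; first 2 last.
- by apply: (@cvg_bsN_ge0 _ _ `|G|) => // v vL; rewrite ler_norm andbT (le_trans _ (wG v vL)).
- apply: (@cvg_bsN_ge0 _ _ (G + G)) => // v vL.
  by have := wG v vL; rewrite ler_norml => /andP[h1 h2]; apply/andP; split; lra.
- exact: is_cvg_cst.
Qed.

Lemma bsD w1 w2 u (G1 G2 : R) : u \in L ->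
  (forall v, v \notin L -> `|w1 v| <= G1) -> (forall v, v \notin L -> `|w2 v| <= G2) ->
  bs (fun v => w1 v + w2 v) u = bs w1 u + bs w2 u.
Proof.
move=> uL h1 h2; rewrite /bs -limD; [|exact: cvg_bsN h1|exact: cvg_bsN h2].
have -> // : bsN (fun v => w1 v + w2 v) u = bsN w1 u + bsN w2 u.
by apply/funext => N; rewrite bsND.
Qed.

Lemma bsZ k w u (G : R) : u \in L -> (forall v, v \notin L -> `|w v| <= G) ->
  bs (fun v => k * w v) u = k * bs w u.
Proof.
move=> uL h; apply/cvg_lim => //.
have -> : bsN (fun v => k * w v) u = (fun N => k * bsN w u N).
  by apply/funext => N; rewrite bsNZ.
by apply: cvgM; [exact: cvg_cst|exact: cvg_bsN h].
Qed.

Lemma eq_bs w1 w2 u : (forall v, v \notin L -> w1 v = w2 v) -> bs w1 u = bs w2 u.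
Proof.
move=> E; rewrite /bs; have -> // : bsN w1 u = bsN w2 u.
by apply/funext => N; apply: eq_bigr => v vL; rewrite E.
Qed.

Lemma bs_sum (I : Type) (r : seq I) (w : I -> site -> R) u (G : I -> R) : u \in L ->
  (forall i v, v \notin L -> `|w i v| <= G i) ->
  bs (fun v => \sum_(i <- r) w i v) u = \sum_(i <- r) bs (w i) u.
Proof.
move=> uL h; elim: r => [|i r IH].
  have z0 v : v \notin L -> `|0 : R| <= 0 by rewrite normr0.
  have := @bsZ 0 (fun=> 0) u 0 uL z0.
  rewrite !mul0r big_nil => E; rewrite -[RHS]E.
  by apply: eq_bs => v _; rewrite big_nil.
rewrite big_cons -IH -(@bsD _ _ _ (G i) (\sum_(i <- r) G i)) //.
- by apply: eq_bs => v _; rewrite big_cons.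
- by move=> v vL; exact: h.
- by move=> v vL; rewrite (le_trans (ler_norm_sum _ _ _))// ler_sum// => j _; exact: h.
Qed.

Lemma bs_le w u (G B : R) : u \in L -> (forall v, v \notin L -> `|w v| <= G) ->
  (forall N, bsN w u N <= B) -> bs w u <= B.
Proof. by move=> uL h hB; apply: limr_le; [exact: cvg_bsN h|exact: nearW]. Qed.

Lemma bs_mono w1 w2 u (G1 G2 : R) : u \in L ->
  (forall v, v \notin L -> `|w1 v| <= G1) -> (forall v, v \notin L -> `|w2 v| <= G2) ->
  (forall v, v \notin L -> w1 v <= w2 v) -> bs w1 u <= bs w2 u.
Proof.
move=> uL h1 h2 h; apply: ler_lim; [exact: cvg_bsN h1|exact: cvg_bsN h2|].
by apply: nearW => N; apply: ler_sum => v vL; rewrite ler_wpM2l// h.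
Qed.

Definition jb u : R := bs (fun=> 1) u.

Lemma bs_cst u k : u \in L -> bs (fun=> k) u = k * jb u.
Proof.
move=> uL; rewrite -(@bsZ _ _ _ 1)//; last by move=> v _; rewrite normr1.
by apply: eq_bs => v _; rewrite mulr1.
Qed.

(** Applied with k the weight of the distance from u to the complement of [L], it gives the edges
    leaving [L] the same moment bound as the edges inside. *)
Lemma jb_moment u k : u \in L -> 0 <= k ->
  (forall v, v \notin L -> k <= (1 + (dist u v)%:R) `^ q) -> k * jb u <= Q.
Proof.
move=> uL k0 h; rewrite -bs_cst//; apply: (@bs_le _ _ k) => // [v _|N].
  by rewrite ger0_norm.
exact: bsN_le_moment.
Qed.

Lemma jb_ge0 u : u \in L -> 0 <= jb u.
Proof.
move=> uL; rewrite -(mul0r (jb u)) -bs_cst//.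
by apply: (@bs_mono _ _ _ 0 1) => // v _; rewrite ?normr0 ?normr1 ?ler01.
Qed.

Lemma bs_norm_le w u G : u \in L -> (forall v, v \notin L -> `|w v| <= G) ->
  `|bs w u| <= G * jb u.
Proof.
move=> uL h; rewrite ler_norml -mulNr -!bs_cst//; apply/andP; split.
- apply: (@bs_mono _ _ _ `|G| G) => // v vL; first by rewrite normrN.
  by have := h v vL; rewrite ler_norml => /andP[].
- apply: (@bs_mono _ _ _ G `|G|) => // v vL.
  by have := h v vL; rewrite ler_norml => /andP[].
Qed.

Lemma bm_bs (w : Omega R -> site -> R) u (G : R) : u \in L ->
  (forall v, measurable_fun setT (w ^~ v)) -> (forall th v, `|w th v| <= G) ->
  bm (fun th => bs (w th) u).
Proof.
move=> uL mw wG; split; last first.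
  by exists (G * jb u) => th; apply: bs_norm_le.
apply: (@measurable_fun_cvg _ _ _ _ (fun N th => bsN (w th) u N)) => //.
- move=> N; rewrite /bsN; have [] // : bm (fun th => \sum_(v <- box N | v \notin L) J (sub_site u v) * w th v).
  by apply: bm_sum => v _; apply: bmZ; split => //; exists G.
- by move=> th _; apply: (@cvg_bsN _ _ G).
Qed.

End BoundarySums.

(** * Decomposition of the energy *)

Lemma cvg_sumr {R : realType} (T I : Type) (F : set_system T) {FF : Filter F}
    (r : seq I) (P : pred I) (g : I -> T -> R) (l : I -> R) :
  (forall i, P i -> g i x @[x --> F] --> l i) ->
  \sum_(i <- r | P i) g i x @[x --> F] --> \sum_(i <- r | P i) l i.
Proof.
move=> gl; elim: r => [|i r IH].
  rewrite big_nil (_ : (fun x => _) = (fun=> 0)); first exact: cvg_cst.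
  by apply/funext => x; rewrite big_nil.
rewrite (_ : (fun x => _) = (fun x => (if P i then g i x else 0) +
    \sum_(i <- r | P i) g i x)); last first.
  by apply/funext => x; rewrite big_cons; case: ifP => // _; rewrite add0r.
rewrite big_cons -[X in _ --> X](_ : (if P i then l i else 0) + \sum_(j <- r | P j) l j = _).
  by apply: cvgD => //; case: ifP => [/gl//|_]; exact: cvg_cst.
by case: ifP => // _; rewrite add0r.
Qed.

Section EnergyDecomposition.
Context {R : realType}.
Variables (J : site -> R) (q Q : R) (L : seq site).
Hypothesis J0 : forall x, 0 <= J x.
Hypothesis Jsym : forall u v, J (sub_site u v) = J (sub_site v u).
Hypothesis q0 : 0 <= q.
Hypothesis HQ : forall (u : site) (l : seq site), uniq l ->
    \sum_(v <- l | v != u) J (sub_site u v) * (1 + (dist u v)%:R) `^ q <= Q.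
Hypothesis uL : uniq L.
Variables (M : nat) (c : nat -> R) (h : R -> R) (eps : R).
Hypothesis ch : continuous h.
Hypothesis hper : forall t, h (t + 2 * pi) = h t.
Hypothesis heven : forall t, h (- t) = h t.
Hypothesis h0eps : forall t, 0 <= h t <= eps.

Definition ptrig t := \sum_(k <- iota 0 M) c k * cos (k%:R * t).
Notation bs := (bs J L).
Notation jb := (jb J L).

(** All the edges from u out of [L] share this factor, so that only finitely many factors are
    expanded. *)
Definition kb u (th : Omega R) := expR (bs (fun v => h (th u - th v)) u) - 1.
Definition kk u v (th : Omega R) := expR (J (sub_site u v) * h (th u - th v)) - 1.
Definition smoothE (th : Omega R) : R :=
  \sum_(u <- L) bs (fun v => ptrig (th u - th v)) u +
  \sum_(p <- pairs L) J (sub_site p.1 p.2) * ptrig (th p.1 - th p.2).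

Let cM := \sum_(k <- iota 0 M) `|c k|.

Let ptrig_bound t : `|ptrig t| <= cM.
Proof.
apply: (le_trans (ler_norm_sum _ _ _)); apply: ler_sum => k _.
by rewrite normrM ler_piMr// ler_norml cos_geN1 cos_le1.
Qed.

Let h_bound t : `|h t| <= eps.
Proof. by have /andP[? ?] := h0eps t; rewrite ger0_norm. Qed.

Lemma ptrig_even t : ptrig (- t) = ptrig t.
Proof. by apply: eq_bigr => k _; rewrite mulrN cosN. Qed.

Lemma expR_energy th : expR (energy (fun t => ptrig t + h t) J L th) =
  expR (smoothE th) *
  (\prod_(u <- L) (1 + kb u th) * \prod_(p <- pairs L) (1 + kk p.1 p.2 th)).
Proof.
rewrite /energy; set f := fun t => ptrig t + h t.
have fb t : `|f t| <= cM + eps by rewrite (le_trans (ler_normD _ _))// lerD.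
have -> : (fun N => \sum_(u <- L) \sum_(v <- box N | v \notin L)
      J (sub_site u v) * f (th u - th v)) =
    (fun N => \sum_(u <- L) bsN J L (fun v => f (th u - th v)) u N) by [].
have -> : limn (fun N => \sum_(u <- L) bsN J L (fun v => f (th u - th v)) u N) =
    \sum_(u <- L) bs (fun v => f (th u - th v)) u.
  apply/cvg_lim => //; rewrite big_seq.
  rewrite (_ : (fun N => _) = (fun N => \sum_(u <- L | u \in L)
    bsN J L (fun v => f (th u - th v)) u N)); last by apply/funext => N; rewrite big_seq.
  apply: cvg_sumr.
  by move=> u ul; apply: (cvg_bsN J0 q0 HQ (G := cM + eps)) ul _ => v _.
rewrite sum_offdiag//; last first.
  by move=> u v; rewrite Jsym -opprB /f ptrig_even heven.
rewrite [2^-1 * _]mulrA mulVf// mul1r.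
have -> : \sum_(u <- L) bs (fun v => f (th u - th v)) u =
    \sum_(u <- L) bs (fun v => ptrig (th u - th v)) u + \sum_(u <- L) bs (fun v => h (th u - th v)) u.
  rewrite -big_split/= !big_seq; apply: eq_bigr => u ul.
  by apply: (bsD J0 q0 HQ ul) => v _; [exact: ptrig_bound|exact: h_bound].
have -> : \sum_(p <- pairs L) J (sub_site p.1 p.2) * f (th p.1 - th p.2) =
    \sum_(p <- pairs L) J (sub_site p.1 p.2) * ptrig (th p.1 - th p.2) +
    \sum_(p <- pairs L) J (sub_site p.1 p.2) * h (th p.1 - th p.2).
  by rewrite -big_split; apply: eq_bigr => p _; rewrite mulrDr.
rewrite addrACA expRD; congr (_ * _); rewrite expRD !expR_sum; congr (_ * _).
- by apply: eq_bigr => u _; rewrite /kb [1 + _]addrC subrK.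
- by apply: eq_bigr => p _; rewrite /kk [1 + _]addrC subrK.
Qed.

(* Each term of the smooth energy is [coef * cos (k (th u - th v) + phase)],
   with [th v] absent in the boundary terms. *)
Definition trm : Type := R * nat * site * option site * R.
Definition tcoef (x : trm) : R := x.1.1.1.1.
Definition targ (x : trm) (th : site -> R) : R :=
  (x.1.1.1.2)%:R * (th x.1.1.2 - (if x.1.2 is Some v then th v else 0)) + x.2.
Definition tslope (x : trm) (a : site -> R) : R :=
  (x.1.1.1.2)%:R * (a x.1.1.2 - (if x.1.2 is Some v then a v else 0)).

(** For fixed boundary values the infinitely many outgoing edges of a site collapse, by the addition
    formula, to one cosine and one sine per frequency; the sine is a cosine of phase - pi / 2. *)
Definition terms (thb : Omega R) : seq trm :=
  [seq (c k * J (sub_site p.1 p.2), k, p.1, Some p.2, 0) | p <- pairs L, k <- iota 0 M] ++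
  [seq (c k * bs (fun v => cos (k%:R * thb v)) u, k, u, None, 0) | u <- L, k <- iota 0 M] ++
  [seq (c k * bs (fun v => sin (k%:R * thb v)) u, k, u, None, - (pi / 2)) | u <- L, k <- iota 0 M].

Let cos_norm1 (t : R) : `|cos t| <= 1.
Proof. by rewrite ler_norml cos_geN1 cos_le1. Qed.

Let sin_norm1 (t : R) : `|sin t| <= 1.
Proof. by rewrite ler_norml sin_geN1 sin_le1. Qed.

Lemma smoothE_terms thb th : (forall v, v \notin L -> th v = thb v) ->
  smoothE th = \sum_(x <- terms thb) tcoef x * cos (targ x th).
Proof.
move=> thE; rewrite /terms big_cat/= big_cat/= !big_allpairs_dep/= [RHS]addrC; congr (_ + _).
  rewrite -big_split/= !big_seq; apply: eq_bigr => u ul.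
  rewrite -big_split/=.
  rewrite (bs_sum J0 q0 HQ (G := fun k => `|c k|) _ ul); last first.
    by move=> k v _; rewrite normrM ler_piMr.
  apply: eq_bigr => k _; rewrite /tcoef /targ/= subr0 addr0 cosBpihalf.
  have b1 v : v \notin L -> `|c k * (cos (k%:R * th u) * cos (k%:R * thb v))| <= `|c k|.
    by rewrite !normrM => _; rewrite ler_piMr// mulr_ile1.
  have b2 v : v \notin L -> `|c k * (sin (k%:R * th u) * sin (k%:R * thb v))| <= `|c k|.
    by rewrite !normrM => _; rewrite ler_piMr// mulr_ile1.
  have -> : bs (fun v => c k * cos (k%:R * (th u - th v))) u =
      bs (fun v => c k * (cos (k%:R * th u) * cos (k%:R * thb v)) +
        c k * (sin (k%:R * th u) * sin (k%:R * thb v))) u.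
    by apply: eq_bs => v vL; rewrite mulrBr cosB (thE _ vL) mulrDr.
  rewrite (bsD J0 q0 HQ ul b1 b2); congr (_ + _).
    have -> : bs (fun v => c k * (cos (k%:R * th u) * cos (k%:R * thb v))) u =
      bs (fun v => (c k * cos (k%:R * th u)) * cos (k%:R * thb v)) u.
      by apply: eq_bs => v _; rewrite mulrA.
    by rewrite (bsZ J0 q0 HQ _ (G := 1) ul)// mulrAC.
  have -> : bs (fun v => c k * (sin (k%:R * th u) * sin (k%:R * thb v))) u =
    bs (fun v => (c k * sin (k%:R * th u)) * sin (k%:R * thb v)) u.
    by apply: eq_bs => v _; rewrite mulrA.
  by rewrite (bsZ J0 q0 HQ _ (G := 1) ul)// mulrAC.
apply: eq_bigr => p _; rewrite mulr_sumr; apply: eq_bigr => k _.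
by rewrite /tcoef /targ/= addr0 mulrCA mulrA.
Qed.

Definition cost (y : R) : R := (M%:R * y) ^+ 2 * expR (M%:R * `|y|).

Let cosh_cost k y : k \in iota 0 M -> cosh (k%:R * y) - 1 <= cost y.
Proof.
rewrite mem_iota add0n => /andP[_ kM]; apply: (le_trans (cosh_sub1_le _)).
have kM' : k%:R <= M%:R :> R by rewrite ler_nat ltnW.
apply: ler_pM; [exact: sqr_ge0|exact: expR_ge0| |].
  by rewrite !exprMn ler_wpM2r ?sqr_ge0// ler_pXn2r// nnegrE.
by rewrite ler_expR normrM ger0_norm// ler_wpM2r.
Qed.

(** The factor 2 accounts for the cosine and the sine term of each boundary sum, both of coefficient
    at most [|c k| * jb u]. *)
Lemma cost_terms thb a :
  \sum_(x <- terms thb) `|tcoef x| * (cosh (tslope x a) - 1) <=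
  2 * cM * (\sum_(u <- L) jb u * cost (a u) +
            \sum_(p <- pairs L) J (sub_site p.1 p.2) * cost (a p.1 - a p.2)).
Proof.
have cost0 y : 0 <= cost y by rewrite mulr_ge0 ?sqr_ge0 ?expR_ge0.
have cM0 : 0 <= cM by exact: sumr_ge0.
rewrite /terms big_cat/= big_cat/= !big_allpairs_dep/= mulrDr addrC lerD//.
  have bnd (g : R -> R) : (forall t, `|g t| <= 1) ->
      \sum_(u <- L) \sum_(k <- iota 0 M) `|c k * bs (fun v => g (k%:R * thb v)) u| *
         (cosh (k%:R * (a u - 0)) - 1) <= cM * \sum_(u <- L) jb u * cost (a u).
    move=> g1; rewrite mulr_sumr !big_seq; apply: ler_sum => u ul.
    rewrite mulr_suml !big_seq; apply: ler_sum => k kM.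
    rewrite normrM -mulrA ler_wpM2l// subr0 ler_pM ?subr_ge0 ?cosh_ge1//; last exact: cosh_cost.
    by rewrite -[leRHS]mul1r (bs_norm_le J0 q0 HQ ul)// => v _; exact: g1.
  have := bnd cos cos_norm1; have := bnd sin sin_norm1; rewrite /tcoef /tslope/=; lra.
have -> : 2 * cM * \sum_(p <- pairs L) J (sub_site p.1 p.2) * cost (a p.1 - a p.2) =
  \sum_(p <- pairs L) \sum_(k <- iota 0 M) 2 * `|c k| * (J (sub_site p.1 p.2) * cost (a p.1 - a p.2)).
  rewrite mulr_sumr; apply: eq_bigr => p _.
  by rewrite -mulr_suml -mulr_sumr.
apply: ler_sum => p _; rewrite !big_seq; apply: ler_sum => k kM; rewrite /tcoef /tslope/=.
rewrite normrM (ger0_norm (J0 _)) -mulrA.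
have h1 : J (sub_site p.1 p.2) * (cosh (k%:R * (a p.1 - a p.2)) - 1) <=
    J (sub_site p.1 p.2) * cost (a p.1 - a p.2) by rewrite ler_wpM2l// cosh_cost.
have h2 := ler_wpM2l (normr_ge0 (c k)) h1.
have h3 := mulr_ge0 (normr_ge0 (c k)) (mulr_ge0 (J0 (sub_site p.1 p.2)) (cost0 (a p.1 - a p.2))).
lra.
Qed.

Let m_sub u v : measurable_fun setT (fun th : Omega R => th u - th v).
Proof. by apply: measurable_funB; exact: measurable_eval. Qed.

Let m_cont (g : R -> R) u v : continuous g ->
  measurable_fun setT (fun th : Omega R => g (th u - th v)).
Proof. by move=> cg; apply: measurableT_comp (m_sub u v); exact: continuous_measurable_fun. Qed.

Lemma continuous_ptrig : continuous ptrig.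
Proof.
move=> t; rewrite /ptrig; apply: cvg_sumr => k _; apply: cvgM; first exact: cvg_cst.
apply: continuous_cvg; first exact: continuous_cos.
by apply: cvgM; [exact: cvg_cst|exact: cvg_id].
Qed.

Lemma bm_smoothE : bm smoothE.
Proof.
apply: bmD.
  have : bm (fun th : Omega R => \sum_(u <- L | u \in L) bs (fun v => ptrig (th u - th v)) u).
    apply: bm_sum => u ul; apply: (bm_bs J0 q0 HQ (G := cM) ul) => [v|th v] //.
    exact: (m_cont _ _ continuous_ptrig).
  by apply: eq_bm => th; rewrite -big_seq.
apply: bm_sum => p _; apply: bmZ; split; last by exists cM => th.
exact: (m_cont _ _ continuous_ptrig).
Qed.

Lemma bm_kb u : u \in L -> bm (kb u).
Proof.
move=> ul; apply: bmB; last exact: bm_cst.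
apply: bm_expR; apply: (bm_bs J0 q0 HQ (G := eps) ul) => [v|th v] //.
exact: m_cont.
Qed.

Lemma bm_kk u v : bm (kk u v).
Proof.
apply: bmB; last exact: bm_cst.
apply: bm_expR; apply: bmZ; split; last by exists eps => th.
exact: m_cont.
Qed.

Lemma kk_sym u v th : kk u v th = kk v u th.
Proof. by rewrite /kk Jsym -[th u - th v]opprB heven. Qed.

Lemma kk_ge0 u v th : 0 <= kk u v th.
Proof.
rewrite subr_ge0 -expR0 ler_expR mulr_ge0//.
by have /andP[] := h0eps (th u - th v).
Qed.

(* k <= x (1 + k) for 1 + k = e^y, 0 <= y <= x; it bounds the opening
   probability k / (1 + k) of an edge. *)
Let opening (y x : R) : y <= x -> expR y - 1 <= x * (1 + (expR y - 1)).
Proof.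
move=> yx; have := expR_ge1Dx (- y); rewrite expRN => h1.
have e0 := expR_gt0 y.
have h2 : (1 - y) * expR y <= 1.
  by have := ler_wpM2r (ltW e0) h1; rewrite mulVf ?gt_eqF.
have := ler_wpM2r (ltW e0) yx; lra.
Qed.

Lemma kk_le u v th : kk u v th <= eps * J (sub_site u v) * (1 + kk u v th).
Proof.
apply: opening; rewrite mulrC ler_wpM2r//.
by have /andP[] := h0eps (th u - th v).
Qed.

Lemma kb_ge0 u th : u \in L -> 0 <= kb u th.
Proof.
move=> ul; rewrite subr_ge0 -expR0 ler_expR -(mul0r (jb u)) -(bs_cst J0 q0 HQ 0 ul).
apply: (bs_mono J0 q0 HQ (G1 := 0) (G2 := eps)) => // v _; first by rewrite normr0.
by have /andP[] := h0eps (th u - th v).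
Qed.

Lemma kb_le u th : u \in L -> kb u th <= eps * jb u * (1 + kb u th).
Proof.
move=> ul; apply: opening; rewrite -(bs_cst J0 q0 HQ eps ul).
apply: (bs_mono J0 q0 HQ (G1 := eps) (G2 := `|eps|)) => // v _.
by have /andP[] := h0eps (th u - th v).
Qed.

Let upd_self (th : Omega R) u t : upd th u t u = t.
Proof. by rewrite /upd eqxx. Qed.

Let upd_other (th : Omega R) u v t : v != u -> upd th u t v = th v.
Proof. by move=> vu; rewrite /upd (negbTE vu). Qed.

Let hper_sub (a b : R) : h (a + 2 * pi - b) = h (a - b) /\ h (b - (a + 2 * pi)) = h (b - a).
Proof.
split; first by rewrite addrAC hper.
by rewrite -(hper (b - _)); congr h; ring.
Qed.

Let h_upd (th : Omega R) u v w :
  h (upd th u (th u + 2 * pi) v - upd th u (th u + 2 * pi) w) = h (th v - th w).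
Proof.
have [->|vu] := eqVneq v u; have [->|wu] := eqVneq w u.
- by rewrite !subrr.
- by rewrite upd_self upd_other//; have [] := hper_sub (th u) (th w).
- by rewrite upd_self upd_other//; have [] := hper_sub (th u) (th v).
- by rewrite !upd_other.
Qed.

Lemma periodic_kb u v : periodic_at (kb v) u.
Proof. by move=> th; rewrite /kb; congr (expR _ - 1); apply: eq_bs => w _; rewrite h_upd. Qed.

Lemma periodic_kk u v w : periodic_at (kk v w) u.
Proof. by move=> th; rewrite /kk h_upd. Qed.

Lemma kk_rotate u v psi th : psi u = psi v -> kk u v (rotate psi th) = kk u v th.
Proof. by move=> E; rewrite /kk /rotate /= E; congr (expR (_ * h _) - 1); ring. Qed.

Lemma kb_rotate u psi th : psi u = 0 -> (forall v, v \notin L -> psi v = 0) ->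
  kb u (rotate psi th) = kb u th.
Proof.
move=> E F; rewrite /kb /rotate /= E; congr (expR _ - 1); apply: eq_bs => v vL.
by rewrite F// !addr0.
Qed.

(** The spins enter the arguments of the cosines with integer coefficients, so advancing one spin by
    a period moves them by multiples of 2 pi; [rint_rotate] needs this periodicity. *)
Let targ_upd x (th : Omega R) u : exists z : int,
  targ x (upd th u (th u + 2 * pi)) = targ x th + z%:~R * (2 * pi).
Proof.
have [z zE] : exists z : int, upd th u (th u + 2 * pi) x.1.1.2 -
    (if x.1.2 is Some v then upd th u (th u + 2 * pi) v else 0) =
    th x.1.1.2 - (if x.1.2 is Some v then th v else 0) + z%:~R * (2 * pi).
  case: x.1.2 => [v|].
  - have [->|vu] := eqVneq x.1.1.2 u; have [->|wu] := eqVneq v u.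
    + by exists 0; rewrite !subrr mul0r addr0.
    + by exists 1; rewrite upd_self upd_other//; ring.
    + by exists (-1); rewrite upd_self upd_other//; ring.
    + by exists 0; rewrite !upd_other// mul0r addr0.
  - have [->|vu] := eqVneq x.1.1.2 u.
    + by exists 1; rewrite upd_self; ring.
    + by exists 0; rewrite !upd_other// mul0r addr0.
exists (x.1.1.1.2%:Z * z); rewrite /targ zE intrM mulrDr -pmulrn; ring.
Qed.

Let cos2pi_per (t : R) : cos (t + 2 * pi) = cos t.
Proof. by rewrite mulr_natl cosD2pi. Qed.

Let sin2pi_per (t : R) : sin (t + 2 * pi) = sin t.
Proof. by rewrite mulr_natl sinD2pi. Qed.

Lemma rint_rotation thb pre (a : site -> R) (u0 : site) (b : R) :
  bm pre -> (forall th, 0 <= pre th) ->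
  (forall u, u \in L -> periodic_at pre u) ->
  (forall t th, pre (rotate (fun u => t * a u) th) = pre th) ->
  (forall v, v \notin L -> a v = 0) ->
  `|rint L (fun th => cos (th u0 - b) * expR (smoothE th) * pre th) thb| <=
  expR (- a u0 + 2 * cM * (\sum_(u <- L) jb u * cost (a u) +
            \sum_(p <- pairs L) J (sub_site p.1 p.2) * cost (a p.1 - a p.2))) *
  rint L (fun th => expR (smoothE th) * pre th) thb.
Proof.
move=> bpre pre0 ppre ipre a0.
pose r := terms thb; pose S th := \sum_(x <- r) tcoef x * cos (targ x th).
have mt x : measurable_fun setT (targ x : Omega R -> R).
  rewrite /targ; apply: measurable_funD; last exact: measurable_cst.
  apply: measurable_funM; first exact: measurable_cst.
  apply: measurable_funB; first exact: measurable_eval.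
  by case: x.1.2 => [v|]; [exact: measurable_eval|exact: measurable_cst].
have mx0 : measurable_fun setT (fun th : Omega R => th u0 - b).
  by apply: measurable_funB; [exact: measurable_eval|exact: measurable_cst].
have -> : rint L (fun th => cos (th u0 - b) * expR (smoothE th) * pre th) thb =
    rint L (fun th => cos (th u0 - b) * expR (S th) * pre th) thb.
  by apply: eq_rint_off => th thE; rewrite (smoothE_terms thE).
have -> : rint L (fun th => expR (smoothE th) * pre th) thb =
    rint L (fun th => expR (S th) * pre th) thb.
  by apply: eq_rint_off => th thE; rewrite (smoothE_terms thE).
pose Lf (F : Omega R -> R) := rint L (fun th => F th * pre th) thb.
have inv (G : Omega R -> R -> R -> R) (s t : R) : bm (G ^~ 0 ^~ s) ->
   (forall u, u \in L -> periodic_at (G ^~ 0 ^~ s) u) ->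
   (forall th, G (rotate (fun u => t * a u) th) 0 s = G th t s) ->
   Lf (G ^~ t ^~ s) = Lf (G ^~ 0 ^~ s).
  move=> bG pG sG; rewrite /Lf -[RHS](rint_rotate (psi := fun u => t * a u)).
  - by apply: eq_rint => th /=; rewrite sG ipre.
  - exact: bmM.
  - by move=> u ul th; rewrite (pG u ul th) (ppre u ul th).
  - by move=> v vL; rewrite a0// mulr0.
pose y x := tslope x a.
have targ_shift x t (th : Omega R) : targ x (rotate (fun u => t * a u) th) = targ x th + t * y x.
  by rewrite /targ /y /tslope /rotate /=; case: x.1.2 => [v|]; ring.
have cper (z : int) (t : R) : cos (t + z%:~R * (2 * pi)) = cos t by rewrite (periodicz z t cos2pi_per).
have sper (z : int) (t : R) : sin (t + z%:~R * (2 * pi)) = sin t by rewrite (periodicz z t sin2pi_per).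
pose x0 (th : Omega R) := th u0 - b.
have x0_upd (th : Omega R) u : exists z : int, x0 (upd th u (th u + 2 * pi)) = x0 th + z%:~R * (2 * pi).
  rewrite /x0; have [->|uu] := eqVneq u0 u.
    by exists 1; rewrite upd_self; ring.
  by exists 0; rewrite upd_other// mul0r addr0.
have rotP_upd s (th : Omega R) u : rotP r tcoef y (a u0) targ (upd th u (th u + 2 * pi)) 0 s =
    rotP r tcoef y (a u0) targ th 0 s.
  congr (_ - _); apply: eq_bigr => x _; have [z ->] := targ_upd x th u.
  by rewrite addrAC cper.
have rotQ_upd s (th : Omega R) u : exists z : int,
    rotQ r tcoef y (a u0) targ x0 (upd th u (th u + 2 * pi)) 0 s =
    rotQ r tcoef y (a u0) targ x0 th 0 s + z%:~R * (2 * pi).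
  have [z zE] := x0_upd th u; exists z; rewrite /rotQ zE addrAC; congr (_ + (_ - _) + _).
  apply: eq_bigr => x _; have [z' ->] := targ_upd x th u.
  by rewrite addrAC sper.
have rotP_shift s t (th : Omega R) : rotP r tcoef y (a u0) targ (rotate (fun u => t * a u) th) 0 s =
    rotP r tcoef y (a u0) targ th t s.
  by congr (_ - _); apply: eq_bigr => x _; rewrite targ_shift mul0r addr0.
have rotQ_shift s t (th : Omega R) : rotQ r tcoef y (a u0) targ x0 (rotate (fun u => t * a u) th) 0 s =
    rotQ r tcoef y (a u0) targ x0 th t s.
  rewrite /rotQ /x0 {1}/rotate !addrA.
  have -> : th u0 + t * a u0 - b + 0 * a u0 = th u0 - b + t * a u0 by ring.
  by congr (_ - _); apply: eq_bigr => x _; rewrite targ_shift mul0r addr0.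
have bV (s t : R) : bm (fun th : Omega R => rotV r tcoef y (a u0) targ x0 th t s).
  exact: bm_rotV.
have := @complex_rotation_bound _ (Omega R) R trm Lf r tcoef y (a u0) targ x0.
rewrite /Lf => rot.
apply: (@le_trans _ _ (expR (- a u0 + \sum_(j <- r) `|tcoef j| * (cosh (y j) - 1)) *
    rint L (fun th => expR (S th) * pre th) thb)).
apply: rot.
- by move=> F G bF bG; rewrite -rintD; [|exact: bmM|exact: bmM];
    apply: eq_rint => th; rewrite mulrDl.
- by move=> k F bF; rewrite -rintZ; [|exact: bmM]; apply: eq_rint => th; rewrite mulrA.
- move=> F G bF bG FG; apply: le_rint; [exact: bmM|exact: bmM|].
  by move=> th; rewrite ler_wpM2r.
- exact: mt.
- exact: mx0.
- move=> t s; apply: (inv (rotV r tcoef y (a u0) targ x0)) => //.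
  + by move=> u ul th; rewrite /rotV rotP_upd; have [z ->] := rotQ_upd s th u; rewrite sper.
  + by move=> th; rewrite /rotV rotP_shift rotQ_shift.
rewrite ler_wpM2r//; last by rewrite ler_expR lerD2l; exact: cost_terms.
have -> : 0 = rint L (fun=> 0) thb by rewrite rint_cst mul0r.
apply: le_rint; first exact: bm_cst.
- apply: bmM => //; apply: bm_expR; apply: bm_sum => x _; apply: bmZ; exact: bm_cos.
- by move=> th; rewrite mulr_ge0 ?expR_ge0.
Qed.

End EnergyDecomposition.

(** * Exploration of the blocks *)

Section Exploration.
Context {R : realType}.
Variables (J : site -> R) (q Q : R) (n : nat) (L : seq site).
Hypothesis J0 : forall x, 0 <= J x.
Hypothesis q0 : 0 <= q.
Hypothesis Q0 : 0 < Q.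
Hypothesis HQ : forall (u : site) (l : seq site), uniq l ->
    \sum_(v <- l | v != u) J (sub_site u v) * (1 + (dist u v)%:R) `^ q <= Q.
Hypothesis uL : uniq L.
Hypothesis Lout : forall u v, u \in L -> v \notin L -> (n - nrm u <= dist u v)%N.

(* [N] and [D] are the absolute numerator and the denominator of a Gibbs
   expectation, as functionals of the part of the weight not yet expanded;
   [k u v] and [kb u] are the extra weights of the edges inside [L] and from
   [u] to the outside of [L]. *)
Variables (N D : (Omega R -> R) -> R) (k : site -> site -> Omega R -> R)
  (kb : site -> Omega R -> R) (kappa t eps : R) (be1 be2 : site -> R) (G0 : R).
Notation jb := (jb J L).
Hypothesis ND : forall F G, bm F -> bm G -> N (fun th => F th + G th) <= N F + N G.
Hypothesis DD : forall F G, bm F -> bm G -> D (fun th => F th + G th) = D F + D G.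
Hypothesis DZ : forall c F, bm F -> D (fun th => c * F th) = c * D F.
Hypothesis le_D : forall F G, bm F -> bm G -> (forall th, F th <= G th) -> D F <= D G.
Hypothesis bm_k : forall u v, bm (k u v).
Hypothesis bm_kb : forall u, u \in L -> bm (kb u).
Hypothesis k_sym : forall u v th, k u v th = k v u th.
Hypothesis k_ge0 : forall u v th, 0 <= k u v th.
Hypothesis kb_ge0 : forall u th, u \in L -> 0 <= kb u th.
Hypothesis k_le : forall u v th, k u v th <= eps * J (sub_site u v) * (1 + k u v th).
Hypothesis kb_le : forall u th, u \in L -> kb u th <= eps * jb u * (1 + kb u th).
Hypothesis k_periodic : forall u v w, periodic_at (k v w) u.
Hypothesis kb_periodic : forall u v, periodic_at (kb v) u.
Hypothesis k_rotate : forall u v psi th, psi u = psi v -> k u v (rotate psi th) = k u v th.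
Hypothesis kb_rotate : forall u psi th, psi u = 0 -> (forall v, v \notin L -> psi v = 0) ->
  kb u (rotate psi th) = kb u th.
Hypothesis kappa_ge1 : 1 <= kappa.
Hypothesis tE : t = kappa * expR 1.
Hypothesis epsE : eps = (2 * t * Q)^-1.
Hypothesis be1_ge0 : forall u, 0 <= be1 u.
Hypothesis be2_ge0 : forall u, 0 <= be2 u.
Hypothesis G00 : 0 <= G0.

(* A block is a set of sites explored from a root, with a flag telling whether
   it was connected to the outside of [L] and an upper bound on its extent,
   the product of (1 + length) over the edges discovered so far. *)
Definition blk : Type := seq site * site * bool * R.
Definition bsites (b : blk) := b.1.1.1.
Definition broot (b : blk) := b.1.1.2.
Definition btouch (b : blk) := b.1.2.
Definition bext (b : blk) := b.2.

(** A touching block counts the outside of [L] among the places that it reaches; [n - nrm] is the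
    truncated distance from the root to the outside. *)
Definition valid (b : blk) := [/\ broot b \in bsites b,
  forall u, u \in bsites b -> 1 + (dist u (broot b))%:R <= bext b &
  btouch b -> 1 + (n - nrm (broot b))%N%:R <= bext b].

Definition locked_on (b : blk) (psi : site -> R) :=
  (forall u, u \in bsites b -> psi u = psi (broot b)) /\ (btouch b -> psi (broot b) = 0).

(** Expanded factors join sites of one block, or a touching block to the outside; the last clause
    records that a locked rotation therefore leaves them unchanged. *)
Definition admissible (pre : Omega R -> R) (bs : seq blk) :=
  [/\ bm pre, forall th, 0 <= pre th, forall u, u \in L -> periodic_at pre u &
    forall psi, (forall v, v \notin L -> psi v = 0) ->
      (forall b, b \in bs -> locked_on b psi) -> forall th, pre (rotate psi th) = pre th].

Definition rest (l : seq site) (th : Omega R) :=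
  \prod_(u <- l) (1 + kb u th) * \prod_(p <- pairs l) (1 + k p.1 p.2 th).

Definition weight (b : blk) := kappa ^+ size (bsites b) * bext b `^ q.
Definition finished (be : site -> R) (bs : seq blk) := \prod_(b <- bs) (1 + be (broot b) * weight b).
(** An unexplored site is charged in advance as a future block: [t] is [kappa] for the site itself
    times e for the growth expected when its edges are examined. *)
Definition unexplored (be : site -> R) (V : seq site) := \prod_(u <- V) (1 + be u * t).

(* The supermartingale of the exploration; [x] is the weight of the block
   under construction, of root [v]. *)
Definition pot (bs : seq blk) (v : site) (x : R) (V : seq site) : R :=
  finished be1 bs * (1 + be1 v * x) * unexplored be1 V - 1 +
  G0 * (finished be2 bs * (1 + be2 v * x) * unexplored be2 V).

(** [finished be1 bs - 1] dominates the sum of [be1 * weight] over the blocks, a Markov bound for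
    the presence of a long block; the [be2] term pays for locking a rotation on short ones. *)
Hypothesis leaf : forall bs pre, bs != [::] -> (forall b, b \in bs -> valid b) ->
  perm_eq (flatten (map bsites bs)) L -> admissible pre bs ->
  N pre <= (finished be1 bs - 1 + G0 * finished be2 bs) * D pre.

Let kappa0 : 0 < kappa. Proof. exact: lt_le_trans ltr01 kappa_ge1. Qed.
Let t0 : 0 < t. Proof. by rewrite tE mulr_gt0 ?expR_gt0. Qed.
Let eps0 : 0 < eps. Proof. by rewrite epsE invr_gt0 !mulr_gt0. Qed.

Let weight_ge0 b : 0 <= weight b.
Proof. by rewrite mulr_ge0 ?powR_ge0// exprn_ge0// ltW. Qed.

Let finished_ge0 be bs : (forall u, 0 <= be u) -> 0 <= finished be bs.
Proof. by move=> be0; apply: prodr_ge0 => b _; rewrite addr_ge0// mulr_ge0. Qed.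

Let unexplored_ge1 be V : (forall u, 0 <= be u) -> 1 <= unexplored be V.
Proof.
move=> be0; rewrite /unexplored; elim: V => [|v V IH]; first by rewrite big_nil.
by rewrite big_cons mulr_ege1// lerDl mulr_ge0// ltW.
Qed.

Lemma unexplored_perm be V V' : perm_eq V V' -> unexplored be V = unexplored be V'.
Proof. by move=> p; apply: perm_big. Qed.

Lemma rest_perm l l' : perm_eq l l' -> rest l = rest l'.
Proof.
move=> p; apply/funext => th; rewrite /rest (perm_big _ p); congr (_ * _).
by apply: (@big_pairs_perm _ _ _ _ (fun u v => 1 + k u v th)) => // u v; rewrite k_sym.
Qed.

Lemma rest_cons s l th : rest (s :: l) th =
  (1 + kb s th) * \prod_(w <- l) (1 + k s w th) * rest l th.
Proof.
rewrite /rest big_cons (big_pairs_cons _ (fun u v => 1 + k u v th))/=.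
by rewrite -!mulrA; congr (_ * _); rewrite mulrCA.
Qed.

Let bm_1k u v : bm (fun th => 1 + k u v th).
Proof. by apply: bmD => //; exact: bm_cst. Qed.

Let bm_row s W : bm (fun th => \prod_(w <- W) (1 + k s w th)).
Proof. exact: bm_prod. Qed.

Let row_ge0 s W th : 0 <= \prod_(w <- W) (1 + k s w th).
Proof. by apply: prodr_ge0 => w _; rewrite addr_ge0. Qed.

Let bm_rest l : {subset l <= L} -> bm (rest l).
Proof.
move=> lL; apply: bmM; last exact: bm_prod.
have : bm (fun th => \prod_(u <- l | u \in L) (1 + kb u th)).
  by apply: bm_prod => u /bm_kb bu; apply: bmD => //; exact: bm_cst.
apply: eq_bm => th; rewrite [RHS]big_seq [LHS]big_seq_cond.
by apply: eq_bigl => u; case: (boolP (u \in l)) => //= /lL ->.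
Qed.

Let rest_ge0 l th : {subset l <= L} -> 0 <= rest l th.
Proof.
move=> lL; apply: mulr_ge0; last by apply: prodr_ge0 => p _; rewrite addr_ge0.
by rewrite big_seq; apply: prodr_ge0 => u /lL uin; rewrite addr_ge0// kb_ge0.
Qed.

Let pot_le_mono bs v x x' V : 0 <= x -> x <= x' -> pot bs v x V <= pot bs v x' V.
Proof.
move=> x0 xx'; rewrite /pot lerD ?lerD2r// ?ler_wpM2l// ler_wpM2r ?(le_trans ler01) ?unexplored_ge1//.
all: by rewrite ler_wpM2l ?finished_ge0// lerD2l ler_wpM2l.
Qed.

(* One edge of weight [kv] is opened with probability at most [y]; when open
   it multiplies the weight of the block by [lam]. *)
Let pot_step bs v x lam y kv V V1 V2 : 0 <= x -> 0 <= lam -> 0 <= kv ->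
  kv <= y * (1 + kv) ->
  (forall be, (forall u, 0 <= be u) -> unexplored be V1 <= unexplored be V) ->
  (forall be, (forall u, 0 <= be u) -> unexplored be V2 <= unexplored be V) ->
  pot bs v x V1 + kv * pot bs v (x * lam) V2 <= pot bs v (x * expR (y * lam)) V * (1 + kv).
Proof.
move=> x0 lam0 k0 ky hV1 hV2.
have main be : (forall u, 0 <= be u) ->
    finished be bs * (1 + be v * x) * unexplored be V1 +
    kv * (finished be bs * (1 + be v * (x * lam)) * unexplored be V2) <=
    finished be bs * (1 + be v * (x * expR (y * lam))) * unexplored be V * (1 + kv).
  move=> be0; have f0 := finished_ge0 bs be0; have V0 := unexplored_ge1 V be0.
  have bx0 : 0 <= be v * x by exact: mulr_ge0.
  have bxl0 : 0 <= be v * (x * lam) by rewrite mulr_ge0// mulr_ge0.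
  have h1 : finished be bs * (1 + be v * x) * unexplored be V1 <=
      finished be bs * (1 + be v * x) * unexplored be V.
    by rewrite ler_wpM2l ?hV1// mulr_ge0// addr_ge0.
  have h2 : kv * (finished be bs * (1 + be v * (x * lam)) * unexplored be V2) <=
      kv * (finished be bs * (1 + be v * (x * lam)) * unexplored be V).
    by rewrite ler_wpM2l// ler_wpM2l ?hV2// mulr_ge0// addr_ge0.
  apply: (le_trans (lerD h1 h2)).
  have -> : finished be bs * (1 + be v * x) * unexplored be V +
     kv * (finished be bs * (1 + be v * (x * lam)) * unexplored be V) =
     (finished be bs * unexplored be V) * ((1 + kv) + be v * x * (1 + kv * lam)) by ring.
  have -> : finished be bs * (1 + be v * (x * expR (y * lam))) * unexplored be V * (1 + kv) =
     (finished be bs * unexplored be V) * ((1 + kv) + be v * x * (expR (y * lam) * (1 + kv))) by ring.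
  rewrite ler_wpM2l ?mulr_ge0 ?(le_trans ler01 V0)// lerD2l ler_wpM2l//.
  apply: (@le_trans _ _ ((1 + y * lam) * (1 + kv))); last first.
    by rewrite ler_wpM2r ?addr_ge0// expR_ge1Dx.
  have := ler_wpM2r lam0 ky; lra.
have m1 := main _ be1_ge0; have m2 := ler_wpM2l G00 (main _ be2_ge0).
rewrite /pot; lra.
Qed.

(** [P1] bounds the ratio of numerator to denominator when the edge is closed, [P2] when it is open.
    As [D] is additive and monotone, the two branches need only be compared pointwise. *)
Let split_step (F kv : Omega R -> R) (P P1 P2 : R) : bm F -> bm kv ->
  (forall th, 0 <= F th) ->
  N F <= P1 * D F -> N (fun th => F th * kv th) <= P2 * D (fun th => F th * kv th) ->
  (forall th, P1 + kv th * P2 <= P * (1 + kv th)) ->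
  N (fun th => F th * (1 + kv th)) <= P * D (fun th => F th * (1 + kv th)).
Proof.
move=> bF bk F0 h1 h2 hP; have bFk := bmM bF bk.
have -> : (fun th => F th * (1 + kv th)) = (fun th => F th + F th * kv th).
  by apply/funext => th; rewrite mulrDr mulr1.
apply: (le_trans (ND bF bFk)); apply: (le_trans (lerD h1 h2)).
rewrite -!DZ//; last exact: bmD.
rewrite -DD; [|exact: bmZ|exact: bmZ].
apply: le_D; [by apply: bmD; exact: bmZ|by apply: bmZ; exact: bmD|].
by move=> th; have := ler_wpM2l (F0 th) (hP th); lra.
Qed.

Let adm_mul pre g bs : admissible pre bs -> bm g -> (forall th, 0 <= g th) ->
  (forall u, u \in L -> periodic_at g u) ->
  (forall psi, (forall v, v \notin L -> psi v = 0) ->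
      (forall b, b \in bs -> locked_on b psi) -> forall th, g (rotate psi th) = g th) ->
  admissible (fun th => pre th * g th) bs.
Proof.
move=> [b1 p1 r1 i1] b2 p2 r2 i2; split.
- exact: bmM.
- by move=> th; rewrite mulr_ge0.
- by move=> u uL' th; rewrite (r1 u uL') (r2 u uL').
- by move=> psi h1 h2 th; rewrite i1// i2.
Qed.

Let adm_weaken pre bs bs' : admissible pre bs ->
  (forall psi, (forall b, b \in bs' -> locked_on b psi) -> forall b, b \in bs -> locked_on b psi) ->
  admissible pre bs'.
Proof. by move=> [b1 p1 r1 i1] h; split => // psi h1 h2; apply: i1 => //; exact: h. Qed.

(** [C] holds the sites of the current block whose edges have all been examined, [S] those
    discovered but not yet examined, [V] the sites in no block. The induction is on the number of
    sites still to be examined. *)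
Let state_ok (m : nat) := forall bs C S v tau ell V pre,
  (size S + size V)%N = m ->
  (forall b, b \in (C ++ S, v, tau, ell) :: bs -> valid b) ->
  perm_eq (flatten (map bsites ((C ++ S, v, tau, ell) :: bs)) ++ V) L ->
  admissible pre ((C ++ S, v, tau, ell) :: bs) ->
  N (fun th => pre th * rest (S ++ V) th) <=
  pot bs v (kappa ^+ size C * ell `^ q * t ^+ size S) V * D (fun th => pre th * rest (S ++ V) th).

Let lam s w : R := (1 + (dist s w)%:R) `^ q.

(** [W] lists the sites whose edge to s is undecided, [rej] those found closed. The exponential is
    the budget for the undecided edges, of which each spends [exp (eps J lam t)]. *)
Let explore_row m : state_ok m -> forall W bs C s S rej v tau ell pre,
  (size S + (size rej + size W))%N = m -> s \in C ->
  (forall b, b \in (C ++ S, v, tau, ell) :: bs -> valid b) ->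
  perm_eq (flatten (map bsites ((C ++ S, v, tau, ell) :: bs)) ++ (rej ++ W)) L ->
  admissible pre ((C ++ S, v, tau, ell) :: bs) ->
  N (fun th => pre th * rest (S ++ (rej ++ W)) th * \prod_(w <- W) (1 + k s w th)) <=
  pot bs v (kappa ^+ size C * ell `^ q * expR (eps * t * \sum_(w <- W) J (sub_site s w) * lam s w) *
    t ^+ size S) (rej ++ W) *
  D (fun th => pre th * rest (S ++ (rej ++ W)) th * \prod_(w <- W) (1 + k s w th)).
Proof.
move=> IH; elim=> [|w W IHW] bs C s S rej v tau ell pre.
  rewrite addn0 !cats0 => sz sC val per adm; rewrite big_nil mulr0 expR0 mulr1.
  have -> : (fun th => pre th * rest (S ++ rej) th * \prod_(w <- [::]) (1 + k s w th)) =
     (fun th => pre th * rest (S ++ rej) th).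
    by apply/funext => th; rewrite big_nil mulr1.
  exact: (IH _ _ _ _ _ _ _ _ sz val per adm).
move=> sz sC val per adm.
have [bpre pre0 _ _] := adm.
set b0 := (C ++ S, v, tau, ell) in val per adm *.
have vb0 : valid b0 by apply: val; rewrite mem_head.
have [/= rC dC tC] := vb0.
have sb0 : s \in C ++ S by rewrite mem_cat sC.
have ell1 : 1 <= ell by have := dC v rC; rewrite dist_refl addr0.
have subL : {subset S ++ (rej ++ w :: W) <= L}.
  move=> u uin; rewrite -(perm_mem per) /= !mem_cat; move: uin; rewrite !mem_cat.
  by move=> /orP[->|->]; rewrite ?orbT.
pose F th := pre th * rest (S ++ (rej ++ w :: W)) th * \prod_(w <- W) (1 + k s w th).
have bF : bm F by apply: bmM => //; apply: bmM => //; exact: bm_rest.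
have F0 th : 0 <= F th by rewrite mulr_ge0// mulr_ge0// rest_ge0.
have -> : (fun th => pre th * rest (S ++ (rej ++ w :: W)) th *
    \prod_(w0 <- w :: W) (1 + k s w0 th)) = (fun th => F th * (1 + k s w th)).
  by apply/funext => th; rewrite big_cons /F; ring.
set x := kappa ^+ size C * ell `^ q * expR (eps * t * \sum_(w <- W) J (sub_site s w) * lam s w) * t ^+ size S.
have x0 : 0 <= x by rewrite !mulr_ge0 ?powR_ge0 ?expR_ge0 ?exprn_ge0 ?ltW.
have -> : kappa ^+ size C * ell `^ q * expR (eps * t * \sum_(w0 <- w :: W) J (sub_site s w0) * lam s w0) * t ^+ size S =
   x * expR (eps * J (sub_site s w) * (lam s w * t)).
  rewrite big_cons mulrDr expRD /x.
  have -> : eps * t * (J (sub_site s w) * lam s w) = eps * J (sub_site s w) * (lam s w * t) by ring.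
  by ring.
have permrej : perm_eq (rej ++ w :: W) (w :: rej ++ W).
  by rewrite -cat1s perm_catCA.
(* If the edge is closed, w joins [rej]. If it is open, w becomes active, the extent grows by the
   factor 1 + length, and the edge factor moves into [pre]. *)
apply: (split_step (P1 := pot bs v x (w :: rej ++ W))
  (P2 := pot bs v (x * (lam s w * t)) (rej ++ W))) => //.
- have := IHW bs C s S (w :: rej) v tau ell pre.
  have -> : F = (fun th => pre th * rest (S ++ (w :: rej) ++ W) th * \prod_(w0 <- W) (1 + k s w0 th)).
    apply/funext => th; rewrite /F; congr (_ * _ * _).
    by rewrite (rest_perm (l' := S ++ (w :: rej) ++ W))// perm_cat2l.
  apply; [by rewrite -sz /= addSnnS|exact: sC|exact: val| |exact: adm].
  by apply: perm_trans per; rewrite perm_cat2l perm_sym.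
- pose ell' := ell * (1 + (dist s w)%:R).
  pose b1 : blk := (C ++ (w :: S), v, tau, ell').
  have eell' : ell <= ell' by rewrite ler_peMr ?(le_trans ler01 ell1)// lerDl.
  have mem1 u : u \in C ++ (w :: S) = (u == w) || (u \in C ++ S).
    by rewrite !mem_cat inE; case: (u == w); rewrite ?orbT.
  have vb1 : valid b1.
    split => /=; first by rewrite mem1 rC orbT.
    - move=> u; rewrite mem1 => /orP[/eqP ->|/dC du]; last exact: le_trans eell'.
      have := dC s sb0; have := dist_triangle s w v.
      rewrite -(ler_nat R) natrD (dist_sym w s) => h1 h2.
      rewrite /ell'; have := ler0n R (dist s w).
      have := ler_wpM2r (ler0n R (dist s w)) ell1; lra.
    - by move=> /tC h; exact: le_trans eell'.
  have lock1 psi : (forall b, b \in b1 :: bs -> locked_on b psi) ->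
     (forall b, b \in b0 :: bs -> locked_on b psi).
    move=> h b; rewrite inE => /orP[/eqP ->|bbs]; last by apply: h; rewrite inE bbs orbT.
    have [h1 h2] := h b1 (mem_head _ _); split => //= u ub.
    by apply: h1; rewrite /= mem1 ub orbT.
  have := IHW bs C s (w :: S) rej v tau ell' (fun th => pre th * k s w th).
  have -> : (fun th => F th * k s w th) = (fun th => pre th * k s w th *
     rest ((w :: S) ++ rej ++ W) th * \prod_(w0 <- W) (1 + k s w0 th)).
    apply/funext => th; rewrite /F (rest_perm (l' := (w :: S) ++ rej ++ W)); first by ring.
    by rewrite cat_cons (perm_trans (perm_cat (perm_refl S) permrej))// -cat1s perm_catCA.
  have -> : kappa ^+ size C * ell' `^ q * expR (eps * t * \sum_(w0 <- W) J (sub_site s w0) * lam s w0) *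
     t ^+ size (w :: S) = x * (lam s w * t).
    rewrite /ell' powRM ?addr_ge0 ?(le_trans ler01 ell1)// /x /lam exprS; ring.
  apply; first by rewrite -sz /= !addnS addSn.
  + exact: sC.
  + by move=> b; rewrite inE => /orP[/eqP ->|bbs]; [exact: vb1|apply: val; rewrite inE bbs orbT].
  + apply: perm_trans per; rewrite /= -!catA perm_cat2l.
    rewrite -[w :: S]cat1s -[w :: W]cat1s -!catA.
    by rewrite perm_catCA perm_cat2l perm_catCA perm_cat2l perm_catCA.
  + apply: adm_mul => //.
    * exact: adm_weaken lock1.
    * move=> psi _ h th; apply: k_rotate.
      have [h1 _] := h b1 (mem_head _ _).
      by rewrite (h1 s) ?(h1 w)//= mem1 ?eqxx// sb0 orbT.
- move=> th; apply: pot_step => //.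
  + by rewrite mulr_ge0 ?powR_ge0 ?ltW.
  + by move=> be be0; rewrite (unexplored_perm be permrej).
  (* The factor of w in [unexplored], at least 1, is given up once w belongs to the block. *)
  + move=> be be0; rewrite (unexplored_perm be permrej) /unexplored big_cons ler_peMl//.
      by rewrite (le_trans ler01)// unexplored_ge1.
    by rewrite lerDl mulr_ge0// ltW.
Qed.

Let sum_row_le s W : uniq W -> s \notin W -> \sum_(w <- W) J (sub_site s w) * lam s w <= Q.
Proof.
move=> uW sW; apply: le_trans (HQ s uW); rewrite le_eqVlt; apply/orP; left; apply/eqP.
rewrite big_seq_cond [RHS]big_seq_cond; apply: eq_bigl => w; rewrite andbT.
by case: (boolP (w \in W)) => //= wW; apply/esym; apply: contraNneq sW => <-.
Qed.

(** The site s passes from [S] to [C], and its charge drops from [t] to [kappa]; the factor e so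
    released covers its edges to [V] and its edge to the outside. *)
Let explore_active m : state_ok m -> forall bs C s S v tau ell V pre,
  (size S + size V)%N = m ->
  (forall b, b \in (C ++ s :: S, v, tau, ell) :: bs -> valid b) ->
  perm_eq (flatten (map bsites ((C ++ s :: S, v, tau, ell) :: bs)) ++ V) L ->
  admissible pre ((C ++ s :: S, v, tau, ell) :: bs) ->
  N (fun th => pre th * rest (s :: S ++ V) th) <=
  pot bs v (kappa ^+ size C * ell `^ q * t ^+ (size S).+1) V * D (fun th => pre th * rest (s :: S ++ V) th).
Proof.
move=> IH bs C s S v tau ell V pre sz val per adm.
set b0 := (C ++ s :: S, v, tau, ell) in val per adm *.
have [bpre pre0 _ _] := adm.
have vb0 : valid b0 by apply: val; rewrite mem_head.
have [/= rC dC tC] := vb0.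
have sb0 : s \in C ++ s :: S by rewrite mem_cat mem_head orbT.
have ell1 : 1 <= ell by have := dC v rC; rewrite dist_refl addr0.
have subL : {subset s :: S ++ V <= L}.
  move=> u; rewrite -(perm_mem per) /= inE !mem_cat inE => /or3P[->|->|->]; by rewrite ?orbT.
have sL : s \in L by apply: subL; rewrite mem_head.
have usV : uniq (s :: S ++ V).
  have := perm_uniq per; rewrite uL /= => u1.
  have : subseq (s :: S ++ V) ((C ++ s :: S) ++ flatten (map bsites bs) ++ V).
    by rewrite -catA (cat_subseq (sub0seq C))// -cat_cons cat_subseq// suffix_subseq.
  by move=> /subseq_uniq; apply; rewrite catA u1.
(* The edges from s to the other active sites stay unexpanded: both ends lie in the same block, so a
   locked rotation preserves their factors and they may enter [pre] whole. *)
pose row := fun th => \prod_(w <- S) (1 + k s w th).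
pose F th := pre th * row th * rest (S ++ ([::] ++ V)) th * \prod_(w <- V) (1 + k s w th).
have bF : bm F.
  by apply: bmM => //; apply: bmM; [by apply: bmM => //; exact: bm_row|apply: bm_rest => u uV; apply: subL; rewrite inE uV orbT].
have F0 th : 0 <= F th.
  apply: mulr_ge0; last exact: row_ge0.
  apply: mulr_ge0; first by apply: mulr_ge0; [exact: pre0|exact: row_ge0].
  by apply: rest_ge0 => u uV; apply: subL; rewrite inE uV orbT.
have -> : (fun th => pre th * rest (s :: S ++ V) th) = (fun th => F th * (1 + kb s th)).
  by apply/funext => th; rewrite rest_cons big_cat/= /F /row; ring.
pose y := expR (eps * t * \sum_(w <- V) J (sub_site s w) * lam s w).
pose x := kappa ^+ (size C).+1 * ell `^ q * y * t ^+ size S.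
have x0 : 0 <= x by rewrite !mulr_ge0 ?powR_ge0 ?expR_ge0 ?exprn_ge0 ?ltW.
pose lb : R := (1 + (n - nrm s)%N%:R) `^ q.
have lb0 : 0 <= lb by exact: powR_ge0.
have jbQ : lb * jb s <= Q.
  apply: (jb_moment J0 q0 HQ sL lb0) => w wL; rewrite ge0_ler_powR ?nnegrE ?addr_ge0//.
  by rewrite lerD2l ler_nat Lout.
(* The edges to [V] cost at most [exp (eps t Q) = e^(1/2)] and the outer edge at most
   [exp (eps Q) <= e^(1/2)]; this is the origin of [eps = (2 t Q)^-1]. *)
have xle : x * expR (eps * jb s * lb) <= kappa ^+ size C * ell `^ q * t ^+ (size S).+1.
  have sV := sum_row_le (W := V) (s := s).
  have {}sV : \sum_(w <- V) J (sub_site s w) * lam s w <= Q.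
    apply: sV; first by move: usV => /= /andP[_]; rewrite cat_uniq => /and3P[].
    by move: usV => /= /andP[]; rewrite mem_cat negb_or => /andP[].
  have -> : x * expR (eps * jb s * lb) = kappa ^+ size C * ell `^ q * t ^+ size S *
     (kappa * (y * expR (eps * jb s * lb))) by rewrite /x exprS; ring.
  have -> : kappa ^+ size C * ell `^ q * t ^+ (size S).+1 =
     kappa ^+ size C * ell `^ q * t ^+ size S * t by rewrite exprS; ring.
  have z0 : 0 <= kappa ^+ size C * ell `^ q * t ^+ size S.
    apply: mulr_ge0; last by rewrite exprn_ge0 ?ltW.
    by apply: mulr_ge0; [rewrite exprn_ge0 ?ltW|exact: powR_ge0].
  apply: (ler_wpM2l z0).
  rewrite [leRHS]tE ler_pM2l// /y -expRD ler_expR.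
  have t1 : 1 <= t.
    by rewrite tE mulr_ege1//; have := expR_ge1Dx (1 : R); lra.
  have h1 : eps * t * \sum_(w <- V) J (sub_site s w) * lam s w <= eps * t * Q.
    by rewrite ler_wpM2l// mulr_ge0// ltW.
  have h2 : eps * jb s * lb <= eps * t * Q.
    rewrite -!mulrA ler_wpM2l ?(ltW eps0)// (le_trans (_ : _ <= Q))//; first by rewrite mulrC.
    by rewrite ler_peMl// ltW.
  have h3 : eps * t * Q = 2^-1.
    by rewrite epsE; field; rewrite !gt_eqF.
  lra.
have permC u : (u \in (s :: C) ++ S) = (u \in C ++ s :: S).
  by rewrite !mem_cat !inE -orbA orbCA.
have step tau1 ell1' : valid ((s :: C) ++ S, v, tau1, ell1') ->
   forall pre', admissible pre' (((s :: C) ++ S, v, tau1, ell1') :: bs) ->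
   N (fun th => pre' th * rest (S ++ ([::] ++ V)) th * \prod_(w <- V) (1 + k s w th)) <=
   pot bs v (kappa ^+ (size C).+1 * ell1' `^ q * y * t ^+ size S) V *
   D (fun th => pre' th * rest (S ++ ([::] ++ V)) th * \prod_(w <- V) (1 + k s w th)).
  move=> vb1 pre' adm'.
  apply: (explore_row IH (C := s :: C) (rej := [::]) (tau := tau1)) => //=; first by rewrite mem_head.
  - by move=> b; rewrite inE => /orP[/eqP -> //|bbs]; apply: val; rewrite inE bbs orbT.
  - apply: perm_trans per; rewrite /= -!catA.
    exact: (permEl (perm_catCA [:: s] C (S ++ flatten [seq bsites i | i <- bs] ++ V))).
have adm1 (tau' : bool) (ell' : R) : (tau -> tau') ->
   admissible (fun th => pre th * row th) (((s :: C) ++ S, v, tau', ell') :: bs).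
  move=> tt'; apply: adm_mul.
  - apply: (adm_weaken adm) => psi h b; rewrite inE => /orP[/eqP ->|bbs]; last first.
      by apply: h; rewrite inE bbs orbT.
    have [/= h1 h2] := h _ (mem_head _ _); split => /= [u ub|/tt' //].
    by apply: h1; rewrite -cat_cons permC.
  - exact: bm_row.
  - exact: row_ge0.
  - by move=> u _ th; apply: eq_bigr => w _; rewrite k_periodic.
  - move=> psi _ h th; apply: eq_big_seq => w wS; rewrite k_rotate//.
    have [/= h1 _] := h _ (mem_head _ _).
    by rewrite (h1 s) ?(h1 w)// !inE ?mem_cat ?wS ?eqxx ?orbT.
have valid1 (tau' : bool) (ell' : R) : ell <= ell' -> (tau' -> 1 + (n - nrm v)%N%:R <= ell') ->
   valid ((s :: C) ++ S, v, tau', ell').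
  move=> ll' ht; split => //=; first by rewrite -cat_cons permC.
  by move=> u; rewrite -cat_cons permC => /dC h; exact: le_trans ll'.
apply: (@le_trans _ _ (pot bs v (x * expR (eps * jb s * lb)) V * D (fun th => F th * (1 + kb s th)))); last first.
  rewrite ler_wpM2r//; last by apply: pot_le_mono => //; rewrite mulr_ge0 ?expR_ge0.
  rewrite -(mul0r (D (fun=> 1))) -DZ; last exact: bm_cst.
  apply: le_D; [by apply: bmZ; exact: bm_cst|apply: bmM => //; apply: bmD; [exact: bm_cst|exact: bm_kb]|].
  by move=> th; rewrite mul0r mulr_ge0// addr_ge0// kb_ge0.
apply: (split_step (P1 := pot bs v x V) (P2 := pot bs v (x * lb) V)) => //.
- exact: bm_kb.
- by apply: (step tau ell); [exact: valid1|exact: adm1].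
- pose ell' := ell * (1 + (n - nrm s)%N%:R).
  have eell' : ell <= ell' by rewrite ler_peMr ?(le_trans ler01 ell1)// lerDl.
  have := step true ell' _ (fun th => pre th * row th * kb s th) _.
  have -> : (fun th => pre th * row th * kb s th * rest (S ++ [::] ++ V) th * \prod_(w <- V) (1 + k s w th)) =
     (fun th => F th * kb s th) by apply/funext => th; rewrite /F; ring.
  have -> : kappa ^+ (size C).+1 * ell' `^ q * y * t ^+ size S = x * lb.
    rewrite /ell' powRM ?addr_ge0 ?(le_trans ler01 ell1)// /x /lb; ring.
  apply.
  + apply: valid1 => // _; have := dC s sb0; rewrite /ell' => h1.
    have h3 : (n - nrm v)%N%:R <= (n - nrm s)%N%:R + (dist s v)%:R :> R.
      by rewrite -natrD ler_nat; move: (nrm_dist s v); clear; lia.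
    have := ler_wpM2r (ler0n R (n - nrm s)) ell1; lra.
  + apply: adm_mul; first exact: adm1.
    * exact: bm_kb.
    * by move=> th; exact: kb_ge0.
    * by move=> u _; exact: kb_periodic.
    * move=> psi p0 h th; apply: kb_rotate => //.
      have [/= h1 h2] := h _ (mem_head _ _).
      by rewrite (h1 s) ?h2// inE eqxx.
- by move=> th; apply: pot_step => //; [exact: kb_ge0|exact: kb_le].
Qed.

Lemma explore m : state_ok m.
Proof.
elim: m => [|m IH] bs C S v tau ell V pre.
  move=> /eqP; rewrite addn_eq0 !size_eq0 => /andP[/eqP -> /eqP ->].
  rewrite !cats0 expr0 mulr1 => val per adm.
  have -> : (fun th => pre th * rest [::] th) = pre.
    by apply/funext => th; rewrite /rest !big_nil !mulr1.
  apply: (le_trans (leaf (bs := (C, v, tau, ell) :: bs) _ val per adm)) => //.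
  by rewrite /pot /finished !big_cons /unexplored !big_nil !mulr1 /weight/= mulrC ![(1 + _) * \prod_(_ <- _) _]mulrC mulrC.
case: S => [|s S] /=; last first.
  by rewrite addSn => -[sz] val per adm; exact: (explore_active IH sz val per adm).
(* No active site is left: the block is finished and u opens a new one of extent 1. The potential is
   unchanged, since u only moves from [unexplored] to a block of weight [t]. *)
case: V => [//|u V] [sz] val per adm.
rewrite cats0 expr0 mulr1 in val per adm *.
have := explore_active IH (bs := (C, v, tau, ell) :: bs) (C := [::]) (s := u) (S := [::]) (v := u)
  (tau := false) (ell := 1) (V := V) (pre := pre).
rewrite /= => /(_ sz) h.
apply: (le_trans (h _ _ _)).
- move=> b; rewrite inE => /orP[/eqP ->|]; last exact: val.
  by split => //= [|w]; rewrite inE// => /eqP ->; rewrite dist_refl addr0.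
- by rewrite (perm_trans _ per)//= -cat1s perm_catCA catA.
- by apply: (adm_weaken adm) => psi hb b bb; apply: hb; rewrite inE bb orbT.
rewrite /pot /finished !big_cons /unexplored !big_cons powR1 !expr0 !expr1 !mul1r /weight/=.
by rewrite le_eqVlt; apply/orP; left; apply/eqP; ring.
Qed.

Lemma exploration_bound (v : site) (V : seq site) : L = v :: V ->
  N (rest L) <= (unexplored be1 L - 1 + G0 * unexplored be2 L) * D (rest L).
Proof.
move=> LE; have := @explore (size V).+1 [::] [::] [:: v] v false 1 V (fun=> 1) erefl.
rewrite /= -LE.
have -> : (fun th => 1 * rest L th) = rest L by apply/funext => th; rewrite mul1r.
move=> h; apply: (le_trans (h _ _ _)).
- move=> b; rewrite inE => /eqP ->.
  by split => //= [|w]; rewrite inE// => /eqP ->; rewrite dist_refl addr0.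
- by [].
- by split => //; exact: bm_cst.
rewrite /pot /finished !big_nil expr0 powR1 !mul1r expr1 LE /unexplored !big_cons.
by rewrite le_eqVlt; apply/orP; left; apply/eqP; ring.
Qed.

End Exploration.

(** * Rotations locked on the blocks *)

Section Profile.
Context {R : realType}.

Lemma lnB_le (x y : R) : 0 < x -> x <= y -> ln y - ln x <= (y - x) / x.
Proof.
move=> x0 xy; have y0 : 0 < y := lt_le_trans x0 xy.
rewrite -ln_div ?posrE//.
have -> : y / x = 1 + (y - x) / x by field; rewrite gt_eqF.
by apply: le_ln1Dx; rewrite (lt_le_trans (ltrN10 R))// divr_ge0 ?subr_ge0// ltW.
Qed.

Lemma normr_lnB_le (x y d rho : R) : 0 < x -> 0 < y -> `|x - y| <= d ->
  x^-1 <= rho -> y^-1 <= rho -> `|ln x - ln y| <= d * rho.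
Proof.
wlog xy : x y / x <= y.
  move=> W x0 y0; have [xy|/ltW yx] := leP x y; first exact: W.
  by move=> h1 h2 h3; rewrite distrC; apply: W => //; rewrite distrC.
move=> x0 y0 dxy xr yr; rewrite distrC ger0_norm ?subr_ge0 ?ler_ln ?posrE//.
apply: (le_trans (lnB_le x0 xy)).
have yx : 0 <= y - x by rewrite subr_ge0.
by apply: ler_pM => //; [rewrite invr_ge0 ltW|rewrite (le_trans _ dxy)// distrC ler_norm].
Qed.

(** Meant for long edges: it makes the exponential part of the rotation cost a power
    [(1 + d)^(M dl)] instead of an exponential of d. *)
Lemma normr_lnB_le_ln (x y d : R) : 1 <= x -> 1 <= y -> `|x - y| <= d ->
  `|ln x - ln y| <= ln (1 + d).
Proof.
wlog xy : x y / x <= y.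
  move=> W x0 y0; have [xy|/ltW yx] := leP x y; first exact: W.
  by move=> h1; rewrite distrC; apply: W => //; rewrite distrC.
move=> x1 y1 dxy; have x0 : 0 < x := lt_le_trans ltr01 x1.
have y0 : 0 < y := lt_le_trans ltr01 y1.
have d0 : 0 <= d := le_trans (normr_ge0 _) dxy.
rewrite distrC ger0_norm ?subr_ge0 ?ler_ln ?posrE//.
rewrite -ln_div ?posrE// ler_ln ?posrE ?divr_gt0//; last by rewrite ltr_pwDl.
rewrite ler_pdivrMr//; have := ler_peMr d0 x1.
have : y - x <= d by rewrite (le_trans _ dxy)// distrC ler_norm.
lra.
Qed.

End Profile.

Section Leaf.
Context {R : realType}.
Variables (J : site -> R) (q Q : R) (m : nat).
Hypothesis J0 : forall x, 0 <= J x.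
Hypothesis Jsym : forall u v, J (sub_site u v) = J (sub_site v u).
Hypothesis q2 : 2 < q.
Hypothesis Q0 : 0 < Q.
Hypothesis HQ : forall (u : site) (l : seq site), uniq l ->
    \sum_(v <- l | v != u) J (sub_site u v) * (1 + (dist u v)%:R) `^ q <= Q.
Hypothesis m0 : (0 < m)%N.
Let n := (m ^ 2)%N.
Let L := box n.-1.
Let n0 : (0 < n)%N. Proof. by rewrite expn_gt0 m0. Qed.
Let nR0 : 0 < n%:R :> R. Proof. by rewrite ltr0n. Qed.
Let q0 : 0 <= q. Proof. by rewrite (le_trans _ (ltW q2)). Qed.
Let uL : uniq L. Proof. exact: uniq_box. Qed.
Variables (M : nat) (c : nat -> R) (h : R -> R).
(** In [block_cost] a block of k sites pays [k <= e^k] for the number of its sites and another [e^k]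
    for an exponential of its rotation cost, hence e^2 per site. *)
Let kappa : R := expR 2.
Let t : R := kappa * expR 1.
Let eps : R := (2 * t * Q)^-1.
Hypothesis ch : continuous h.
Hypothesis hper : forall t, h (t + 2 * pi) = h t.
Hypothesis heven : forall t, h (- t) = h t.
Hypothesis h0eps : forall t, 0 <= h t <= eps.
Let cM := \sum_(k <- iota 0 M) `|c k|.
Let K1 : R := 4 * M%:R ^+ 2 * expR 2.
Let K2 : R := 4 * cM * K1 * Q.
Variable dl : R.
Hypothesis dl0 : 0 < dl.
Hypothesis Mdl1 : M%:R * dl <= 1.
Hypothesis Mdlq : M%:R * dl <= q - 2.
Hypothesis K2dl : K2 * dl ^+ 2 <= 1.

Definition rcut (u : site) : R := (maxn m (nrm u))%:R.
Let prof (u : site) : R := dl * (ln n%:R - ln (rcut u)).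

Lemma mem_L u : (u \in L) = (nrm u < n)%N.
Proof. by rewrite mem_box -ltnS prednK. Qed.

Let rad_ge1 u : 1 <= rcut u.
Proof. by rewrite /rcut ler1n leq_max m0. Qed.

Let rad_gt0 u : 0 < rcut u.
Proof. exact: lt_le_trans ltr01 (rad_ge1 u). Qed.

Let rad_le_n u : u \in L -> rcut u <= n%:R.
Proof.
rewrite mem_L => un; rewrite /rcut ler_nat geq_max (ltnW un) andbT.
by rewrite /n -mulnn leq_pmulr.
Qed.

Let rad_lip u v : `|rcut u - rcut v| <= (dist u v)%:R.
Proof.
rewrite /rcut ler_norml; have := nrm_dist u v; have := nrm_dist v u.
rewrite (dist_sym v u) => h1 h2; rewrite lerNl opprB !lerBlDl -!natrD !ler_nat.
by apply/andP; split; move: h1 h2; clear; lia.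
Qed.

Let out_dist u v : u \in L -> v \notin L -> (n - nrm u <= dist u v)%N.
Proof.
rewrite !mem_L -leqNgt => un nv; have := nrm_dist v u; rewrite (dist_sym v u).
by move: nv; clear; lia.
Qed.

Let ln_n_rad u : u \in L -> 0 <= ln n%:R - ln (rcut u).
Proof.
by move=> ul; rewrite subr_ge0 ler_ln ?posrE//; exact: rad_le_n.
Qed.

Let dist_n_rad u : u \in L -> `|n%:R - rcut u| <= (n - nrm u)%N%:R.
Proof.
move=> ul; rewrite ger0_norm ?subr_ge0 ?rad_le_n//.
move: ul; rewrite mem_L => un; rewrite natrB ?(ltnW un)// lerD2l lerN2.
by rewrite /rcut ler_nat leq_maxr.
Qed.

(* The cost of rotating an edge of length d whose ends turn by amounts that
   differ by the log-profile A plus an error o due to locking blocks. *)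
Let cost_le y d A o rho : 0 <= d -> 0 <= A -> 0 <= o -> o <= 2 * dl -> 0 <= rho ->
  A <= dl * (d * rho) -> A <= dl * ln (1 + d) -> `|y| <= A + o ->
  cost M y <= 2 * M%:R ^+ 2 * expR 2 * ((1 + d) `^ q * (dl ^+ 2 * rho ^+ 2 + o ^+ 2)).
Proof.
move=> d0 A0 o0 odl rho0 A1 A2 yAo; rewrite /cost.
have d1 : 0 < 1 + d by rewrite ltr_pwDl.
(* Of the exponent q, the part [q - 2 >= M dl] pays for the exponential in the cost and the part 2
   for the square. *)
have e1 : expR (M%:R * `|y|) <= expR 2 * (1 + d) `^ (q - 2).
  rewrite /powR gt_eqF// -expRD ler_expR.
  apply: (@le_trans _ _ (M%:R * (dl * ln (1 + d) + 2 * dl))).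
    by rewrite ler_wpM2l// (le_trans yAo)// lerD.
  have l0 : 0 <= ln (1 + d) by rewrite ln_ge0// lerDl.
  have := ler_wpM2r l0 Mdlq; have := Mdl1; lra.
have e2 : (M%:R * y) ^+ 2 <= 2 * M%:R ^+ 2 * ((1 + d) ^+ 2 * (dl ^+ 2 * rho ^+ 2 + o ^+ 2)).
  have -> : 2 * M%:R ^+ 2 * ((1 + d) ^+ 2 * (dl ^+ 2 * rho ^+ 2 + o ^+ 2)) =
     M%:R ^+ 2 * (2 * ((1 + d) ^+ 2 * (dl ^+ 2 * rho ^+ 2 + o ^+ 2))) by ring.
  rewrite exprMn; apply: ler_wpM2l; first exact: sqr_ge0.
  rewrite -(real_normK (num_real y)).
  apply: (@le_trans _ _ ((A + o) ^+ 2)); first by rewrite ler_pXn2r// nnegrE addr_ge0.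
  have h1 : A ^+ 2 <= (dl * (d * rho)) ^+ 2.
    by rewrite ler_pXn2r// nnegrE ?mulr_ge0// ltW.
  have h2 : d ^+ 2 <= (1 + d) ^+ 2 by rewrite ler_pXn2r// ?nnegrE ?(ltW d1)// lerDr.
  have h3 : 1 <= (1 + d) ^+ 2 by rewrite exprn_ege1// lerDl.
  have h4 := ler_wpM2r (mulr_ge0 (sqr_ge0 dl) (sqr_ge0 rho)) h2.
  have h5 := ler_wpM2r (sqr_ge0 o) h3.
  have h6 : 0 <= (A - o) ^+ 2 by exact: sqr_ge0.
  have h7 : (A + o) ^+ 2 <= 2 * (A ^+ 2 + o ^+ 2) by move: h6; lra.
  apply: (le_trans h7); rewrite ler_pM2l//.
  have h8 : (dl * (d * rho)) ^+ 2 = d ^+ 2 * (dl ^+ 2 * rho ^+ 2) by ring.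
  move: h1 h4 h5; rewrite h8 mul1r; lra.
apply: (le_trans (ler_pM (sqr_ge0 _) (expR_ge0 _) e2 e1)).
have -> : (1 + d) `^ q = (1 + d) ^+ 2 * (1 + d) `^ (q - 2).
  rewrite -powR_mulrn ?(ltW d1)// -powRD ?(gt_eqF d1) ?implybT//.
  by congr (_ `^ _); ring.
by rewrite le_eqVlt; apply/orP; left; apply/eqP; ring.
Qed.

Let K1_ge0 : 0 <= K1.
Proof. by rewrite mulr_ge0 ?expR_ge0// mulr_ge0// sqr_ge0. Qed.

Let K2_ge0 : 0 <= K2.
Proof.
apply: mulr_ge0; last exact: ltW.
by apply: mulr_ge0 => //; apply: mulr_ge0 => //; exact: sumr_ge0.
Qed.

(** * The locked rotation when all blocks are short *)

Section Blocks.
Variables (bs : seq (@blk R)).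
Hypothesis val : forall b, b \in bs -> valid (R := R) n b.
Hypothesis cover : perm_eq (flatten (map bsites bs)) L.
Hypothesis small : forall b, b \in bs -> bext b <= rcut (broot b) / 4.

Let bval (b : @blk R) : R := if btouch b then 0 else prof (broot b).
(** The blocks are disjoint, so at most one term is present; as a sum it is 0 off [L] without a case
    distinction. *)
Definition lockrot (u : site) : R := \sum_(b <- bs | u \in bsites b) bval b.
(** [2 * bext b] bounds the change of radius forced by locking, the 2 being needed for touching
    blocks, and 3 / 4 of the radius at the root bounds the radius on the block from below. *)
Let err (b : @blk R) : R := 8 / 3 * bext b / rcut (broot b).
Let errS (u : site) : R := \sum_(b <- bs | u \in bsites b) err b.

Let sum_block (g : @blk R -> R) b u : b \in bs -> u \in bsites b ->
  \sum_(b' <- bs | u \in bsites b') g b' = g b.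
Proof.
have := perm_uniq cover; rewrite uL; clear.
elim: bs => //= b0 s IH; rewrite cat_uniq => /and3P[_ /hasPn dis us].
rewrite inE => /orP[/eqP -> ub|bs' ub].
  rewrite big_cons ub big_seq_cond big1 ?addr0// => b' /andP[b's ub'].
  have /dis : u \in flatten (map bsites s).
    by apply/flattenP; exists (bsites b') => //; exact: map_f.
  by rewrite /= ub.
rewrite big_cons IH//; case: ifP => // ub0.
have /dis : u \in flatten (map bsites s) by apply/flattenP; exists (bsites b) => //; exact: map_f.
by rewrite /= ub0.
Qed.

Let block_of u : u \in L -> exists2 b, b \in bs & u \in bsites b.
Proof.
rewrite -(perm_mem cover) => /flattenP[B /mapP[b bbs ->] ub]; by exists b.
Qed.

Let in_L b u : b \in bs -> u \in bsites b -> u \in L.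
Proof.
move=> bbs ub; rewrite -(perm_mem cover); apply/flattenP.
by exists (bsites b) => //; exact: map_f.
Qed.

Let ext_ge1 b : b \in bs -> 1 <= bext b.
Proof. by move=> /val[rb db _]; have := db _ rb; rewrite dist_refl addr0. Qed.

Let err_ge0 b : b \in bs -> 0 <= err b.
Proof.
move=> bbs; rewrite divr_ge0 ?(ltW (rad_gt0 _))// mulr_ge0// (le_trans ler01)//.
exact: ext_ge1.
Qed.

Let err_le1 b : b \in bs -> err b <= 1.
Proof.
move=> bbs; rewrite ler_pdivrMr//; have := small bbs; have := rad_gt0 (broot b); lra.
Qed.

Let locked_err u : u \in L -> `|lockrot u - prof u| <= dl * errS u.
Proof.
move=> /[dup] ul /block_of[b bbs ub]; rewrite /lockrot /errS !(sum_block _ bbs ub).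
have [rb db tb] := val bbs; have b1 := ext_ge1 bbs; have bsm := small bbs.
have dub := db u ub; have := rad_lip u (broot b); rewrite ler_norml => /andP[l1 l2].
have rb0 := rad_gt0 (broot b); have ru0 := rad_gt0 u.
have ru : 3 / 4 * rcut (broot b) <= rcut u by lra.
have rho1 : (rcut u)^-1 <= (3 / 4 * rcut (broot b))^-1.
  by rewrite lef_pV2 ?posrE ?mulr_gt0.
have rho2 : (rcut (broot b))^-1 <= (3 / 4 * rcut (broot b))^-1.
  by rewrite lef_pV2 ?posrE ?mulr_gt0//; lra.
have errE : err b = 2 * bext b * (3 / 4 * rcut (broot b))^-1.
  by rewrite /err; field; rewrite gt_eqF.
rewrite /bval /prof; case: ifPn => [tt|_].
  rewrite sub0r normrN normrM (gtr0_norm dl0) ler_pM2l// errE.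
  have nn : (n%:R : R)^-1 <= (3 / 4 * rcut (broot b))^-1.
    by apply: le_trans rho1; rewrite lef_pV2 ?posrE// rad_le_n.
  apply: normr_lnB_le => //.
  have := tb tt; have := dist_n_rad (in_L bbs rb); rewrite ler_norml => /andP[_ h1] h2.
  rewrite ger0_norm ?subr_ge0 ?rad_le_n//; lra.
have -> : dl * (ln n%:R - ln (rcut (broot b))) - dl * (ln n%:R - ln (rcut u)) =
  dl * (ln (rcut u) - ln (rcut (broot b))) by ring.
rewrite normrM (gtr0_norm dl0) ler_pM2l// errE.
apply: normr_lnB_le => //; rewrite ler_norml; apply/andP; split; lra.
Qed.

Let errS_ge0 u : u \in L -> 0 <= errS u.
Proof. by move=> /block_of[b bbs ub]; rewrite /errS (sum_block _ bbs ub); exact: err_ge0. Qed.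

Let errS_le1 u : u \in L -> errS u <= 1.
Proof. by move=> /block_of[b bbs ub]; rewrite /errS (sum_block _ bbs ub); exact: err_le1. Qed.

Let sS (u : site) : R := rcut u ^- 2 + errS u ^+ 2.

Let cost_pair u v : u \in L -> v \in L ->
  cost M (lockrot u - lockrot v) <= K1 * dl ^+ 2 * ((1 + (dist u v)%:R) `^ q * (sS u + sS v)).
Proof.
move=> ul vl; have := locked_err ul; have := locked_err vl.
have eu0 := errS_ge0 ul; have ev0 := errS_ge0 vl.
have eu1 := errS_le1 ul; have ev1 := errS_le1 vl.
set ou := errS u in eu0 eu1 *; set ov := errS v in ev0 ev1 *.
move=> lv lu.
pose rho := Num.max (rcut u)^-1 (rcut v)^-1.
have rho0 : 0 <= rho by rewrite le_max invr_ge0 ltW.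
have pE : prof u - prof v = dl * (ln (rcut v) - ln (rcut u)) by rewrite /prof; ring.
have A1 : `|prof u - prof v| <= dl * ((dist u v)%:R * rho).
  rewrite pE normrM (gtr0_norm dl0) ler_pM2l// normr_lnB_le//.
  - by rewrite distrC; exact: rad_lip.
  - by rewrite le_max lexx orbT.
  - by rewrite le_max lexx.
have A2 : `|prof u - prof v| <= dl * ln (1 + (dist u v)%:R).
  rewrite pE normrM (gtr0_norm dl0) ler_pM2l// normr_lnB_le_ln//.
  by rewrite distrC; exact: rad_lip.
apply: (le_trans (@cost_le _ (dist u v)%:R `|prof u - prof v| (dl * ou + dl * ov) rho _ _ _ _ _ A1 A2 _)) => //.
- by rewrite addr_ge0// mulr_ge0// ltW.
- have := ler_wpM2l (ltW dl0) eu1; have := ler_wpM2l (ltW dl0) ev1; lra.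
- have -> : lockrot u - lockrot v = (prof u - prof v) + ((lockrot u - prof u) - (lockrot v - prof v)) by ring.
  by rewrite (le_trans (ler_normD _ _))// lerD2l (le_trans (ler_normB _ _))// lerD.
have rho2 : rho ^+ 2 <= rcut u ^- 2 + rcut v ^- 2.
  rewrite /rho -!exprVn; have hu := sqr_ge0 (rcut u)^-1; have hv := sqr_ge0 (rcut v)^-1.
  by rewrite maxEle; case: ifP => _; move: hu hv; lra.
have o2 : (dl * ou + dl * ov) ^+ 2 <= 2 * dl ^+ 2 * (ou ^+ 2 + ov ^+ 2).
  by have := sqr_ge0 (dl * ou - dl * ov); lra.
have d2 := ler_wpM2l (sqr_ge0 dl) rho2.
have rr0 : 0 <= dl ^+ 2 * (rcut u ^- 2 + rcut v ^- 2).
  by rewrite mulr_ge0 ?sqr_ge0// addr_ge0// invr_ge0 exprn_ge0// ltW.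
rewrite /K1.
have -> : 4 * M%:R ^+ 2 * expR 2 * dl ^+ 2 * ((1 + (dist u v)%:R) `^ q * (sS u + sS v)) =
  2 * M%:R ^+ 2 * expR 2 * ((1 + (dist u v)%:R) `^ q * (2 * dl ^+ 2 * (sS u + sS v))) by ring.
apply: ler_wpM2l; first by rewrite !mulr_ge0 ?expR_ge0 ?sqr_ge0.
apply: ler_wpM2l; first exact: powR_ge0.
by rewrite /sS -/ou -/ov; move: d2 o2 rr0; lra.
Qed.

Let cost_boundary u : u \in L ->
  cost M (lockrot u) <= K1 * dl ^+ 2 * ((1 + (n - nrm u)%N%:R) `^ q * sS u).
Proof.
move=> ul; have lu := locked_err ul; have eu0 := errS_ge0 ul; have eu1 := errS_le1 ul.
have p0 : 0 <= prof u by rewrite mulr_ge0 ?(ltW dl0)// ln_n_rad.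
have dn := dist_n_rad ul.
have n1 : 1 <= n%:R :> R by rewrite ler1n.
have A1 : prof u <= dl * ((n - nrm u)%N%:R * (rcut u)^-1).
  rewrite ler_pM2l// (le_trans (ler_norm _))// normr_lnB_le//.
  by rewrite lef_pV2 ?posrE// rad_le_n.
have A2 : prof u <= dl * ln (1 + (n - nrm u)%N%:R).
  by rewrite ler_pM2l// (le_trans (ler_norm _))// normr_lnB_le_ln.
apply: (le_trans (@cost_le _ (n - nrm u)%N%:R (prof u) (dl * errS u) (rcut u)^-1 _ _ _ _ _ A1 A2 _)) => //.
- by rewrite mulr_ge0// ltW.
- have := ler_wpM2l (ltW dl0) eu1; have := ltW dl0; lra.
- by rewrite invr_ge0 ltW.
- rewrite -(subrK (prof u) (lockrot u)) addrC (le_trans (ler_normD _ _))//.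
  by rewrite (ger0_norm p0) lerD2l.
rewrite /K1 /sS.
have z0 : 0 <= M%:R ^+ 2 * expR 2 * ((1 + (n - nrm u)%N%:R) `^ q * (dl ^+ 2 * (rcut u ^- 2 + errS u ^+ 2))).
  apply: mulr_ge0; first by apply: mulr_ge0; [exact: sqr_ge0|exact: expR_ge0].
  apply: mulr_ge0; first exact: powR_ge0.
  apply: mulr_ge0; first exact: sqr_ge0.
  by rewrite addr_ge0 ?sqr_ge0// invr_ge0 exprn_ge0// ltW.
rewrite exprVn; move: z0; lra.
Qed.

(** The power [(1 + d)^q] in the cost of an edge is absorbed by the moment [Q] of the couplings,
    which leaves a squared slope and a squared locking error per site. Outgoing and inner edges give
    one copy each, whence the 2. *)
Lemma total_cost_le :
  \sum_(u <- L) jb J L u * cost M (lockrot u) +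
  \sum_(p <- pairs L) J (sub_site p.1 p.2) * cost M (lockrot p.1 - lockrot p.2) <=
  2 * (K1 * dl ^+ 2 * Q * (\sum_(u <- L) rcut u ^- 2 + \sum_(u <- L) errS u ^+ 2)).
Proof.
have -> : \sum_(u <- L) rcut u ^- 2 + \sum_(u <- L) errS u ^+ 2 = \sum_(u <- L) sS u.
  by rewrite -big_split.
have K10 := mulr_ge0 K1_ge0 (sqr_ge0 dl).
have sS0 u : 0 <= sS u by rewrite addr_ge0 ?sqr_ge0// invr_ge0 exprn_ge0// ltW.
rewrite mulr2n mulrDl mul1r lerD//.
  rewrite mulr_sumr !big_seq; apply: ler_sum => u ul.
  apply: (le_trans (ler_wpM2l (jb_ge0 J0 q0 HQ ul) (cost_boundary ul))).
  have := jb_moment J0 q0 HQ (k := (1 + (n - nrm u)%N%:R) `^ q) ul (powR_ge0 _ _).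
  have hd v : v \notin L -> (1 + (n - nrm u)%N%:R) `^ q <= (1 + (dist u v)%:R) `^ q :> R.
    by move=> vl; rewrite ge0_ler_powR ?nnegrE ?addr_ge0// lerD2l ler_nat out_dist.
  move=> /(_ hd) jq.
  have := ler_wpM2r (sS0 u) (ler_wpM2l K10 jq).
  by set X := K1 * dl ^+ 2; set Y := (1 + _) `^ q; lra.
pose g u v := J (sub_site u v) * ((1 + (dist u v)%:R) `^ q * (sS u + sS v)).
apply: (@le_trans _ _ (K1 * dl ^+ 2 * \sum_(p <- pairs L) g p.1 p.2)).
  rewrite mulr_sumr !big_seq; apply: ler_sum => p /mem_pairs /andP[p1 p2].
  have := ler_wpM2l (J0 (sub_site p.1 p.2)) (cost_pair p1 p2).
  by rewrite /g; set X := K1 * dl ^+ 2; set Y := (1 + _) `^ q; lra.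
rewrite -[leRHS]mulrA; apply: ler_wpM2l => //.
have gsym u v : g u v = g v u by rewrite /g Jsym dist_sym [sS u + _]addrC.
have := sum_offdiag uL gsym; pose g1 u v := J (sub_site u v) * (1 + (dist u v)%:R) `^ q.
have -> : \sum_(u <- L) \sum_(v <- L | v != u) g u v =
  \sum_(u <- L) \sum_(v <- L | v != u) g1 u v * sS u + \sum_(u <- L) \sum_(v <- L | v != u) g1 u v * sS v.
  rewrite -big_split/=; apply: eq_bigr => u _; rewrite -big_split/=; apply: eq_bigr => v _.
  by rewrite /g /g1; ring.
have -> : \sum_(u <- L) \sum_(v <- L | v != u) g1 u v * sS v =
   \sum_(u <- L) \sum_(v <- L | v != u) g1 u v * sS u.
  rewrite (exchange_big_dep xpredT)//=; apply: eq_bigr => u _.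
  apply: eq_big => [v|v _]; first by rewrite eq_sym.
  by rewrite /g1 Jsym dist_sym.
have : \sum_(u <- L) \sum_(v <- L | v != u) g1 u v * sS u <= Q * \sum_(u <- L) sS u.
  rewrite mulr_sumr; apply: ler_sum => u _; rewrite -mulr_suml ler_wpM2r//.
  exact: HQ.
by set A := \sum_(u <- L) \sum_(v <- L | _) _; set B := \sum_(p <- pairs L) _; lra.
Qed.

(** The profile at 0 is [dl (ln (m ^ 2) - ln m) = dl ln m], of which locking takes away at most
    [dl]. *)
Lemma locked_origin : - lockrot site0 <= dl * (1 - ln m%:R).
Proof.
have s0 : site0 \in L by rewrite mem_L.
have := locked_err s0; rewrite ler_norml => /andP[h1 _].
have h2 := ler_wpM2l (ltW dl0) (errS_le1 s0).
have -> : ln m%:R = ln n%:R - ln (rcut site0) :> R.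
  rewrite /rcut /nrm/= maxn0 /n natrX lnXn ?ltr0n// mulr2n; ring.
move: h1 h2; rewrite /prof; lra.
Qed.

Lemma locked_out v : v \notin L -> lockrot v = 0.
Proof.
move=> vL; rewrite /lockrot big_seq_cond big1// => b /andP[bbs vb].
by move: vL; rewrite (in_L bbs vb).
Qed.

Lemma locked_locks b k : b \in bs -> locked_on b (fun u => k * lockrot u).
Proof.
move=> bbs; have [rb _ _] := val bbs; split.
  by move=> u ub; rewrite /lockrot !(sum_block _ bbs).
by move=> tb; rewrite /lockrot (sum_block _ bbs)// /bval tb mulr0.
Qed.

Definition be2 (u : site) : R := 8 * K2 * dl ^+ 2 / rcut u ^+ 2.

(** From [e^X <= 1 + X e^X], where X is at most the number of sites because [err <= 1] and
    [K2 dl^2 <= 1]. The squared extent in X is at most [bext b ^ q], so the result is linear in the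
    weight of the block. *)
Lemma block_cost b : b \in bs ->
  expR (K2 * dl ^+ 2 * \sum_(u <- bsites b) errS u ^+ 2) <=
  1 + be2 (broot b) * weight q kappa b.
Proof.
move=> bbs; have -> : \sum_(u <- bsites b) errS u ^+ 2 = (size (bsites b))%:R * err b ^+ 2.
  rewrite big_seq (eq_bigr (fun=> err b ^+ 2)); last first.
    by move=> u ub; rewrite /errS (sum_block _ bbs ub).
  by rewrite -big_seq big_const_seq count_predT iter_addr addr0 mulr_natl.
set k := size (bsites b).
have K20 := mulr_ge0 K2_ge0 (sqr_ge0 dl).
pose X := K2 * dl ^+ 2 * (k%:R * err b ^+ 2).
have X0 : 0 <= X by rewrite mulr_ge0// mulr_ge0 ?sqr_ge0.
have e1 : err b ^+ 2 <= 1 by rewrite exprn_ile1 ?err_ge0 ?err_le1.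
have Xk : X <= k%:R.
  have := ler_pM K20 (mulr_ge0 (ler0n R k) (sqr_ge0 (err b))) K2dl (ler_wpM2l (ler0n R k) e1).
  by rewrite mulr1 mul1r.
have eX : expR X <= 1 + X * expR X.
  have := expR_ge1Dx (- X); rewrite expRN => h1.
  have := ler_wpM2r (expR_ge0 X) h1; rewrite mulVf ?gt_eqF ?expR_gt0//; lra.
apply: (le_trans eX); rewrite lerD2l.
have b1 := ext_ge1 bbs; have r0 := rad_gt0 (broot b).
have kexp : k%:R <= expR k%:R :> R by have := expR_ge1Dx (k%:R : R); lra.
have h1 : X * expR X <= K2 * dl ^+ 2 * (err b ^+ 2 * expR (2 * k%:R)).
  have -> : X * expR X = K2 * dl ^+ 2 * (err b ^+ 2 * (k%:R * expR X)) by rewrite /X; ring.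
  apply: ler_wpM2l => //; apply: ler_wpM2l; first exact: sqr_ge0.
  have -> : 2 * k%:R = k%:R + k%:R :> R by ring.
  by rewrite expRD ler_pM ?expR_ge0 ?ler_expR.
apply: (le_trans h1).
have -> : expR (2 * k%:R) = kappa ^+ k by rewrite /kappa -expRM_natr.
have ext2 : bext b ^+ 2 <= bext b `^ q.
  by rewrite -powR_mulrn ?(le_trans ler01)// ler_powR// ltW.
have errE : err b ^+ 2 = 64 / 9 * (bext b ^+ 2 / rcut (broot b) ^+ 2).
  by rewrite /err; field; rewrite gt_eqF.
have h2 : err b ^+ 2 <= 8 * (bext b `^ q / rcut (broot b) ^+ 2).
  rewrite errE; have : bext b ^+ 2 / rcut (broot b) ^+ 2 <= bext b `^ q / rcut (broot b) ^+ 2.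
    by rewrite ler_wpM2r// invr_ge0 exprn_ge0// ltW.
  have : 0 <= bext b `^ q / rcut (broot b) ^+ 2.
    by rewrite divr_ge0 ?powR_ge0// exprn_ge0// ltW.
  lra.
have kk0 : 0 <= kappa ^+ k by rewrite exprn_ge0// expR_ge0.
have := ler_wpM2l K20 (ler_wpM2r kk0 h2).
rewrite /be2 /weight -/k; set Y := kappa ^+ k; set Z := bext b `^ q.
have -> : 8 * K2 * dl ^+ 2 / rcut (broot b) ^+ 2 * (Y * Z) =
  K2 * dl ^+ 2 * (8 * (Z / rcut (broot b) ^+ 2) * Y) by ring.
by [].
Qed.

Lemma sum_errS : expR (K2 * dl ^+ 2 * \sum_(u <- L) errS u ^+ 2) <=
  finished q kappa be2 bs.
Proof.
have -> : \sum_(u <- L) errS u ^+ 2 = \sum_(b <- bs) \sum_(u <- bsites b) errS u ^+ 2.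
  by rewrite -(perm_big _ cover)/= big_flatten big_map.
rewrite mulr_sumr expR_sum /finished !big_seq; apply: ler_prod => b bbs.
by rewrite expR_ge0 block_cost.
Qed.

End Blocks.

(** The coefficient of a Markov bound: a block longer than a quarter of the radius at its root has
    [be1 * weight >= 1]. *)
Definition be1 (u : site) : R := (4 / rcut u) `^ q.
Let be1_ge0 u : 0 <= be1 u. Proof. exact: powR_ge0. Qed.
Let be2_ge0 u : 0 <= be2 u.
Proof.
rewrite divr_ge0//; last by rewrite exprn_ge0// ltW.
apply: mulr_ge0; last exact: sqr_ge0.
exact: mulr_ge0.
Qed.

Let weight0 b : 0 <= weight q kappa b.
Proof. by apply: mulr_ge0; [rewrite exprn_ge0// expR_ge0|exact: powR_ge0]. Qed.

Let finished_ge1 be bs : (forall u, 0 <= be u) -> 1 <= finished q kappa be bs.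
Proof.
move=> be0; rewrite /finished; elim: bs => [|v V IH]; first by rewrite big_nil.
by rewrite big_cons mulr_ege1// lerDl mulr_ge0.
Qed.

Let finished_mem be bs b : (forall u, 0 <= be u) -> b \in bs ->
  1 + be (broot b) * weight q kappa b <= finished q kappa be bs.
Proof.
move=> be0; elim: bs => // b0 s IH; rewrite inE /finished big_cons => /orP[/eqP <-|/IH h1].
  apply: ler_peMr; last exact: finished_ge1.
  by apply: addr_ge0 => //; exact: mulr_ge0 (be0 _) (weight0 _).
apply: (le_trans h1); apply: ler_peMl; first exact: le_trans ler01 (finished_ge1 _ be0).
by rewrite lerDl; exact: mulr_ge0 (be0 _) (weight0 _).
Qed.

Variables (thb : Omega R) (b0 : R).
Let N (F : Omega R -> R) :=
  `|rint L (fun th => cos (th site0 - b0) * expR (smoothE J L M c th) * F th) thb|.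
Let D (F : Omega R -> R) := rint L (fun th => expR (smoothE J L M c th) * F th) thb.
Let S2 := \sum_(u <- L) rcut u ^- 2.
Let G0 : R := expR (dl * (1 - ln m%:R) + K2 * dl ^+ 2 * S2).

Let bm_E : bm (fun th => expR (smoothE J L M c th)).
Proof. by apply: bm_expR; exact: (bm_smoothE L J0 q0 HQ). Qed.

Let bm_cE : bm (fun th : Omega R => cos (th site0 - b0) * expR (smoothE J L M c th)).
Proof.
apply: bmM => //; apply: bm_cos.
by apply: measurable_funB; [exact: measurable_eval|exact: measurable_cst].
Qed.

Let N_le_D F : bm F -> (forall th, 0 <= F th) -> N F <= D F.
Proof.
move=> bF F0; apply: le_norm_rint; [exact: bmM|exact: bmM|] => th.
rewrite !normrM (ger0_norm (F0 th)) (ger0_norm (expR_ge0 _)).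
apply: ler_wpM2r => //; rewrite ler_piMl ?expR_ge0// ler_norml.
by rewrite cos_geN1 cos_le1.
Qed.

Let D_ge0 F : bm F -> (forall th, 0 <= F th) -> 0 <= D F.
Proof.
move=> bF F0; have h1 := le_rint L thb (bm_cst 0) (bmM bm_E bF).
by move: h1; rewrite rint_cst mul0r; apply=> th; rewrite mulr_ge0 ?expR_ge0.
Qed.

Let leaf_bound bs pre : bs != [::] -> (forall b, b \in bs -> valid (R := R) n b) ->
  perm_eq (flatten (map bsites bs)) L -> admissible L pre bs ->
  N pre <= (finished q kappa be1 bs - 1 + G0 * finished q kappa be2 bs) * D pre.
Proof.
move=> _ val cover [bpre pre0 ppre ipre].
have f1 := finished_ge1 bs be1_ge0; have f2 := finished_ge1 bs be2_ge0.
have G00 : 0 <= G0 := expR_ge0 _.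
have Dp0 := D_ge0 bpre pre0.
have [small|/allPn[b bbs]] := boolP (all (fun b => bext b <= rcut (broot b) / 4) bs); last first.
  (* With a long block no rotation is attempted: the coefficient is at least 1, and the numerator
     never exceeds the denominator. *)
  rewrite -ltNge => big; apply: (le_trans (N_le_D bpre pre0)); rewrite ler_peMl//.
  have r0 := rad_gt0 (broot b).
  have ext0 : 0 < bext b by apply: lt_trans big; rewrite divr_gt0.
  have : 1 <= be1 (broot b) * weight q kappa b.
    rewrite /be1 /weight mulrCA mulr_ege1//.
      by rewrite exprn_ege1// /kappa -expR0 ler_expR.
    rewrite -powRM ?(ltW ext0)// ?divr_ge0 ?(ltW r0)//.
    have h1 : 1 <= 4 / rcut (broot b) * bext b.
      by rewrite mulrAC ler_pdivlMr// mul1r mulrC -ler_pdivrMr// ltW.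
    have := ge0_ler_powR q0 _ _ h1; rewrite powR1 !nnegrE; apply=> //.
    exact: le_trans ler01 h1.
  have := finished_mem be1_ge0 bbs; have := mulr_ge0 G00 (le_trans ler01 f2); lra.
move/allP : small => small.
have := @rint_rotation _ _ _ _ _ J0 q0 HQ M c thb _ (lockrot bs) site0 b0 bpre pre0 ppre.
move=> /(_ _ _) /le_trans; apply.
- move=> s th; apply: ipre => [v vL|b bb]; first by rewrite (locked_out cover) ?mulr0.
  exact: (locked_locks val cover).
- by move=> v; exact: (locked_out cover).
apply: ler_wpM2r => //.
have e1 := total_cost_le val cover small.
have e2 := locked_origin val cover small.
have e3 := sum_errS val cover small.
set E := \sum_(u <- L) _ ^+ 2 in e1 e3.
have cM0 : 0 <= cM by exact: sumr_ge0.
(* The factor [2 cM] of the trigonometric coefficients times [2 K1 dl^2 Q] of the total cost is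
   [K2 dl^2]. *)
apply: (@le_trans _ _ (expR (dl * (1 - ln m%:R) + K2 * dl ^+ 2 * S2 + K2 * dl ^+ 2 * E))).
  rewrite ler_expR; have := ler_wpM2l cM0 e1; move: e2.
  rewrite -/cM -/S2 /K2 -/K1; lra.
rewrite expRD -/G0; have := ler_wpM2l G00 e3; move: f1; lra.
Qed.

Lemma local_cos_bound :
  `|rint L (fun th : Omega R => cos (th site0 - b0) *
       expR (energy (fun s => ptrig M c s + h s) J L th)) thb| <=
  (unexplored t be1 L - 1 + G0 * unexplored t be2 L) *
  rint L (fun th => expR (energy (fun s => ptrig M c s + h s) J L th)) thb.
Proof.
have [v [V LE]] : exists v V, L = v :: V.
  have : site0 \in L by rewrite mem_L.
  by case: L => // v V _; exists v, V.
have eE th := expR_energy J0 Jsym q0 HQ uL M c heven h0eps th.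
have h1 : 1 <= kappa by rewrite /kappa -expR0 ler_expR.
have ND F G : bm F -> bm G -> N (fun th => F th + G th) <= N F + N G.
  move=> bF bG; rewrite /N (eq_rint L thb (G := fun th : Omega R =>
    cos (th site0 - b0) * expR (smoothE J L M c th) * F th +
    cos (th site0 - b0) * expR (smoothE J L M c th) * G th)).
    by rewrite rintD; [exact: ler_normD|exact: bmM|exact: bmM].
  by move=> th; rewrite mulrDr.
have DD F G : bm F -> bm G -> D (fun th => F th + G th) = D F + D G.
  move=> bF bG; rewrite /D -rintD; [|exact: bmM|exact: bmM].
  by apply: eq_rint => th; rewrite mulrDr.
have DZ a F : bm F -> D (fun th => a * F th) = a * D F.
  move=> bF; rewrite /D -rintZ; last exact: bmM.
  by apply: eq_rint => th; rewrite mulrCA.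
have le_D F G : bm F -> bm G -> (forall th, F th <= G th) -> D F <= D G.
  move=> bF bG FG; apply: le_rint; [exact: bmM|exact: bmM|] => th.
  by rewrite ler_wpM2l ?expR_ge0.
have := exploration_bound J0 q0 Q0 HQ uL out_dist ND DD DZ le_D
  (bm_kk J ch h0eps) (bm_kb J0 q0 HQ ch h0eps) (kk_sym Jsym heven)
  (kk_ge0 J0 h0eps) (kb_ge0 J0 q0 HQ h0eps) (kk_le J0 h0eps)
  (kb_le J0 q0 HQ h0eps) (periodic_kk J hper) (periodic_kb J L hper)
  (@kk_rotate _ J h) (@kb_rotate _ J L h) h1 erefl erefl be1_ge0 be2_ge0
  (expR_ge0 _) leaf_bound LE.
set B := _ - 1 + _; clearbody B; rewrite /N /D.
have -> : (fun th : Omega R => cos (th site0 - b0) * expR (smoothE J L M c th) *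
    rest (kk J h) (kb J L h) L th) = (fun th : Omega R => cos (th site0 - b0) *
    expR (energy (fun s => ptrig M c s + h s) J L th)).
  by apply/funext => th; rewrite eE mulrA.
have -> : (fun th : Omega R => expR (smoothE J L M c th) *
    rest (kk J h) (kb J L h) L th) =
    (fun th => expR (energy (fun s => ptrig M c s + h s) J L th)).
  by apply/funext => th; rewrite eE.
by [].
Qed.

End Leaf.

(** * Choice of the constants *)

Section Constants.
Context {R : realType}.

Lemma ln_le_powR (x g : R) : 0 < x -> 0 < g -> ln x <= x `^ g / g.
Proof.
move=> x0 g0; rewrite ler_pdivlMr// mulrC -ln_powR.
have xg : 0 < x `^ g by exact: powR_gt0.
have : ln (1 + (x `^ g - 1)) <= x `^ g - 1.
  by apply: le_ln1Dx; rewrite ltrBrDr addNr.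
by rewrite addrC subrK => /le_trans; apply; rewrite gerBl.
Qed.

Lemma unexplored_le_expR (t : R) (be : site -> R) V : 0 <= t -> (forall u, 0 <= be u) ->
  unexplored t be V <= expR (t * \sum_(u <- V) be u).
Proof.
move=> t0 be0; rewrite mulr_sumr expR_sum; apply: ler_prod => u _.
by rewrite addr_ge0 ?mulr_ge0//= mulrC expR_ge1Dx.
Qed.

(** Splitting q as (q - 2) + 2, the first part is estimated at the smallest radius m and the second
    leaves the sum of inverse squares. *)
Lemma sum_be1_le (q : R) (m : nat) : 2 < q -> (0 < m)%N ->
  \sum_(u <- box (m ^ 2).-1) be1 q m u <=
  4 `^ q * (m%:R `^ (2 - q) * \sum_(u <- box (m ^ 2).-1) rcut m u ^- 2).
Proof.
move=> q2 m0; rewrite !mulr_sumr; apply: ler_sum => u _.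
have mR0 : 0 < m%:R :> R by rewrite ltr0n.
have mr : m%:R <= rcut m u :> R by rewrite ler_nat leq_maxl.
have r0 : 0 < rcut m u := lt_le_trans mR0 mr.
rewrite /be1 powRM// ?invr_ge0 ?(ltW r0)//; apply: ler_wpM2l; first exact: powR_ge0.
rewrite -powR_inv1 ?(ltW r0)// -powRrM mulN1r.
have -> : rcut m u `^ (- q) = rcut m u `^ (2 - q) * rcut m u ^- 2.
  rewrite -powR_mulrn ?(ltW r0)// -powRN -powRD; last by rewrite (gt_eqF r0) implybT.
  by congr (_ `^ _); ring.
apply: ler_wpM2r; first by rewrite invr_ge0 exprn_ge0// ltW.
have -> : 2 - q = - (q - 2) by ring.
rewrite !powRN lef_pV2 ?posrE ?powR_gt0// ge0_ler_powR ?nnegrE// ?ltW//.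
by rewrite subr_gt0.
Qed.

(** [A] stands for the correlation. The trivial bound [A <= 1] disposes of those m for which the
    estimate on long blocks is not yet small. *)
Lemma decay_constants (q Q : R) (M : nat) (c : nat -> R) : 2 < q -> 0 < Q ->
  let t : R := expR 2 * expR 1 in
  let K2 : R := 4 * (\sum_(k <- iota 0 M) `|c k|) * (4 * M%:R ^+ 2 * expR 2) * Q in
  exists dl c0 C : R, [/\ [/\ 0 < dl, M%:R * dl <= 1, M%:R * dl <= q - 2 & K2 * dl ^+ 2 <= 1],
    0 <= c0, 0 < C & forall m, (0 < m)%N -> forall A, A <= 1 ->
    A <= unexplored t (be1 q m) (box (m ^ 2).-1) - 1 +
      expR (dl * (1 - ln m%:R) + K2 * dl ^+ 2 * \sum_(u <- box (m ^ 2).-1) rcut m u ^- 2) *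
      unexplored t (be2 Q m M c dl) (box (m ^ 2).-1) ->
    A <= c0 * m%:R `^ (- C)].
Proof.
move=> q2 Q0 t K2.
have t0 : 0 <= t by rewrite mulr_ge0 ?expR_ge0.
have K20 : 0 <= K2.
  apply: mulr_ge0; last exact: ltW.
  apply: mulr_ge0; first by apply: mulr_ge0 => //; exact: sumr_ge0.
  by apply: mulr_ge0; [rewrite mulr_ge0 ?sqr_ge0|exact: expR_ge0].
(* The coefficient of [dl^2 * S2] in the exponent: [K2] for the profile and [8 t K2] for the locking
   of blocks. *)
pose W := K2 * (1 + 8 * t).
have W0 : 0 <= W by apply: mulr_ge0 => //; rewrite addr_ge0// mulr_ge0.
pose g := (q - 2) / 2.
have g0 : 0 < g by rewrite divr_gt0// subr_gt0.
(* Each summand serves one smallness condition on [dl = Z^-1]; the term [64 * W] makes the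
   logarithmic part of the cost at most half the gain [dl ln m]. *)
pose Z := 1 + M%:R + M%:R / (q - 2) + 64 * W + K2.
have Mq : 0 <= M%:R / (q - 2) by rewrite divr_ge0// subr_ge0 ltW.
have M0 : 0 <= M%:R :> R by [].
have Z1 : 1 <= Z by rewrite /Z; lra.
have Z0 : 0 < Z := lt_le_trans ltr01 Z1.
pose dl := Z^-1.
have dl0 : 0 < dl by rewrite invr_gt0.
have dlZ x : x <= Z -> x * dl <= 1 by move=> xZ; rewrite ler_pdivrMr ?mul1r.
have dl1 : dl <= 1 by rewrite -[dl]mul1r dlZ.
pose Y := t * 4 `^ q * (40 + 32 / g).
have Y0 : 0 <= Y.
  apply: mulr_ge0; first by apply: mulr_ge0 => //; exact: powR_ge0.
  by rewrite addr_ge0// divr_ge0// ltW.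
have W64 : 64 * W * dl <= 1 by apply: dlZ; rewrite /Z; lra.
have C0 : 0 < Num.min g (dl / 2) by rewrite lt_min g0 divr_gt0.
exists dl, (2 * Y + expR (2 * dl)), (Num.min g (dl / 2)); split => //.
- split=> //.
  + by apply: dlZ; rewrite /Z; lra.
  + have : M%:R / (q - 2) * dl <= 1 by apply: dlZ; rewrite /Z; lra.
    by rewrite mulrAC ler_pdivrMr ?subr_gt0// mul1r.
  + have h1 : K2 * dl <= 1 by apply: dlZ; rewrite /Z; lra.
    have h2 : 0 <= K2 * dl by rewrite mulr_ge0// ltW.
    by rewrite expr2 mulrA mulr_ile1// ltW.
- by rewrite addr_ge0 ?expR_ge0// mulr_ge0.
move=> m m0 A A1 AB; set C := Num.min _ _ in C0 *.
have mR1 : 1 <= m%:R :> R by rewrite ler1n.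
have mR0 : 0 < m%:R :> R := lt_le_trans ltr01 mR1.
have lm0 : 0 <= ln m%:R :> R by rewrite ln_ge0.
set L := box (m ^ 2).-1 in AB.
set S2 := \sum_(u <- L) rcut m u ^- 2 in AB.
have S2le : S2 <= 40 + 32 * ln m%:R := sum_inv_sq_box m0.
have mC a : C <= a -> m%:R `^ (- a) <= m%:R `^ (- C) :> R.
  by move=> Ca; rewrite ler_powR// lerN2.
pose y := t * (4 `^ q * (m%:R `^ (2 - q) * (40 + 32 * ln m%:R))).
have yY : y <= Y * m%:R `^ (- C).
  apply: (@le_trans _ _ (Y * m%:R `^ (- g))); last first.
    by apply: ler_wpM2l => //; apply: mC; rewrite ge_min lexx.
  have mg1 : 1 <= m%:R `^ g.
    by rewrite -[leLHS](powRr0 m%:R) ler_powR// ltW.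
  have hl : 40 + 32 * ln m%:R <= (40 + 32 / g) * m%:R `^ g.
    by have := ln_le_powR mR0 g0; lra.
  have -> : Y * m%:R `^ (- g) = t * (4 `^ q * (m%:R `^ (2 - q) * ((40 + 32 / g) * m%:R `^ g))).
    have -> : m%:R `^ (- g) = m%:R `^ (2 - q) * m%:R `^ g :> R.
      rewrite -powRD; last by rewrite (gt_eqF mR0) implybT.
      by congr (_ `^ _); rewrite /g; field.
    rewrite /Y; ring.
  rewrite /y; apply: ler_wpM2l => //; apply: ler_wpM2l; first exact: powR_ge0.
  by apply: ler_wpM2l => //; exact: powR_ge0.
have P0 : 0 <= m%:R `^ (- C) :> R := powR_ge0 _ _.
have e0 : 0 <= expR (2 * dl) := expR_ge0 _.
have eP0 := mulr_ge0 e0 P0.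
(* For y > 1/2 the bound [A <= 1 < 2 y] is enough; otherwise [e^y - 1 <= 2 y]. *)
have [y2|y2] := ltP 2^-1 y; first by apply: (le_trans A1); lra.
apply: (le_trans AB).
have h1 : unexplored t (be1 q m) L <= expR y.
  apply: (le_trans (unexplored_le_expR _ t0 _)); first by move=> u; exact: powR_ge0.
  rewrite ler_expR; apply: ler_wpM2l => //; apply: (le_trans (sum_be1_le q2 m0)).
  by apply: ler_wpM2l; [exact: powR_ge0|apply: ler_wpM2l => //; exact: powR_ge0].
have y0 : 0 <= y.
  apply: mulr_ge0 => //; apply: mulr_ge0; first exact: powR_ge0.
  apply: mulr_ge0; first exact: powR_ge0.
  by rewrite addr_ge0// mulr_ge0.
have ey : expR y <= 1 + 2 * y.
  have := expR_ge1Dx (- y); rewrite expRN => h2.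
  have ey0 := expR_gt0 y.
  have h3 : 1 <= (1 + 2 * y) * (1 - y).
    have : 0 <= y * (1 - 2 * y) by rewrite mulr_ge0//; lra.
    lra.
  have h4 : (1 + 2 * y) * (1 - y) <= (1 + 2 * y) * (expR y)^-1.
    by apply: ler_wpM2l => //; lra.
  by have := le_trans h3 h4; rewrite ler_pdivlMr// mul1r.
have h2 : expR (dl * (1 - ln m%:R) + K2 * dl ^+ 2 * S2) * unexplored t (be2 Q m M c dl) L <=
    expR (2 * dl) * m%:R `^ (- C).
  apply: (@le_trans _ _ (expR (2 * dl) * m%:R `^ (- (dl / 2)))); last first.
    by apply: ler_wpM2l => //; apply: mC; rewrite ge_min lexx orbT.
  have hb : unexplored t (be2 Q m M c dl) L <= expR (t * (8 * K2 * dl ^+ 2 * S2)).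
    apply: (le_trans (unexplored_le_expR _ t0 _)).
      move=> u; rewrite /be2 divr_ge0// ?exprn_ge0//.
      by apply: mulr_ge0; [exact: mulr_ge0|exact: sqr_ge0].
    by rewrite ler_expR; apply: ler_wpM2l => //; rewrite mulr_sumr.
  apply: (le_trans (ler_wpM2l (expR_ge0 _) hb)).
  rewrite /powR (gt_eqF mR0) -!expRD ler_expR.
  have Wd0 : 0 <= W * dl ^+ 2 by rewrite mulr_ge0// sqr_ge0.
  have k1 := ler_wpM2l Wd0 S2le.
  have k2 : 64 * (W * dl ^+ 2) <= dl.
    by have := ler_wpM2r (ltW dl0) W64; rewrite mul1r expr2; lra.
  have k3 := ler_wpM2r lm0 k2.
  have -> : dl * (1 - ln m%:R) + K2 * dl ^+ 2 * S2 + t * (8 * K2 * dl ^+ 2 * S2) =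
    dl - dl * ln m%:R + W * dl ^+ 2 * S2 by rewrite /W; ring.
  lra.
lra.
Qed.

End Constants.

(** * The DLR equations *)

Section SimpleApproximation.
Context {d : measure_display} {T : measurableType d} {R : realType}.

Lemma staircase (n : nat) (y : R) : 0 <= y <= n%:R ->
  y - 1 <= \sum_(j < n) (j.+1%:R <= y)%R%:R <= y.
Proof.
elim: n y => [|n IH] y /andP[y0 yn].
  rewrite big_ord0 y0 andbT; lra.
rewrite big_ord_recr/=; have [yn'|yn'] := leP y n%:R.
  have -> : (n.+1%:R <= y) = false.
    by apply/negbTE; rewrite -ltNge (le_lt_trans yn')// ltr_nat.
  by rewrite addr0; apply: IH; rewrite y0.
rewrite (eq_bigr (fun=> 1)) => [|j _]; last first.
  by rewrite (le_trans _ (ltW yn'))// ler_nat.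
rewrite sumr_const card_ord; rewrite -natr1 in yn *.
by case: (leP (n%:R + 1) y) => h /=; apply/andP; split; lra.
Qed.

(** F is rounded down to a grid of mesh a <= e starting at - K; each level that F reaches adds a. *)
Lemma bm_simple_approx (F : T -> R) e : bm F -> 0 < e ->
  exists n (c : nat -> R) (A : nat -> set T), (forall j, measurable (A j)) /\
    forall x, `|F x - \sum_(j < n) c j * \1_(A j) x| <= e.
Proof.
move=> [mF [K0 FK0]] e0.
pose K := 1 + `|K0|.
have K1 : 1 <= K by rewrite lerDl.
have FK x : `|F x| <= K by rewrite (le_trans (FK0 x))// (le_trans (ler_norm _))// lerDr.
pose n := (Num.trunc (2 * K / e)).+1.
have n0 : 0 < n%:R :> R by rewrite ltr0n.
have ne : 2 * K / e <= n%:R by rewrite ltW// truncnS_gt.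
pose a := 2 * K / n%:R.
have ae : a <= e by rewrite /a ler_pdivrMr// [leRHS]mulrC -ler_pdivrMr.
have a0 : 0 < a by rewrite divr_gt0// mulr_gt0// (lt_le_trans ltr01).
pose A (j : nat) := [set x | - K + j%:R * a <= F x].
exists n.+1, (fun j => if j == 0 then - K else a), (fun j => if j == 0 then setT else A j); split.
  by case=> [|j] //=; rewrite -[A _]setTI; apply: measurable_fun_le.
move=> x; rewrite big_ord_recl/= indicT mulr1.
have -> : \sum_(j < n) a * \1_(A (bump 0 j)) x = a * \sum_(j < n) (j.+1%:R <= (F x + K) / a)%R%:R.
  rewrite -mulr_sumr; congr (_ * _).
  apply: eq_bigr => j _; rewrite indicE ler_pdivlMr// -lerBlDr addrC; congr (nat_of_bool _)%:R.
  by apply/idP/idP; rewrite inE.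
have /staircase : 0 <= (F x + K) / a <= n%:R.
  have := FK x; rewrite ler_norml => /andP[h1 h2].
  rewrite divr_ge0 ?(ltW a0)//=; last by rewrite -lerBlDr sub0r.
  rewrite ler_pdivrMr// /a mulrCA mulfV ?gt_eqF// mulr1; lra.
move=> /andP[]; rewrite lerBlDr ler_pdivrMr// ler_pdivlMr//.
set s := \sum_(j < n) _; move=> h1 h2; rewrite ler_norml; apply/andP; split; lra.
Qed.

End SimpleApproximation.

(** * From the conditional bound to the Gibbs expectation *)

Section Dlr.
Context {R : realType}.
Variables (f : R -> R) (J : site -> R) (mu : probability (Omega R) R) (s : seq site).
Hypothesis gibbs : is_gibbs f J mu.
Hypothesis us : uniq s.
Let W (th : Omega R) := expR (energy f J s th).
Hypothesis bW : bm W.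

Let ex (F : Omega R -> R) := Rintegral mu setT F.
Let cond (F : Omega R -> R) (thb : Omega R) : R :=
  rint s (fun th => F th * W th) thb / rint s W thb.

Let Z_ge0 thb : 0 <= rint s W thb.
Proof.
have := le_rint s thb (bm_cst 0) bW; rewrite rint_cst mul0r; apply=> th; exact: expR_ge0.
Qed.

Let cond_bound F B thb : 0 <= B ->
  `|rint s (fun th => F th * W th) thb| <= B * rint s W thb -> `|cond F thb| <= B.
Proof.
move=> B0 h; rewrite /cond normrM normfV (ger0_norm (Z_ge0 thb)).
(* For a vanishing normalisation the quotient is 0, the inverse of 0 being 0. *)
have := Z_ge0 thb; rewrite le_eqVlt => /orP[/eqP <-|Z0]; first by rewrite invr0 mulr0.
by rewrite ler_pdivrMr.
Qed.

Let cond_norm F B thb : bm F -> (forall th, `|F th| <= B) -> `|cond F thb| <= B.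
Proof.
move=> bF FB; have B0 : 0 <= B := le_trans (normr_ge0 _) (FB thb).
apply: cond_bound => //; rewrite -rintZ//; apply: le_norm_rint; [exact: bmM|exact: bmZ|].
by move=> th; rewrite normrM (ger0_norm (expR_ge0 _)) ler_wpM2r ?expR_ge0.
Qed.

Let bm_cond F : bm F -> bm (cond F).
Proof.
move=> bF; have [_ [B FB]] := bF; split; last by exists B => th; exact: cond_norm.
(* On nonnegative reals the inverse is the power -1, which is a measurable function. *)
rewrite (_ : cond F = fun thb => rint s (fun th => F th * W th) thb * (rint s W thb) `^ (-1)).
  apply: measurable_funM; first by have [] := bm_rint s (bmM bF bW).
  by apply: (measurableT_comp (measurable_powR _)); have [] := bm_rint s bW.
by apply/funext => th; rewrite powR_inv1.
Qed.

Let condD F G : bm F -> bm G -> cond (fun th => F th + G th) = (fun th => cond F th + cond G th).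
Proof.
move=> bF bG; apply/funext => thb; rewrite /cond -mulrDl -rintD; [|exact: bmM|exact: bmM].
by congr (_ / _); apply: eq_rint => th; rewrite mulrDl.
Qed.

Let condZ a F : bm F -> cond (fun th => a * F th) = (fun th => a * cond F th).
Proof.
move=> bF; apply/funext => thb; rewrite /cond mulrA -rintZ; last exact: bmM.
by congr (_ / _); apply: eq_rint => th; rewrite mulrA.
Qed.

Let int_bm F : bm F -> mu.-integrable setT (EFin \o F).
Proof.
move=> bF; apply: integrable_bm => //.
by apply: (@le_lt_trans _ _ 1%E); [exact: probability_le1|exact: ltry].
Qed.

Let exD F G : bm F -> bm G -> ex (fun th => F th + G th) = ex F + ex G.
Proof. by move=> bF bG; apply: RintegralD => //; exact: int_bm. Qed.

Let exZ a F : bm F -> ex (fun th => a * F th) = a * ex F.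
Proof. by move=> bF; apply: RintegralZl => //; exact: int_bm. Qed.

Let ex_norm F B : bm F -> (forall th, `|F th| <= B) -> `|ex F| <= B.
Proof.
move=> bF FB; apply: (le_trans (le_normr_Rintegral _ (int_bm bF))) => //.
have -> : B = Rintegral mu setT (fun=> B).
  rewrite Rintegral_cst// -[LHS]mulr1; congr (_ * _).
  exact: (congr1 fine (esym (probability_setT mu))).
by apply: le_Rintegral => //; [exact: int_bm (bm_norm bF)|exact: int_bm (bm_cst B)].
Qed.

Let ex_cond_indic (A : set (Omega R)) : measurable A -> ex \1_A = ex (cond \1_A).
Proof.
move=> mA; have bA := bm_indic (R := R) mA.
rewrite /ex /Rintegral; congr fine; rewrite integral_indic// setIT.
apply: (etrans (gibbs.2 s us A mA)); apply: eq_integral => thb _; rewrite /gibbs_kernel.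
have -> : (fun th : config R => ((\1_A th) * expR (energy f J s th))%:E) =
   EFin \o (fun th : Omega R => \1_A th * W th) by [].
have -> : (fun th : config R => (expR (energy f J s th))%:E) = EFin \o (W : Omega R -> R) by [].
by rewrite !iintE//; exact: bmM.
Qed.

Let ex_cond_simple n (c : nat -> R) (A : nat -> set (Omega R)) :
  (forall j, measurable (A j)) ->
  let G := fun th => \sum_(j < n) c j * \1_(A j) th in
  bm G /\ ex G = ex (cond G).
Proof.
move=> mA /=; elim: n => [|n [bG eG]].
  rewrite (_ : (fun th => _) = (fun th => 0 * \1_setT th)); last first.
    by apply/funext => th; rewrite big_ord0 mul0r.
  have bT := bm_indic (R := R) (@measurableT _ (Omega R)).
  split; first exact: bmZ.
  by rewrite condZ// !exZ ?mul0r//; exact: bm_cond.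
have bA := bm_indic (R := R) (mA n).
rewrite (_ : (fun th => _) = (fun th => \sum_(j < n) c j * \1_(A j) th + c n * \1_(A n) th)); last first.
  by apply/funext => th; rewrite big_ord_recr.
have bAZ := bmZ (c n) bA.
split; first exact: bmD.
rewrite condD// !exD//; [|exact: bm_cond|exact: bm_cond].
rewrite condZ// !exZ//; last exact: bm_cond.
by rewrite eG ex_cond_indic.
Qed.

(** The DLR equations speak of events. They extend to [F] by uniform approximation with simple
    functions, for which the expectation and the averaged conditional expectation agree; the
    approximation moves either of them by at most e / 2. *)
Lemma gibbs_expectation_bound (F : Omega R -> R) B : bm F -> 0 <= B ->
  (forall thb, `|rint s (fun th => F th * expR (energy f J s th)) thb| <=
    B * rint s (fun th => expR (energy f J s th)) thb) ->
  `|Rintegral mu setT F| <= B.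
Proof.
move=> bF B0 h; apply/ler_addgt0Pl => e e0.
have e2 : 0 < e / 2 by rewrite divr_gt0.
have [n [c [A [mA FA]]]] := bm_simple_approx bF e2.
have [bG eG] := ex_cond_simple n c mA.
pose G (th : Omega R) := \sum_(j < n) c j * \1_(A j) th.
rewrite -/G in bG eG.
have bH : bm (fun th => F th + (-1) * G th) by apply: bmD => //; exact: bmZ.
have HI th : `|F th + (-1) * G th| <= e / 2 by rewrite mulN1r; exact: FA.
have e1 := ex_norm bH HI.
have e3 := ex_norm (bm_cond bH) (fun th => cond_norm th bH HI).
have e4 : `|ex (cond F)| <= B by apply: ex_norm => [|th]; [exact: bm_cond|exact: cond_bound].
have bcF := bm_cond bF; have bcG := bm_cond bG.
move: e1 e3; rewrite condD ?condZ//; last exact: bmZ.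
rewrite !exD ?exZ//; [|exact: bmZ|exact: bmZ].
rewrite -eG -/(ex F); move: e4; rewrite !ler_norml => /andP[? ?] /andP[? ?] /andP[? ?].
apply/andP; split; lra.
Qed.

End Dlr.

(** * Decay of correlations *)

Section FiniteVolume.
Context {R : realType}.

Lemma unexplored_ge1 (t : R) (be : site -> R) V : 0 <= t -> (forall u, 0 <= be u) ->
  1 <= unexplored t be V.
Proof.
move=> t0 be0; rewrite /unexplored; elim: V => [|v V IH]; first by rewrite big_nil.
by rewrite big_cons mulr_ege1// lerDl mulr_ge0.
Qed.

Lemma bm_expR_energy (J : site -> R) (q Q : R) (L : seq site) (M : nat) (c : nat -> R)
    (h : R -> R) (eps : R) :
  (forall x, 0 <= J x) -> (forall u v, J (sub_site u v) = J (sub_site v u)) -> 0 <= q ->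
  (forall (u : site) (l : seq site), uniq l ->
    \sum_(v <- l | v != u) J (sub_site u v) * (1 + (dist u v)%:R) `^ q <= Q) ->
  uniq L -> continuous h -> (forall t, h (- t) = h t) -> (forall t, 0 <= h t <= eps) ->
  bm (fun th : Omega R => expR (energy (fun t => ptrig M c t + h t) J L th)).
Proof.
move=> J0 Jsym q0 HQ uL ch heven h0eps.
apply: (@eq_bm _ _ _ (fun th : Omega R => expR (smoothE J L M c th) *
  (\prod_(u <- L | u \in L) (1 + kb J L h u th) *
   \prod_(p <- pairs L) (1 + kk J h p.1 p.2 th)))).
  by move=> th; rewrite (expR_energy J0 Jsym q0 HQ uL M c heven h0eps) -big_seq.
apply: bmM; first by apply: bm_expR; exact: (bm_smoothE L J0 q0 HQ).
apply: bmM.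
  by apply: bm_prod => u ul; apply: bmD; [exact: bm_cst|exact: (bm_kb J0 q0 HQ ch h0eps)].
by apply: bm_prod => p _; apply: bmD; [exact: bm_cst|exact: (bm_kk J ch h0eps)].
Qed.

End FiniteVolume.

Lemma sqrtn_floor (N : nat) : exists m, (m ^ 2 <= N < m.+1 ^ 2)%N.
Proof.
elim: N => [|N [m /andP[h1 h2]]]; first by exists 0.
have [h|h] := leqP (m.+1 ^ 2) N.+1.
  by exists m.+1; move: h1 h2 h; rewrite -!mulnn; lia.
by exists m; rewrite h andbT leqW.
Qed.

Theorem theorem1 (R : realType) (f : R -> R) (J : site -> R) :
  couplings J -> A1 J -> A2 f ->
  exists (c C : R), 0 < C /\
    forall mu : probability (Omega R) R, is_gibbs f J mu ->
      forall x : site, x != site0 ->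
        `| Rintegral mu setT (fun th : Omega R => cos (th site0 - th x)) |
          <= c * ((norminf x)%:~R `^ (- C)).
Proof.
move=> cJ A1J [cf [fper feven]].
have [Jeven [J0 _]] := cJ.
have Jsym u v : J (sub_site u v) = J (sub_site v u).
  by rewrite [LHS]Jeven; congr J; rewrite /sub_site/= !sub0r !opprB.
have [q [Q [q2 Q0 HQ]]] := moment_bound cJ A1J.
have q0 : 0 <= q by rewrite (le_trans _ (ltW q2)).
pose t : R := expR 2 * expR 1; pose eps : R := (2 * t * Q)^-1.
have t0 : 0 < t by rewrite mulr_gt0 ?expR_gt0.
have eps0 : 0 < eps by rewrite invr_gt0 !mulr_gt0.
(* Approximating [f - eps / 2] within [eps / 2] places the remainder [f - ptrig] in [0, eps]. *)
have [M [c fc]] : exists M (c : nat -> R), forall s, `|f s - eps / 2 - \sum_(k < M) c k * cos (k%:R * s)| <= eps / 2.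
  apply: (@trig_approx R (fun s => f s - eps / 2)); last by rewrite divr_gt0.
  split; last by split=> s; rewrite ?fper ?feven.
  by move=> s; apply: cvgB; [exact: cf|exact: cvg_cst].
pose h s := f s - ptrig M c s.
have pE s : ptrig M c s = \sum_(k < M) c k * cos (k%:R * s).
  by rewrite /ptrig -[M in iota 0 M]subn0 big_mkord.
have h0eps s : 0 <= h s <= eps.
  by have := fc s; rewrite -pE ler_norml /h => /andP[? ?]; apply/andP; split; lra.
have pcont : continuous (ptrig M c).
  move=> s; rewrite /ptrig; apply: cvg_sumr => k _.
  apply: cvgM; first exact: cvg_cst.
  apply: continuous_comp; last exact: continuous_cos.
  by apply: cvgM; [exact: cvg_cst|exact: cvg_id].
have ch : continuous h by move=> s; apply: cvgB; [exact: cf|exact: pcont].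
have heven s : h (- s) = h s by rewrite /h ptrig_even feven.
have hper s : h (s + 2 * pi) = h s.
  rewrite /h fper; congr (_ - _); apply: eq_bigr => k _; congr (_ * _).
  rewrite mulrDr; apply: (periodicz (Posz k)) => r.
  by rewrite mulr_natl cosD2pi.
have fE : f = (fun s => ptrig M c s + h s) by apply/funext => s; rewrite addrC subrK.
have [dl [c0 [C [[dl0 Mdl1 Mdlq K2dl] c00 C0 decay]]]] := decay_constants M c q2 Q0.
(* The factor 4^(C / 2) and the halved exponent translate a power of m into one of |x|, by
   [|x| < (m + 1) ^ 2 <= 4 m ^ 2]. *)
exists (c0 * expR (C / 2 * ln 4)), (C / 2); split; first by rewrite divr_gt0.
move=> mu gibbs x x0.
have [m /andP[mx xm]] := sqrtn_floor (nrm x).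
have nx0 : (0 < nrm x)%N by rewrite lt0n nrm_eq0.
have m0 : (0 < m)%N by case: m xm {mx} => //; rewrite ltnS leqn0 nrm_eq0 (negbTE x0).
(* The box stops at radius [m ^ 2 - 1], so that [m ^ 2 <= |x|] leaves x outside. *)
pose L := box (m ^ 2).-1.
have xL : x \notin L by rewrite mem_L// -leqNgt.
have bW := bm_expR_energy M c J0 Jsym q0 HQ (uniq_box (m ^ 2).-1) ch heven h0eps.
rewrite -fE in bW.
pose F (th : Omega R) := cos (th site0 - th x).
have bF : bm F.
  by apply: bm_cos; apply: measurable_funB; exact: measurable_eval.
have F1 th : `|F th| <= 1 by rewrite ler_norml cos_geN1 cos_le1.
have E1 : `|Rintegral mu setT F| <= 1.
  apply: (gibbs_expectation_bound gibbs (uniq_box (m ^ 2).-1) bW bF) => // thb.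
  rewrite mul1r; apply: le_norm_rint => [||th]; [exact: bmM|exact: bW|].
  by rewrite normrM (ger0_norm (expR_ge0 _)) ler_piMl ?expR_ge0.
have := decay m m0 _ E1.
set B := _ - 1 + _.
have B0 : 0 <= B.
  rewrite addr_ge0 ?subr_ge0 ?unexplored_ge1 ?(ltW t0)//.
    by move=> u; exact: powR_ge0.
  apply: mulr_ge0; first exact: expR_ge0.
  apply: (le_trans ler01); apply: unexplored_ge1 => [|u]; first exact: ltW.
  rewrite /be2 divr_ge0 ?exprn_ge0//; apply: mulr_ge0; last exact: sqr_ge0.
  apply: mulr_ge0 => //; apply: mulr_ge0; last exact: ltW.
  apply: mulr_ge0; first by apply: mulr_ge0 => //; exact: sumr_ge0.
  by apply: mulr_ge0; [rewrite mulr_ge0 ?sqr_ge0|exact: expR_ge0].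
have EB : `|Rintegral mu setT F| <= B.
  apply: (gibbs_expectation_bound gibbs (uniq_box (m ^ 2).-1) bW bF) => // thb.
  (* Off the box the spin at x equals its boundary value [thb x], which serves as the fixed angle
     [b0]. *)
  have := local_cos_bound J0 Jsym q2 Q0 HQ m0 ch hper heven h0eps dl0 Mdl1 Mdlq K2dl thb (thb x).
  rewrite -fE -/B => hB; apply: le_trans hB; rewrite le_eqVlt; apply/orP; left; apply/eqP.
  by congr Num.norm; apply: eq_rint_off => th thE; rewrite /F (thE x xL).
move=> /(_ EB) /le_trans; apply.
rewrite -mulrA; apply: ler_wpM2l => //.
have N0 : 0 < (nrm x)%:R :> R by rewrite ltr0n.
have mR0 : 0 < m%:R :> R by rewrite ltr0n.
have -> : (norminf x)%:~R = (nrm x)%:R :> R by rewrite norminfE.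
rewrite /powR (gt_eqF N0) (gt_eqF mR0) -expRD ler_expR.
have : ln (nrm x)%:R <= ln (4 * m%:R ^+ 2) :> R.
  rewrite ler_ln ?posrE ?mulr_gt0 ?exprn_gt0// -natrX -natrM ler_nat.
  apply: (leq_trans (ltnW xm)); rewrite -(expnMn 2 m 2) leq_exp2r//.
  by rewrite mul2n -addnn -addn1 leq_add2l.
rewrite lnM ?posrE ?exprn_gt0// lnXn// mulr2n => hN.
have C20 : 0 <= C / 2 by rewrite divr_ge0// ltW.
have := ler_wpM2l C20 hN; lra.
Qed.
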